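(* Let $(M,g,J)$ be a Kähler surface (real dimension $4$), and let $\mathcal{D}$ be an integrable $J$-invariant distribution of real rank $2$ on $M$. Let $I$ be the opposite almost Hermitian structure defined by $\mathcal{D}$, i.e. $I|_{\mathcal{D}}=J|_{\mathcal{D}}$ and $I|_{\mathcal{D}^{\perp}}=-J|_{\mathcal{D}^{\perp}}$. Assume that $(M,g,I)$ is Hermitian, is not Kähler, and is conformally Kähler, so that its Lee form $\theta$, defined by $d\omega_I=2\theta\wedge\omega_I$, satisfies $\theta=du$ for some smooth function $u:M\to\mathbb{R}$. Let $U=\{x\in M:\theta_x\neq 0\}$. Then the Kähler surface $(U,g|_U,J|_U)$ is of Calabi type, and $(M,g,J)$ admits a special Kähler-Ricci potential.
   Context: Manifolds and structures are smooth. For an orthogonal almost complex structure $I$ on $(M,g)$, $\omega_I(X,Y)=g(IX,Y)$ is its Kähler form. $(M,g,I)$ is Hermitian if $I$ is an integrable complex structure orthogonal with respect to $g$, and it is Kähler if in addition $d\omega_I=0$. On a Kähler surface $(M,g,J)$, an (almost) Hermitian structure $I$ is called opposite if it induces the orientation opposite to that of $J$, i.e. $\omega_I^2=-\omega_J^2$. The Lee form $\theta$ of a Hermitian surface $(M,g,I)$ is the $1$-form determined by $d\omega_I=2\theta\wedge\omega_I$. The Hermitian surface is conformally Kähler if $g$ is globally conformal to a metric that is Kähler with respect to $I$; equivalently, $\theta=du$ for a smooth function $u$ on $M$. A Kähler surface $(N,g,J)$ is called of Calabi type if it has a nowhere vanishing holomorphic Killing vector field $X$ such that, for the distribution $\mathcal{D}_X=\mathrm{span}\{X,JX\}$,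 the almost Hermitian structure $I_X$ given by $I_X=J$ on $\mathcal{D}_X$ and $I_X=-J$ on $\mathcal{D}_X^{\perp}$ is Hermitian and conformally Kähler. A function $\tau$ on a Kähler manifold $(M,g,J)$ is a Killing potential if $J\nabla\tau$ is a Killing vector field. A special Kähler-Ricci potential on $(M,g,J)$ is a nonconstant Killing potential $\tau$ such that, at every point where $d\tau\neq 0$, all nonzero tangent vectors orthogonal to both $\nabla\tau$ and $J\nabla\tau$ are eigenvectors of both the Hessian $\nabla d\tau$ and the Ricci tensor $Ric$ (both regarded as endomorphisms via $g$). *)

(* Defs.v *)
From HB Require Import structures.
From mathcomp Require Import all_boot all_order all_algebra.
From mathcomp Require Import all_classical all_reals all_analysis.

Set Implicit Arguments.
Unset Strict Implicit.
Unset Printing Implicit Defensive.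

Import Order.TTheory GRing.Theory Num.Theory.
Import numFieldNormedType.Exports.

Local Open Scope classical_set_scope.
Local Open Scope ring_scope.

(** Vectors are row vectors and endomorphisms act on the right: the matrix of
    [A] has as its [i]-th row the image of the [i]-th basis vector.
    Real dimension is fixed to 4. *)

Section Euclidean.
Context {R : realType}.
Implicit Types (U : set 'rV[R]_4) (f : 'rV[R]_4 -> R).

Definition basis_vec (i : 'I_4) : 'rV[R]_4 := delta_mx 0 i.

(** Class C^k on an open set, by iterated partial derivatives. *)
Fixpoint Ck (k : nat) U f : Prop :=
  match k with
  | 0%N => forall p, U p -> {for p, continuous f}
  | k'.+1 => forall i : 'I_4,
      (forall p, U p -> derivable f p (basis_vec i)) /\
      Ck k' U ('D_(basis_vec i) f)
  end.

Definition Csmooth U f : Prop := forall k, Ck k U f.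

(** The complex structure of C^2 = R^4 with complex coordinates
    z_1 = x_0 + i x_2 and z_2 = x_1 + i x_3. *)
Definition std_complex : 'M[R]_4 :=
  block_mx (0 : 'M[R]_2) (1%:M : 'M[R]_2) (- 1%:M : 'M[R]_2) (0 : 'M[R]_2).

End Euclidean.

Record chart (R : realType) (T : topologicalType) := Chart {
  cdom : set T;
  cmap : T -> 'rV[R]_4;
  cinv : 'rV[R]_4 -> T;
  cdom_open : open cdom;
  cimg_open : open (cmap @` cdom);
  cmapK : forall x, cdom x -> cinv (cmap x) = x;
  cmap_continuous : forall x, cdom x -> {for x, continuous cmap};
  cinv_continuous : forall p, (cmap @` cdom) p -> {for p, continuous cinv}
}.

Section Charts.
Context {R : realType} {T : topologicalType}.

Definition coord (c : chart R T) (i : 'I_4) (x : T) : R := cmap c x 0 i.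

Definition smooth_transition (c c' : chart R T) : Prop :=
  forall i, Csmooth (cmap c @` (cdom c `&` cdom c')) (coord c' i \o cinv c).

End Charts.

(** A smooth 4-manifold, with a preferred chart around each point; the atlas
    is the set of preferred charts. *)
Record manifold4 (R : realType) := Manifold4 {
  carrier :> topologicalType;
  manifold_hausdorff : hausdorff_space carrier;
  manifold_second_countable : @second_countable carrier;
  chart_at : carrier -> chart R carrier;
  chart_at_dom : forall x, cdom (chart_at x) x;
  chart_at_smooth : forall x y, smooth_transition (chart_at x) (chart_at y)
}.

(** The tangent space at [x] is identified with R^4 by the preferred chart
    [chart_at x].  Thus vector fields are maps [M -> 'rV_4], 1-forms are maps
    [M -> 'cV_4], and bilinear forms and endomorphism fields are maps
    [M -> 'M_4], all read at [x] in the chart [chart_at x]; these maps need not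
    be continuous, since [chart_at x] may jump with [x].  Structures on an open
    submanifold [U] are given by such maps, only their values on [U] being
    relevant: the argument [U] below is always meant to be open. *)
Section Manifold.
Context {R : realType} {M : manifold4 R}.
Implicit Types (U V : set M) (f tau : M -> R) (X Y Z : M -> 'rV[R]_4).
Implicit Types (theta : M -> 'cV[R]_4) (g B J I D : M -> 'M[R]_4).

Definition smooth_fun U f : Prop :=
  forall y : M, Csmooth (cmap (chart_at y) @` (U `&` cdom (chart_at y)))
                        (f \o cinv (chart_at y)).

(** The derivative at [x] of [f] along the tangent vector [v] at [x]. *)
Definition tangent_deriv (x : M) (v : 'rV[R]_4) f : R :=
  'D_v (f \o cinv (chart_at x)) (cmap (chart_at x) x).

(** The function X(f). *)
Definition lie_fun X f : M -> R := fun x => tangent_deriv x (X x) f.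

(** The differential at [x] of (the coordinate map of) a chart [c]. *)
Definition chart_diff (c : chart R M) (x : M) (v : 'rV[R]_4) : 'rV[R]_4 :=
  \row_j tangent_deriv x v (coord c j).

(** Smoothness of the components of [X] in all charts. *)
Definition smooth_vf U X : Prop :=
  forall (y : M) (i : 'I_4),
    smooth_fun (U `&` cdom (chart_at y)) (lie_fun X (coord (chart_at y) i)).

(** [X(Y f) - Y(X f)] for [f] the coordinates of the preferred chart. *)
Definition bracket X Y : M -> 'rV[R]_4 := fun x =>
  \row_j (lie_fun X (lie_fun Y (coord (chart_at x) j)) x
          - lie_fun Y (lie_fun X (coord (chart_at x) j)) x).

(** The [i]-th coordinate vector field of [chart_at x], near [x]. *)
Definition coord_vf (x : M) (i : 'I_4) : M -> 'rV[R]_4 := fun z =>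
  \row_j 'D_(basis_vec i) (coord (chart_at z) j \o cinv (chart_at x))
           (cmap (chart_at x) z).

Definition form_app theta X : M -> R := fun x => (X x *m theta x) 0 0.

Definition bil_app B X Y : M -> R := fun x => (X x *m B x *m (Y x)^T) 0 0.

Definition endo_app J X : M -> 'rV[R]_4 := fun x => X x *m J x.

Definition smooth_form U theta : Prop :=
  forall V X, open V -> V `<=` U -> smooth_vf V X ->
    smooth_fun V (form_app theta X).

Definition smooth_bil U B : Prop :=
  forall V X Y, open V -> V `<=` U -> smooth_vf V X -> smooth_vf V Y ->
    smooth_fun V (bil_app B X Y).

Definition smooth_endo U J : Prop :=
  forall V X, open V -> V `<=` U -> smooth_vf V X -> smooth_vf V (endo_app J X).

Definition differential tau : M -> 'cV[R]_4 := fun x =>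
  \col_i tangent_deriv x (basis_vec i) tau.

(** * Exterior calculus.  The conventions for [d] and for the wedge product are
    the matching ones without normalizing factors. *)

Definition ext_d2 B X Y Z : M -> R := fun x =>
  lie_fun X (bil_app B Y Z) x - lie_fun Y (bil_app B X Z) x
  + lie_fun Z (bil_app B X Y) x
  - bil_app B (bracket X Y) Z x + bil_app B (bracket X Z) Y x
  - bil_app B (bracket Y Z) X x.

Definition wedge12 theta B X Y Z : M -> R := fun x =>
  form_app theta X x * bil_app B Y Z x + form_app theta Y x * bil_app B Z X x
  + form_app theta Z x * bil_app B X Y x.

(** * Hermitian and Kähler structures *)

Definition riemannian U g : Prop :=
  [/\ smooth_bil U g,
      forall x, U x -> (g x)^T = g x
    & forall x, U x -> forall v : 'rV[R]_4, v != 0 -> 0 < (v *m g x *m v^T) 0 0].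

Definition almost_complex U J : Prop :=
  smooth_endo U J /\ forall x, U x -> J x *m J x = - 1%:M.

Definition orthogonal_endo U g J : Prop :=
  forall x, U x -> J x *m g x *m (J x)^T = g x.

(** A chart of the maximal smooth atlas. *)
Definition compatible_chart (c : chart R M) : Prop :=
  forall y, smooth_transition c (chart_at y) /\ smooth_transition (chart_at y) c.

(** Existence of local holomorphic coordinates for [J]. *)
Definition integrable_complex U J : Prop :=
  forall x, U x -> exists c : chart R M,
    [/\ compatible_chart c, cdom c x
      & forall z, U z -> cdom c z -> forall v : 'rV[R]_4,
          chart_diff c z (v *m J z) = chart_diff c z v *m std_complex].

Definition hermitian_structure U g J : Prop :=
  [/\ riemannian U g, almost_complex U J, orthogonal_endo U g J
    & integrable_complex U J].

(** omega_J(X, Y) = g(JX, Y). *)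
Definition kahler_form g J : M -> 'M[R]_4 := fun x => J x *m g x.

Definition closed_form2 U B : Prop :=
  forall V X Y Z, open V -> V `<=` U ->
    smooth_vf V X -> smooth_vf V Y -> smooth_vf V Z ->
    forall x, V x -> ext_d2 B X Y Z x = 0.

Definition kahler U g J : Prop :=
  hermitian_structure U g J /\ closed_form2 U (kahler_form g J).

Definition lee_form U g J theta : Prop :=
  smooth_form U theta /\
  forall V X Y Z, open V -> V `<=` U ->
    smooth_vf V X -> smooth_vf V Y -> smooth_vf V Z ->
    forall x, V x -> ext_d2 (kahler_form g J) X Y Z x
                     = 2 * wedge12 theta (kahler_form g J) X Y Z x.

Definition conformally_kahler U g J : Prop :=
  exists phi : M -> R,
    [/\ smooth_fun U phi, forall x, U x -> 0 < phi x
      & kahler U (fun x => phi x *: g x) J].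

(** * Distributions, represented by the row spaces of the matrices [D x] *)

Definition rank2_distribution U D : Prop :=
  (forall x, U x -> \rank (D x) = 2%N) /\
  forall x, U x -> exists V X Y,
    [/\ open V, V x, smooth_vf V X, smooth_vf V Y
      & forall z, U z -> V z -> (D z == X z + Y z)%MS].

Definition invariant_distribution U J D : Prop :=
  forall x, U x -> (D x *m J x <= D x)%MS.

(** Around each point there are coordinates such that the surfaces on which
    the last two of them are constant are integral manifolds of [D]. *)
Definition integrable_distribution U D : Prop :=
  forall x, U x -> exists c : chart R M,
    [/\ compatible_chart c, cdom c x
      & forall z, U z -> cdom c z -> forall v : 'rV[R]_4,
          (v <= D z)%MS <->
          rsubmx (chart_diff c z v : 'rV[R]_(2 + 2)) = 0].

(** [I] is [J] on [D] and [- J] on the orthogonal complement of [D]. *)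
Definition opposite_structure U g J D I : Prop :=
  forall x, U x -> forall v : 'rV[R]_4,
    ((v <= D x)%MS -> v *m I x = v *m J x) /\
    ((forall w : 'rV[R]_4, (w <= D x)%MS -> (v *m g x *m w^T) 0 0 = 0) ->
     v *m I x = - (v *m J x)).

(** * Kähler surfaces of Calabi type *)

(** L_X g = 0. *)
Definition killing U g X : Prop :=
  smooth_vf U X /\
  forall V Y Z, open V -> V `<=` U -> smooth_vf V Y -> smooth_vf V Z ->
    forall x, V x ->
      lie_fun X (bil_app g Y Z) x
      - bil_app g (bracket X Y) Z x - bil_app g Y (bracket X Z) x = 0.

(** L_X J = 0. *)
Definition holomorphic_vf U J X : Prop :=
  smooth_vf U X /\
  forall V Y, open V -> V `<=` U -> smooth_vf V Y ->
    forall x, V x -> bracket X (endo_app J Y) x = endo_app J (bracket X Y) x.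

Definition complex_span J X : M -> 'M[R]_4 := fun x =>
  (X x + X x *m J x)%MS.

Definition calabi_type U g J : Prop :=
  kahler U g J /\
  exists X I,
    [/\ forall x, U x -> X x != 0,
        holomorphic_vf U J X /\ killing U g X,
        opposite_structure U g J (complex_span J X) I,
        hermitian_structure U g I
      & conformally_kahler U g I].

(** * Levi-Civita connection, Hessian, Ricci tensor *)

(** By Koszul's formula such a [nabla] is unique on locally defined smooth
    vector fields; in particular it is local. *)
Definition levi_civita g (nabla : (M -> 'rV[R]_4) -> (M -> 'rV[R]_4) ->
                                  (M -> 'rV[R]_4)) : Prop :=
  forall V X Y Z f, open V ->
    smooth_vf V X -> smooth_vf V Y -> smooth_vf V Z -> smooth_fun V f ->
    smooth_vf V (nabla X Y) /\
    forall x, V x ->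
      [/\ nabla (fun z => X z + Y z) Z x = nabla X Z x + nabla Y Z x
          /\ nabla (fun z => f z *: X z) Y x = f x *: nabla X Y x,
          nabla X (fun z => Y z + Z z) x = nabla X Y x + nabla X Z x,
          nabla X (fun z => f z *: Y z) x
            = lie_fun X f x *: Y x + f x *: nabla X Y x,
          nabla X Y x - nabla Y X x = bracket X Y x
        & lie_fun X (bil_app g Y Z) x
            = bil_app g (nabla X Y) Z x + bil_app g Y (nabla X Z) x].

Definition curvature (nabla : (M -> 'rV[R]_4) -> (M -> 'rV[R]_4) ->
                              (M -> 'rV[R]_4)) X Y Z : M -> 'rV[R]_4 := fun x =>
  nabla X (nabla Y Z) x - nabla Y (nabla X Z) x - nabla (bracket X Y) Z x.

(** Ric(Y, Z) is the trace of X |-> R(X, Y)Z, here for coordinate vector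
    fields; at [x] the vector [coord_vf x i x] is [basis_vec i]. *)
Definition ricci (nabla : (M -> 'rV[R]_4) -> (M -> 'rV[R]_4) ->
                          (M -> 'rV[R]_4)) : M -> 'M[R]_4 := fun x =>
  \matrix_(j, k) \sum_i
     curvature nabla (coord_vf x i) (coord_vf x j) (coord_vf x k) x 0 i.

(** (nabla d tau)(Y, Z) = Y(Z tau) - (nabla_Y Z) tau. *)
Definition hessian (nabla : (M -> 'rV[R]_4) -> (M -> 'rV[R]_4) ->
                            (M -> 'rV[R]_4)) tau : M -> 'M[R]_4 := fun x =>
  \matrix_(j, k)
     (lie_fun (coord_vf x j) (lie_fun (coord_vf x k) tau) x
      - lie_fun (nabla (coord_vf x j) (coord_vf x k)) tau x).

(** The endomorphism [A] such that g(A v, w) = B(v, w). *)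
Definition endo_of_bil g B : M -> 'M[R]_4 := fun x => B x *m invmx (g x).

Definition gradient g tau : M -> 'rV[R]_4 := fun x =>
  (differential tau x)^T *m invmx (g x).

Definition eigenvector (A : 'M[R]_4) (v : 'rV[R]_4) : Prop :=
  v != 0 /\ exists a : R, v *m A = a *: v.

(** * Special Kähler-Ricci potentials *)

Definition killing_potential g J tau : Prop :=
  smooth_fun setT tau /\ killing setT g (endo_app J (gradient g tau)).

Definition special_kahler_ricci_potential g J tau : Prop :=
  [/\ kahler setT g J,
      killing_potential g J tau,
      exists x y : M, tau x != tau y
    & exists nabla, levi_civita g nabla /\
      forall x : M, differential tau x != 0 ->
      forall v : 'rV[R]_4, v != 0 ->
        (v *m g x *m (gradient g tau x)^T) 0 0 = 0 ->
        (v *m g x *m (gradient g tau x *m J x)^T) 0 0 = 0 ->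
        eigenvector (endo_of_bil g (hessian nabla tau) x) v /\
        eigenvector (endo_of_bil g (ricci nabla) x) v].

End Manifold.

(* Main.v *)
Require Import Defs.
From HB Require Import structures.
From mathcomp Require Import all_boot all_order all_algebra.
From mathcomp Require Import all_classical all_reals all_analysis.
From mathcomp Require Import ring lra.
Set Implicit Arguments.
Unset Strict Implicit.
Unset Printing Implicit Defensive.
Import Order.TTheory GRing.Theory Num.Theory.
Import numFieldNormedType.Exports.
Local Open Scope classical_set_scope.
Local Open Scope ring_scope.

(** Let [xi] be the gradient of [u], [N] its covariant derivative, [n] the square
    norm of [xi], [a] half the trace of [N], and [D] the kernel of [I - J].  The
    potential is [exp u], and its rotated gradient [J grad (exp u)] is the vector
    field that exhibits the Calabi type.

    The covariant derivative of an integrable [I] is determined by the exterior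
    derivative of its Kähler form.  Hence [J] is parallel ([cov_J]), and that of
    [I] is an explicit expression in [du] and [xi] ([cov_lee]).  Involutivity of
    [D] says that [Z (nabla_Y I)] is symmetric in [Y] and [Z] along [D], which
    forces [xi] to be tangent to [D] ([lee_vector_inD]).

    Wherever [du] is nonzero, [xi] and [J xi] frame [D].  Differentiating
    [xi (I - J) = 0] shows that [N] preserves [D] and is multiplication by [n / 2]
    on its orthogonal complement ([hessian_inD], [hessian_inP]), and
    [N J + J N = a J + (a - n) I] ([ddc_form]).  Multiplied by the metric, the
    left-hand side becomes an exact 2-form, [- d(J du)].  Closedness of the
    right-hand side gives [da = 0] on the complement of [D] and
    [dn = 2 (a - n) du] ([alpha_inP], [dn_theta]).  These say that [xi] and [J xi]
    are eigenvectors of [N], and that [N + du (x) xi] is [n / 2] on the complement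
    of [D] and [a] on [D] ([hessian_normal_form]).  Up to the factor [exp u] this
    operator is the Hessian of [exp u].  It commutes with [J] where [du] is
    nonzero, and on the rest of [M] by continuity ([shape_comm]).  A gradient
    whose Hessian commutes with [J] has a Killing and holomorphic rotation
    ([killing_hat], [holomorphic_hat]).  On the set where [du] is nonzero the
    rotated gradient spans [D] together with its image by [J], so that the
    opposite structure it defines is [I], which is conformally Kähler by
    assumption.

    The complement of [D] is an eigenspace of the Hessian of [exp u] by the normal
    form.  For the Ricci tensor, the Ricci identity expresses the curvature applied
    to [xi] by the covariant derivative of [N], computed from the normal form; its
    contraction gives [Ric (Y, xi) = 0] for [Y] orthogonal to [D]
    ([ric_xi_inP]).  Since Ric is symmetric and [J]-invariant, it then preserves
    the complement of [D], and on that plane it is a multiple of the metric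
    ([ric_inP_eigen]).  Finally [u] is not constant, since otherwise the Lee form
    would vanish and [(g, I)] would be Kähler.

    All identities are proved for matrices at one point, then for matrix-valued
    functions on an open set of R^4 satisfying [local_geometry], and transferred
    to [M] by reading every field in a chart ([local_geometry_hat]).  The
    Levi-Civita connection is defined by Christoffel symbols in the preferred
    chart at each point, and Koszul's formula shows that it does not depend on the
    chart ([nabla_hat]). *)

Local Notation "''e_' i" := (basis_vec i)
  (at level 8, i at level 2, format "''e_' i").

(** * Smooth functions on R^4 *)

Section Calculus.
Context {R : realType}.
Notation E := 'rV[R]_4.

Lemma coord_le_norm (h : E) (j : 'I_4) : `|h 0 j| <= `|h|.
Proof.
rewrite [leRHS]mx_normrE.
by apply: (le_trans _ (le_bigmax _ _ (0, j))).
Qed.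

Lemma ball_coordP (p q : E) (r : R) : 0 < r ->
  ball p r q <-> forall j, `|p 0 j - q 0 j| < r.
Proof.
move=> r0; split => [b j|b]; first exact: (b.2 0 j).
split=> // i j; rewrite ord1; exact: b.
Qed.

Lemma line_is_derive (f : E -> R) (p v : E) (s : R) :
  derivable f (p + s *: v) v ->
  is_derive s (1 : R) (fun t : R => f (p + t *: v)) ('D_v f (p + s *: v)).
Proof.
move=> df.
have [d1 d2] : is_derive (p + s *: v) v f ('D_v f (p + s *: v)) by exact: derivableP.
have eqq : (fun h : R => h^-1 *: (f (p + (h *: (1 : R) + s) *: v) - f (p + s *: v)))
   = (fun h : R => h^-1 *: (f (h *: v + (p + s *: v)) - f (p + s *: v))).
  apply/funext => h; congr (_ *: (f _ - _)).
  by rewrite scalerDl [h *: (1 : R)]mulr1 addrCA.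
split; first by rewrite /derivable eqq.
by rewrite /derive /= eqq.
Qed.

Lemma mvt_line (f : E -> R) (p v : E) (t : R) :
  (forall s, `|s| <= `|t| -> derivable f (p + s *: v) v) ->
  exists2 s, `|s| <= `|t| & f (p + t *: v) - f p = t * 'D_v f (p + s *: v).
Proof.
move=> df.
have D (s : R) : `|s| <= `|t| ->
   is_derive s (1 : R) (fun t : R => f (p + t *: v)) ('D_v f (p + s *: v)).
  by move=> st; apply: line_is_derive; apply: df.
have C (s : R) : `|s| <= `|t| -> {for s, continuous (fun t : R => f (p + t *: v))}.
  move=> st; apply: differentiable_continuous; apply/derivable1_diffP.
  exact: (@ex_derive _ _ _ _ _ _ _ (D s st)).
have [t0|t0] := leP 0 t.
  have [||s] := @MVT_segment R (fun t => f (p + t *: v))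
      (fun s => 'D_v f (p + s *: v)) 0 t t0.
  - move=> x; rewrite in_itv /= => /andP[x0 xt]; apply: D.
    by rewrite (ger0_norm (ltW x0)) ger0_norm // ltW.
  - apply: continuous_in_subspaceT => x; rewrite inE /= in_itv /= => /andP[x0 xt].
    by apply: C; rewrite !ger0_norm.
  rewrite in_itv /= => /andP[s0 st] e; exists s; first by rewrite !ger0_norm.
  by rewrite scale0r addr0 subr0 in e; rewrite e mulrC.
have [||s] := @MVT_segment R (fun t => f (p + t *: v))
      (fun s => 'D_v f (p + s *: v)) t 0 (ltW t0).
- move=> x; rewrite in_itv /= => /andP[x0 xt]; apply: D.
  by rewrite !ltr0_norm // lerN2 ltW.
- apply: continuous_in_subspaceT => x; rewrite inE /= in_itv /= => /andP[x0 xt].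
  by apply: C; rewrite !ler0_norm ?lerN2 // ltW.
rewrite in_itv /= => /andP[s0 st] e; exists s.
  by rewrite !ler0_norm ?lerN2 // ltW.
rewrite scale0r addr0 sub0r in e; rewrite -opprB e; ring.
Qed.

(** Moving one coordinate at a time turns the increment into four increments on
    lines, to each of which the mean value theorem applies. *)
Lemma increment_telescope (f : E -> R) (p : E) (W : set E) (r : R) :
  (forall q : E, (forall j, `|p 0 j - q 0 j| < r) -> W q) ->
  (forall i q, W q -> derivable f q 'e_i) ->
  forall h : E, `|h| < r -> exists q : 'I_4 -> E,
    (forall i, forall j, `|p 0 j - q i 0 j| <= `|h|) /\
    f (p + h) - f p = \sum_i h 0 i * 'D_('e_i) f (q i).
Proof.
move=> rW df h hr.
pose t k : E := \row_j (if (j < k)%N then h 0 j else 0).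
have tS (k : 'I_4) : t k.+1 = t k + h 0 k *: 'e_k.
  apply/rowP => j; rewrite !mxE eqxx /= ltnS leq_eqVlt -val_eqE /=.
  case: (ltngtP (j : nat) k) => jk /=; rewrite ?mulr0 ?addr0 //.
  by rewrite (val_inj jk) add0r mulr1.
have bd (k : 'I_4) s : `|s| <= `|h 0 k| ->
    forall j, `|p 0 j - (p + t k + s *: 'e_k) 0 j| <= `|h|.
  move=> sh j; rewrite !mxE eqxx /= -addrA opprD addNKr normrN.
  have [->|jk] := eqVneq j k.
    by rewrite ltnn add0r mulr1 (le_trans sh) ?coord_le_norm.
  by rewrite mulr0 addr0; case: ifP => _; rewrite ?normr0 // coord_le_norm.
have /choice [q Hq] : forall i : 'I_4, exists q : E,
   (forall j, `|p 0 j - q 0 j| <= `|h|) /\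
   f (p + t i.+1) - f (p + t i) = h 0 i * 'D_('e_i) f q.
  move=> i.
  have [|s sh e] := @mvt_line f (p + t i) 'e_i (h 0 i).
    move=> s sh; apply: df; apply: rW => j.
    by apply: le_lt_trans hr; apply: bd.
  exists (p + t i + s *: 'e_i); split; first exact: bd.
  by rewrite tS addrA e.
exists q; split; first by move=> i; exact: (Hq i).1.
have t0 : t 0%N = 0 by apply/rowP => j; rewrite !mxE.
have t4 : t 4%N = h by apply/rowP => j; rewrite !mxE ltn_ord.
have := @telescope_sumr _ 0%N 4%N (fun k => f (p + t k)) isT.
rewrite t0 t4 addr0 => <-; rewrite big_mkord.
by apply: eq_bigr => i _; rewrite (Hq i).2.
Qed.

Definition grad_pairing (G : 'I_4 -> R) (v : E) : R := \sum_i v 0 i * G i.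

Fact grad_pairing_is_linear G : linear (grad_pairing G).
Proof.
move=> a x y; rewrite /grad_pairing scaler_sumr -big_split /=.
by apply: eq_bigr => i _; rewrite !mxE mulrDl -mulrA.
Qed.
HB.instance Definition _ G :=
  GRing.isLinear.Build R E R _ (grad_pairing G) (grad_pairing_is_linear G).

Lemma grad_pairing_continuous G : continuous (grad_pairing G).
Proof.
apply: continuous_big => [|i _ v]; first exact: add_continuous.
 apply: (@continuousM _ _ (fun w : E => w 0 i : R) (cst (G i))).
  exact: (@coord_continuous R 1 4 0 i).
exact: cst_continuous.
Qed.

(** The increment is a combination of partial derivatives at points close to
    [p], and by continuity these are close to the partial derivatives at [p]. *)
Lemma C1_differentiable (W : set E) (f : E -> R) (p : E) : open W -> W p ->
  (forall i q, W q -> derivable f q 'e_i) ->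
  (forall i q, W q -> {for q, continuous ('D_('e_i) f)}) ->
  differentiable f p /\ 'd f p = grad_pairing (fun i => 'D_('e_i) f p) :> (E -> R).
Proof.
move=> oW Wp df cf.
set G := fun i => 'D_('e_i) f p.
have lo : (f : E -> R^o) \o shift p =
    cst (f p : R^o) + (grad_pairing G : E -> R^o) +o_ (0 : E) id.
  apply/eqaddoP => _/posnumP[e].
  have : \forall q \near p, W q /\ forall i, `|'D_('e_i) f q - G i| < e%:num / 4.
    apply: filterI; first by apply: open_nbhs_nbhs.
    apply: (@filter_forall E 'I_4 (fun i q => `|'D_('e_i) f q - G i| < e%:num / 4)
      (nbhs p)) => i; have /cvgrPdist_lt := cf i p Wp.
    move=> /(_ (e%:num / 4)); have e40 : 0 < e%:num / 4 by rewrite divr_gt0.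
    move=> /(_ e40); apply: filterS => q /=.
    by rewrite distrC.
  move=> /nbhs_ballP [r /= r0 rW].
  have rW' (q : E) : (forall j, `|p 0 j - q 0 j| < r) ->
      W q /\ forall i, `|'D_('e_i) f q - G i| < e%:num / 4.
    by move=> /(ball_coordP _ _ r0) /rW.
  apply/nbhs_ballP; exists r => //= h; rewrite -ball_normE /ball_ /= sub0r normrN => hr.
  have [||q [qb qe]] := @increment_telescope f p W r _ _ h hr.
  - by move=> q /rW' [].
  - by move=> i q; apply: df.
  change (`|f (h + p) - (f p + grad_pairing G h)| <= e%:num * `|h|).
  rewrite opprD addrA (addrC h p) qe /grad_pairing -sumrB.
  apply: le_trans (ler_norm_sum _ _ _) _.
  apply: (@le_trans _ _ (\sum_(i < 4) `|h| * (e%:num / 4))).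
    apply: ler_sum => i _; rewrite -mulrBr normrM ler_pM // ?coord_le_norm //.
    apply: ltW; apply: (rW' (q i) _).2 => j; exact: le_lt_trans (qb i j) hr.
  by rewrite sumr_const card_ord -mulrnAr -[X in _ * X]mulr_natr divfK ?pnatr_eq0 // mulrC.
have dE := diff_unique (@grad_pairing_continuous G) lo.
split=> //; apply/diff_locallyP; split; rewrite dE //.
exact: grad_pairing_continuous.
Qed.
End Calculus.

Section SmoothFunctions.
Context {R : realType}.
Notation E := 'rV[R]_4.
Implicit Types (W : set E) (f : E -> R) (p : E).

Lemma near_open W p (P : E -> Prop) : open W -> W p -> (forall q, W q -> P q) ->
  \forall q \near p, P q.
Proof. by move=> oW Wp WP; apply: filterS (open_nbhs_nbhs (conj oW Wp)). Qed.

Lemma derive_translate f (w v q : E) : derivable f (q + w) v ->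
  is_derive q v (fun x => f (x + w)) ('D_v f (q + w)).
Proof.
move=> df; have eqq : (fun h : R => h^-1 *: (f (h *: v + q + w) - f (q + w)))
    = (fun h : R => h^-1 *: (f (h *: v + (q + w)) - f (q + w))).
  by apply/funext => h; rewrite addrA.
by split; rewrite /derivable /derive /= eqq.
Qed.

(** Two applications of the mean value theorem, first in the direction [i] and
    then in the direction [j].  The step [r / 3] keeps the square of increments
    in the ball. *)
Lemma second_difference W f p (r : R) (i j : 'I_4) : 0 < r ->
  (forall q, ball p r q -> W q) ->
  (forall q, W q -> derivable f q 'e_i) ->
  (forall q, W q -> derivable ('D_('e_i) f) q 'e_j) ->
  exists2 q, ball p r q &
    f (p + (r / 3) *: 'e_i + (r / 3) *: 'e_j) - f (p + (r / 3) *: 'e_i)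
    - f (p + (r / 3) *: 'e_j) + f p
    = (r / 3) * ((r / 3) * 'D_('e_j) ('D_('e_i) f) q).
Proof.
move=> r0 rW dfi dfij; set s := r / 3.
have s0 : 0 < s by rewrite divr_gt0.
have inb (x y : R) : `|x| <= `|s| -> `|y| <= `|s| ->
    ball p r (p + x *: 'e_i + y *: 'e_j).
  rewrite (gtr0_norm s0) => xs ys; apply/ball_coordP => // k.
  rewrite !mxE eqxx /= -addrA opprD addNKr normrN.
  apply: (@le_lt_trans _ _ (s + s)); last by rewrite /s; lra.
  apply: le_trans (ler_normD _ _) _; apply: lerD; rewrite normrM.
    by rewrite -[leRHS]mulr1 ler_pM // normr_nat; case: eqP.
  by rewrite -[leRHS]mulr1 ler_pM // normr_nat; case: eqP.
pose phi q := f (q + s *: 'e_j) - f q.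
have dphi q : W q -> W (q + s *: 'e_j) ->
   is_derive q 'e_i phi ('D_('e_i) f (q + s *: 'e_j) - 'D_('e_i) f q).
  move=> Wq Wqs; apply: is_deriveB; first by apply: derive_translate; apply: dfi.
  by apply: derivableP; apply: dfi.
have z0 : `|0 : R| <= `|s| by rewrite normr0.
have [x|x xs ex] := @mvt_line R phi p 'e_i s.
  move=> xs; apply: (@ex_derive _ _ _ _ _ _ _ (dphi _ _ _)); apply: rW.
    by have := inb x 0 xs z0; rewrite scale0r addr0.
  exact: inb.
have [y|y ys ey] := @mvt_line R ('D_('e_i) f) (p + x *: 'e_i) 'e_j s.
  by move=> ys; apply: dfij; apply: rW; apply: inb.
exists (p + x *: 'e_i + y *: 'e_j); first exact: inb.
have W1 : W (p + x *: 'e_i).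
  by apply: rW; have := inb x 0 xs z0; rewrite scale0r addr0.
have W2 : W (p + x *: 'e_i + s *: 'e_j) by apply: rW; apply: inb.
have dx := @derive_val _ _ _ _ _ _ _ (dphi (p + x *: 'e_i) W1 W2).
rewrite -ey -dx -ex /phi.
have reorder (a b c d : R) : a - b - c + d = a - b - (c - d) by ring.
exact: reorder.
Qed.

(** Both orders of the second difference quotient are values of the two mixed
    derivatives near [p]. *)
Lemma schwarz W f p (i j : 'I_4) : open W -> W p ->
  (forall i q, W q -> derivable f q 'e_i) ->
  (forall i j q, W q -> derivable ('D_('e_i) f) q 'e_j) ->
  (forall i j q, W q -> {for q, continuous ('D_('e_j) ('D_('e_i) f))}) ->
  'D_('e_j) ('D_('e_i) f) p = 'D_('e_i) ('D_('e_j) f) p.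
Proof.
move=> oW Wp df ddf cf; apply/eqP; rewrite -subr_eq0 -normr_le0.
apply/ler_addgt0Pl => e e0; rewrite addr0.
have near2 a b : \forall q \near p,
    `|'D_('e_b) ('D_('e_a) f) p - 'D_('e_b) ('D_('e_a) f) q| < e / 2.
  have /cvgrPdist_lt := cf a b p Wp; apply; by rewrite divr_gt0.
have /nbhs_ballP [r /= r0 rW] : \forall q \near p, W q /\
    (`|'D_('e_j) ('D_('e_i) f) p - 'D_('e_j) ('D_('e_i) f) q| < e / 2 /\
     `|'D_('e_i) ('D_('e_j) f) p - 'D_('e_i) ('D_('e_j) f) q| < e / 2).
  apply: filterI; first exact: open_nbhs_nbhs.
  by apply: filterI; apply: near2.
have [|||q1 b1 e1] := @second_difference W f p r i j r0.
- by move=> q /rW [].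
- by move=> q; apply: df.
- by move=> q; apply: ddf.
have [|||q2 b2 e2] := @second_difference W f p r j i r0.
- by move=> q /rW [].
- by move=> q; apply: df.
- by move=> q; apply: ddf.
have e12 : 'D_('e_j) ('D_('e_i) f) q1 = 'D_('e_i) ('D_('e_j) f) q2.
  have s0 : r / 3 != 0 by rewrite mulf_neq0 // gt_eqF.
  apply: (mulfI s0); apply: (mulfI s0); apply: etrans (esym e1) (etrans _ e2).
  have reorder (a b c d : R) : a - b - c + d = a - c - b + d by ring.
  by rewrite (addrAC p) reorder.
have [_ [h1 _]] := rW _ b1; have [_ [_ h2]] := rW _ b2.
rewrite -(subrKA ('D_('e_j) ('D_('e_i) f) q1)).
apply: le_trans (ler_normD _ _) _.
rewrite distrC in h2; rewrite -e12 in h2.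
by apply: le_trans (lerD (ltW h1) (ltW h2)) _; rewrite -splitr.
Qed.

Lemma Csmooth_derivable W f p i : Csmooth W f -> W p -> derivable f p 'e_i.
Proof. by move=> sf Wp; apply: ((sf 1%N) i).1. Qed.

Lemma Csmooth_cont W f p : Csmooth W f -> W p -> {for p, continuous f}.
Proof. by move=> sf; apply: (sf 0%N). Qed.

Lemma CsmoothD_e W f i : Csmooth W f -> Csmooth W ('D_('e_i) f).
Proof. by move=> sf k; apply: ((sf k.+1) i).2. Qed.

Lemma Csmooth_schwarz W f p i j : open W -> Csmooth W f -> W p ->
  'D_('e_j) ('D_('e_i) f) p = 'D_('e_i) ('D_('e_j) f) p.
Proof.
move=> oW sf Wp; apply: (schwarz _ _ oW Wp).
- by move=> k q; apply: Csmooth_derivable.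
- by move=> k l q; apply: Csmooth_derivable; apply: CsmoothD_e.
- by move=> k l q; apply: Csmooth_cont; do 2 apply: CsmoothD_e.
Qed.

Lemma Csmooth_differentiable W f p : open W -> Csmooth W f -> W p ->
  differentiable f p /\ 'd f p = grad_pairing (fun i => 'D_('e_i) f p) :> (E -> R).
Proof.
move=> oW sf Wp; apply: (C1_differentiable oW Wp).
- by move=> k q; apply: Csmooth_derivable.
- by move=> k q; apply: Csmooth_cont; apply: CsmoothD_e.
Qed.

Lemma Csmooth_derive W f p v : open W -> Csmooth W f -> W p ->
  is_derive p v f (\sum_i v 0 i * 'D_('e_i) f p).
Proof.
move=> oW sf Wp; have [df dE] := Csmooth_differentiable oW sf Wp.
by split; [exact: diff_derivable|rewrite deriveE // dE].
Qed.

Lemma Ck_sub k W W' f : W' `<=` W -> Ck k W f -> Ck k W' f.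
Proof.
elim: k f => [|k IH] f sW /=; first by move=> cf p /sW; apply: cf.
move=> cf i; have [h1 h2] := cf i; split; last exact: IH.
by move=> p /sW; apply: h1.
Qed.

Lemma Csmooth_sub W W' f : W' `<=` W -> Csmooth W f -> Csmooth W' f.
Proof. by move=> sW sf k; apply: Ck_sub (sf k). Qed.

Lemma derive_eq_on W (f g : E -> R) p v : open W -> (forall q, W q -> f q = g q) ->
  W p -> 'D_v f p = 'D_v g p.
Proof. by move=> oW fg Wp; apply: near_eq_derive; apply: near_open fg. Qed.

Lemma Ck_eq k W (f g : E -> R) : open W -> (forall q, W q -> f q = g q) ->
  Ck k W f -> Ck k W g.
Proof.
move=> oW; elim: k f g => [|k IH] f g fg /=.
  move=> cf p Wp; change (g x @[x --> p] --> g p); rewrite -fg //.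
  have fg' : \forall q \near p, f q = g q by apply: near_open fg.
  by apply: cvg_trans (cf p Wp); exact: near_eq_cvg fg'.
move=> cf i; have [h1 h2] := cf i; split.
  move=> p Wp; apply: near_eq_derivable (h1 p Wp); exact: near_open fg.
apply: IH h2 => q; exact: derive_eq_on.
Qed.

Lemma Csmooth_eq W (f g : E -> R) : open W -> (forall q, W q -> f q = g q) ->
  Csmooth W f -> Csmooth W g.
Proof. by move=> oW fg sf k; apply: Ck_eq (sf k). Qed.

Lemma Csmooth_cst W (a : R) : Csmooth W (fun=> a).
Proof.
move=> k; elim: k a => [|k IH] a /=; first by move=> p _; apply: cst_continuous.
move=> i; split; first by move=> p _; apply: derivable_cst.
rewrite (_ : 'D_('e_i) (fun=> a) = fun=> 0) //.
by apply/funext => p; exact: derive_cst.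
Qed.

Lemma Ck_add k W f g : open W -> Ck k W f -> Ck k W g ->
  Ck k W (fun q => f q + g q).
Proof.
move=> oW; elim: k f g => [|k IH] f g /=.
  by move=> cf cg p Wp; exact: cvgD (cf p Wp) (cg p Wp).
move=> cf cg i; have [f1 f2] := cf i; have [g1 g2] := cg i; split.
  by move=> p Wp; exact: derivableD (f1 p Wp) (g1 p Wp).
apply: Ck_eq (IH _ _ f2 g2) => // q Wq.
by symmetry; exact: (deriveD (f1 q Wq) (g1 q Wq)).
Qed.

Lemma Csmooth_add W f g : open W -> Csmooth W f -> Csmooth W g ->
  Csmooth W (fun q => f q + g q).
Proof. by move=> oW sf sg k; apply: Ck_add. Qed.

(** The base case needs the total derivative: partial derivatives alone do not
    give continuity. *)
Lemma CkS_Ck k W f : open W -> Ck k.+1 W f -> Ck k W f.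
Proof.
move=> oW; elim: k f => [|k IH] f cf.
  move=> p Wp; apply: differentiable_continuous.
  by apply: (C1_differentiable oW Wp _ _).1 => i q Wq; [apply: (cf i).1|apply: (cf i).2].
by move=> i; split; [apply: (cf i).1|apply: IH; apply: (cf i).2].
Qed.

Lemma Ck_mul k W f g : open W -> Ck k W f -> Ck k W g -> Ck k W (fun q => f q * g q).
Proof.
move=> oW; elim: k f g => [|k IH] f g cf cg.
  by move=> p Wp; exact: cvgM (cf p Wp) (cg p Wp).
have [cf' cg'] := (CkS_Ck oW cf, CkS_Ck oW cg).
move=> i; have [f1 f2] := cf i; have [g1 g2] := cg i; split.
  by move=> p Wp; exact: derivableM (f1 p Wp) (g1 p Wp).
apply: (@Ck_eq k W (fun q => f q * 'D_('e_i) g q + g q * 'D_('e_i) f q)) => //.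
  by move=> q Wq; symmetry; exact: (deriveM (f1 q Wq) (g1 q Wq)).
by apply: Ck_add => //; apply: IH.
Qed.

Lemma Csmooth_mul W f g : open W -> Csmooth W f -> Csmooth W g ->
  Csmooth W (fun q => f q * g q).
Proof. by move=> oW sf sg k; apply: Ck_mul. Qed.

Lemma Csmooth_opp W f : open W -> Csmooth W f -> Csmooth W (fun q => - f q).
Proof.
move=> oW sf; apply: (@Csmooth_eq W (fun q => (-1) * f q)) => //.
  by move=> q _; rewrite mulN1r.
by apply: Csmooth_mul => //; apply: Csmooth_cst.
Qed.

Lemma Csmooth_sub_fun W f g : open W -> Csmooth W f -> Csmooth W g ->
  Csmooth W (fun q => f q - g q).
Proof. by move=> oW sf sg; apply: Csmooth_add => //; apply: Csmooth_opp. Qed.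

Lemma Ck_sum k W (I : Type) (r : seq I) (F : I -> E -> R) :
  open W -> (forall i, Ck k W (F i)) -> Ck k W (fun q => \sum_(i <- r) F i q).
Proof.
move=> oW sF; elim: r => [|i r IH].
  rewrite (_ : (fun q => _) = fun=> 0); first exact: Csmooth_cst.
  by apply/funext => q; rewrite big_nil.
rewrite (_ : (fun q => _) = (fun q => F i q + \sum_(i <- r) F i q)).
  by apply: Ck_add => //; apply: sF.
by apply/funext => q; rewrite big_cons.
Qed.

Lemma Csmooth_sum W (I : Type) (r : seq I) (F : I -> E -> R) :
  open W -> (forall i, Csmooth W (F i)) ->
  Csmooth W (fun q => \sum_(i <- r) F i q).
Proof. by move=> oW sF k; apply: Ck_sum => // i; apply: sF. Qed.

Lemma Csmooth_prod W (I : Type) (r : seq I) (F : I -> E -> R) :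
  open W -> (forall i, Csmooth W (F i)) ->
  Csmooth W (fun q => \prod_(i <- r) F i q).
Proof.
move=> oW sF; elim: r => [|i r IH].
  rewrite (_ : (fun q => _) = fun=> 1); first exact: Csmooth_cst.
  by apply/funext => q; rewrite big_nil.
rewrite (_ : (fun q => _) = (fun q => F i q * \prod_(i <- r) F i q)).
  by apply: Csmooth_mul => //; apply: sF.
by apply/funext => q; rewrite big_cons.
Qed.

Lemma Csmooth_inv W f : open W -> (forall q, W q -> f q != 0) -> Csmooth W f ->
  Csmooth W (fun q => (f q)^-1).
Proof.
move=> oW f0 sf; elim => [|k IH] /=.
  by move=> p Wp; exact: (cvgV (f0 p Wp) (Csmooth_cont sf Wp)).
move=> i; split.
  by move=> p Wp; exact: derivableV (f0 p Wp) (Csmooth_derivable sf Wp).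
apply: (@Ck_eq k W (fun q => (- 1) * ((f q)^-1 * (f q)^-1) * 'D_('e_i) f q)) => //.
  move=> q Wq; rewrite (deriveV (f0 q Wq) (Csmooth_derivable sf Wq)).
  by rewrite -[RHS]/(_ * _) mulN1r -invfM expr2.
apply: Ck_mul => //; last exact: CsmoothD_e.
by apply: Ck_mul => //; [apply: Csmooth_cst|apply: Ck_mul].
Qed.

Lemma derive_exp W f p i : open W -> Csmooth W f -> W p ->
  is_derive p 'e_i (fun q => expR (f q)) (expR (f p) * 'D_('e_i) f p).
Proof.
move=> oW sf Wp; have [df dE] := Csmooth_differentiable oW sf Wp.
have de : differentiable expR (f p).
  by apply/derivable1_diffP; exact: derivable_expR.
have dc : differentiable (fun q => expR (f q)) p.
  exact: (@differentiable_comp _ _ _ _ f expR).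
split; first exact: diff_derivable.
rewrite deriveE // (@diff_comp _ _ _ _ f expR) //= -(deriveE _ df).
rewrite deriv1E; last exact: derivable_expR.
by rewrite derive1E derive_val [_ *: _]mulrC.
Qed.

Lemma Csmooth_exp W f : open W -> Csmooth W f -> Csmooth W (fun q => expR (f q)).
Proof.
move=> oW sf; elim => [|k IH] /=.
  move=> p Wp; apply: (@continuous_comp _ _ _ f expR).
    exact: Csmooth_cont Wp.
  exact: continuous_expR.
move=> i; split.
  by move=> p Wp; apply: (@ex_derive _ _ _ _ _ _ _ (derive_exp i oW sf Wp)).
apply: (@Ck_eq k W (fun q => expR (f q) * 'D_('e_i) f q)) => //.
  by move=> q Wq; rewrite (@derive_val _ _ _ _ _ _ _ (derive_exp i oW sf Wq)).
by apply: Ck_mul => //; apply: CsmoothD_e.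
Qed.

Lemma chain_rule W f (w : E -> E) p v : open W -> Csmooth W f -> W (w p) ->
  (forall j, derivable (fun q => w q 0 j) p v) ->
  is_derive p v (fun q => f (w q))
    (\sum_j 'D_v (fun q => w q 0 j) p * 'D_('e_j) f (w p)).
Proof.
move=> oW sf Wp dw.
have [df dE] := Csmooth_differentiable oW sf Wp.
have dwp : derivable w p v by apply/derivable_mxP => i j; rewrite ord1; apply: dw.
pose l h := w (h *: v + p).
have l0 : l 0 = w p by rewrite /l scale0r add0r.
have dl : differentiable l 0 by apply/derivable1_diffP; exact: ((derivable1P w p v).1 dwp).
have dfl : differentiable (f \o l) 0 by apply: differentiable_comp; rewrite ?l0.
split; first by apply: (derivable1P (fun q => f (w q)) p v).2; apply/derivable1_diffP.
have lE h : l (h *: (1 : R) + 0) = w (h *: v + p) by rewrite addr0 /l [h *: _]mulr1.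
have -> : 'D_v (fun q => f (w q)) p = 'D_1 (f \o l) 0.
  apply: (congr1 (fun F : R -> R => lim (F @ (0:R)^'))).
  by apply/funext => h /=; rewrite lE l0.
rewrite deriveE // diff_comp ?l0 //= -(deriveE _ dl) dE /grad_pairing.
have -> : 'D_1 l 0 = 'D_v w p.
  apply: (congr1 (fun F : R -> E => lim (F @ (0:R)^'))).
  by apply/funext => h /=; rewrite lE l0.
by rewrite derive_mx //; apply: eq_bigr => j _; rewrite mxE.
Qed.

Lemma Csmooth_comp W W' f (w : E -> E) : open W -> open W' -> Csmooth W f ->
  (forall p, W' p -> W (w p)) -> (forall j, Csmooth W' (fun q => w q 0 j)) ->
  Csmooth W' (fun q => f (w q)).
Proof.
move=> oW oW' sf wW sw k.
have dc g p i : Csmooth W g -> W' p -> is_derive p 'e_i (fun q => g (w q))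
    (\sum_j 'D_('e_i) (fun q => w q 0 j) p * 'D_('e_j) g (w p)).
  move=> sg W'p; apply: (@chain_rule W) => //; first exact: wW.
  by move=> j; apply: Csmooth_derivable W'p.
elim: k f sf => [|k IH] f sf /=.
  move=> p W'p; apply: (@continuous_comp _ _ _ w f); last exact: (Csmooth_cont sf (wW _ W'p)).
  move=> A /nbhs_ballP [e /= e0 eA]; change (nbhs p (fun q => A (w q))).
  have : \forall q \near p, forall j, `|w p 0 j - w q 0 j| < e.
    apply: (@filter_forall E 'I_4 (fun j q => `|w p 0 j - w q 0 j| < e) (nbhs p)).
    by move=> j; have /cvgrPdist_lt := Csmooth_cont (sw j) W'p; apply.
  by apply: (@filterS _ _ (nbhs_filter p)) => q; move/(ball_coordP _ _ e0); exact: eA.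
move=> i; split; first by move=> p W'p; apply: (@ex_derive _ _ _ _ _ _ _ (dc f p i sf W'p)).
apply: (@Ck_eq k W' (fun p => \sum_j 'D_('e_i) (fun q => w q 0 j) p * 'D_('e_j) f (w p))) => //.
  by move=> q W'q; rewrite (@derive_val _ _ _ _ _ _ _ (dc f q i sf W'q)).
apply: Ck_sum => // j; apply: Ck_mul => //.
  by move: k {IH}; apply: CsmoothD_e.
by apply: (IH ('D_('e_j) f)); apply: CsmoothD_e.
Qed.

End SmoothFunctions.

(** * Matrix-valued smooth functions *)

Section SmoothMatrices.
Context {R : realType}.
Notation E := 'rV[R]_4.
Implicit Types (W : set E) (p : E) (k : 'I_4).

Definition smx m n W (F : E -> 'M[R]_(m, n)) : Prop :=
  forall i j, Csmooth W (fun q => F q i j).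

Lemma eq_derive (f h : E -> R) v p : f =1 h -> 'D_v f p = 'D_v h p.
Proof. by move=> /funext ->. Qed.

Lemma smx_derivable m n W (F : E -> 'M[R]_(m, n)) p k :
  smx W F -> W p -> derivable F p 'e_k.
Proof. by move=> sF Wp; apply/derivable_mxP => i j; apply: Csmooth_derivable Wp. Qed.

Lemma smx_deriveE m n W (F : E -> 'M[R]_(m, n)) p k i j :
  smx W F -> W p -> ('D_('e_k) F p) i j = 'D_('e_k) (fun q => F q i j) p.
Proof. by move=> sF Wp; rewrite derive_mx ?mxE //; apply: smx_derivable Wp. Qed.

Lemma smx_eq m n W (F G : E -> 'M[R]_(m, n)) : open W ->
  (forall q, W q -> F q = G q) -> smx W F -> smx W G.
Proof.
by move=> oW FG sF i j; apply: Csmooth_eq (sF i j) => // q Wq; rewrite FG.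
Qed.

Lemma derive_eq_mx m n W (F G : E -> 'M[R]_(m, n)) p v : open W ->
  (forall q, W q -> F q = G q) -> W p -> 'D_v F p = 'D_v G p.
Proof. by move=> oW FG Wp; apply: near_eq_derive; apply: near_open FG. Qed.

Lemma smx_D m n W (F : E -> 'M[R]_(m, n)) k : open W -> smx W F ->
  smx W ('D_('e_k) F).
Proof.
move=> oW sF i j; apply: Csmooth_eq (CsmoothD_e k (sF i j)) => // q Wq.
by rewrite (smx_deriveE _ _ _ sF Wq).
Qed.

Lemma smx_schwarz m n W (F : E -> 'M[R]_(m, n)) p k l : open W -> smx W F ->
  W p -> 'D_('e_k) ('D_('e_l) F) p = 'D_('e_l) ('D_('e_k) F) p.
Proof.
move=> oW sF Wp; apply/matrixP => i j.
have DD a b : ('D_('e_a) ('D_('e_b) F) p) i j = 'D_('e_a) ('D_('e_b) (fun q => F q i j)) p.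
  rewrite (smx_deriveE a i j (smx_D b oW sF) Wp).
  by apply: (derive_eq_on _ oW _ Wp) => q Wq; apply: smx_deriveE Wq.
apply: etrans (DD k l) (etrans _ (esym (DD l k))).
exact: (Csmooth_schwarz _ _ oW (sF i j) Wp).
Qed.

Lemma smx_cst m n W (A : 'M[R]_(m, n)) : smx W (fun=> A).
Proof. by move=> i j; exact: Csmooth_cst. Qed.

Lemma smx_add m n W (F G : E -> 'M[R]_(m, n)) : open W -> smx W F -> smx W G ->
  smx W (fun q => F q + G q).
Proof.
move=> oW sF sG i j; rewrite (_ : (fun q => _) = (fun q => F q i j + G q i j)).
  exact: Csmooth_add.
by apply/funext => q; rewrite mxE.
Qed.

Lemma smx_opp m n W (F : E -> 'M[R]_(m, n)) : open W -> smx W F ->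
  smx W (fun q => - F q).
Proof.
move=> oW sF i j; rewrite (_ : (fun q => _) = (fun q => - F q i j)).
  exact: Csmooth_opp.
by apply/funext => q; rewrite mxE.
Qed.

Lemma smx_sub m n W (F G : E -> 'M[R]_(m, n)) : open W -> smx W F -> smx W G ->
  smx W (fun q => F q - G q).
Proof. by move=> oW sF sG; apply: smx_add => //; apply: smx_opp. Qed.

Lemma smx_scale m n W (f : E -> R) (F : E -> 'M[R]_(m, n)) : open W ->
  Csmooth W f -> smx W F -> smx W (fun q => f q *: F q).
Proof.
move=> oW sf sF i j; rewrite (_ : (fun q => _) = (fun q => f q * F q i j)).
  exact: Csmooth_mul.
by apply/funext => q; rewrite mxE.
Qed.

Lemma smx_mul m n r W (F : E -> 'M[R]_(m, n)) (G : E -> 'M[R]_(n, r)) :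
  open W -> smx W F -> smx W G -> smx W (fun q => F q *m G q).
Proof.
move=> oW sF sG i j.
rewrite (_ : (fun q => _) = (fun q => \sum_l F q i l * G q l j)).
  by apply: Csmooth_sum => // l; apply: Csmooth_mul.
by apply/funext => q; rewrite mxE.
Qed.

Lemma smx_tr m n W (F : E -> 'M[R]_(m, n)) : smx W F -> smx W (fun q => (F q)^T).
Proof.
move=> sF i j; rewrite (_ : (fun q => _) = (fun q => F q j i)) //.
by apply/funext => q; rewrite mxE.
Qed.

Lemma Csmooth_det n W (F : E -> 'M[R]_n) : open W -> smx W F ->
  Csmooth W (fun q => \det (F q)).
Proof.
move=> oW sF; apply: Csmooth_sum => // s; apply: Csmooth_mul => //.
  exact: Csmooth_cst.
exact: Csmooth_prod.
Qed.

Lemma Csmooth_tr n W (F : E -> 'M[R]_n) : open W -> smx W F ->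
  Csmooth W (fun q => \tr (F q)).
Proof. by move=> oW sF; apply: Csmooth_sum. Qed.

Lemma smx_inv n W (F : E -> 'M[R]_n) : open W -> smx W F ->
  (forall q, W q -> F q \in unitmx) -> smx W (fun q => invmx (F q)).
Proof.
move=> oW sF uF.
apply: (@smx_eq _ _ _ (fun q => (\det (F q))^-1 *: \adj (F q))) => //.
  by move=> q Wq; rewrite /invmx uF.
apply: smx_scale => //.
  apply: Csmooth_inv => //; last exact: Csmooth_det.
  by move=> q /uF; rewrite unitmxE unitfE.
move=> i j.
rewrite (_ : (fun q => _) =
  (fun q => (-1) ^+ (j + i) * \det (row' j (col' i (F q))))).
  apply: Csmooth_mul => //; first exact: Csmooth_cst.
  apply: Csmooth_det => // a b.
  rewrite (_ : (fun q => _) = (fun q => F q (lift j a) (lift i b))) //.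
  by apply/funext => q; rewrite !mxE.
by apply/funext => q; rewrite mxE.
Qed.

Lemma D_addf W (f h : E -> R) p k : Csmooth W f -> Csmooth W h -> W p ->
  'D_('e_k) (fun q => f q + h q) p = 'D_('e_k) f p + 'D_('e_k) h p.
Proof.
by move=> sf sh Wp; exact: (deriveD (Csmooth_derivable sf Wp) (Csmooth_derivable sh Wp)).
Qed.

Lemma D_mulf W (f h : E -> R) p k : Csmooth W f -> Csmooth W h -> W p ->
  'D_('e_k) (fun q => f q * h q) p = 'D_('e_k) f p * h p + f p * 'D_('e_k) h p.
Proof.
move=> sf sh Wp.
rewrite addrC [X in _ + X]mulrC.
exact: (deriveM (Csmooth_derivable sf Wp) (Csmooth_derivable sh Wp)).
Qed.

Lemma D_sumf W n (F : 'I_n -> E -> R) p k : (forall i, Csmooth W (F i)) -> W p ->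
  'D_('e_k) (fun q => \sum_i F i q) p = \sum_i 'D_('e_k) (F i) p.
Proof.
move=> sF Wp; rewrite -derive_sum; last by move=> i; apply: Csmooth_derivable Wp.
apply: eq_derive => q.
by elim/big_rec2 : _ => // i y f _ ->.
Qed.

Lemma D_cstf (a : R) p k : 'D_('e_k) (fun=> a) p = 0.
Proof. exact: derive_cst. Qed.

Lemma D_cst m n (A : 'M[R]_(m, n)) p k : 'D_('e_k) (fun=> A) p = 0.
Proof. exact: derive_cst. Qed.

Lemma D_add m n W (F G : E -> 'M[R]_(m, n)) p k : smx W F -> smx W G -> W p ->
  'D_('e_k) (fun q => F q + G q) p = 'D_('e_k) F p + 'D_('e_k) G p.
Proof.
by move=> sF sG Wp; exact: (deriveD (smx_derivable sF Wp) (smx_derivable sG Wp)).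
Qed.

Lemma D_opp m n W (F : E -> 'M[R]_(m, n)) p k : smx W F -> W p ->
  'D_('e_k) (fun q => - F q) p = - 'D_('e_k) F p.
Proof. by move=> sF Wp; exact: (deriveN (smx_derivable sF Wp)). Qed.

Lemma D_sub m n W (F G : E -> 'M[R]_(m, n)) p k : smx W F -> smx W G -> W p ->
  'D_('e_k) (fun q => F q - G q) p = 'D_('e_k) F p - 'D_('e_k) G p.
Proof.
by move=> sF sG Wp; exact: (deriveB (smx_derivable sF Wp) (smx_derivable sG Wp)).
Qed.

Lemma D_tr m n W (F : E -> 'M[R]_(m, n)) p k : smx W F -> W p ->
  'D_('e_k) (fun q => (F q)^T) p = ('D_('e_k) F p)^T.
Proof.
move=> sF Wp; apply/matrixP => i j.
apply: etrans (smx_deriveE k i j (smx_tr sF) Wp) _.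
rewrite [RHS]mxE; apply: etrans (esym (smx_deriveE k j i sF Wp)).
by apply: eq_derive => q; rewrite mxE.
Qed.

Lemma D_scale m n W (f : E -> R) (F : E -> 'M[R]_(m, n)) p k : open W ->
  Csmooth W f -> smx W F -> W p ->
  'D_('e_k) (fun q => f q *: F q) p = 'D_('e_k) f p *: F p + f p *: 'D_('e_k) F p.
Proof.
move=> oW sf sF Wp; apply/matrixP => i j.
apply: etrans (smx_deriveE k i j (smx_scale oW sf sF) Wp) _.
have -> : ('D_('e_k) f p *: F p + f p *: 'D_('e_k) F p) i j =
    'D_('e_k) f p * F p i j + f p * ('D_('e_k) F p) i j.
  by rewrite [LHS]mxE; congr (_ + _); rewrite [LHS]mxE.
rewrite (smx_deriveE k i j sF Wp); apply: etrans (D_mulf k sf (sF i j) Wp).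
by apply: eq_derive => q; rewrite mxE.
Qed.

Lemma D_mul m n r W (F : E -> 'M[R]_(m, n)) (G : E -> 'M[R]_(n, r)) p k :
  open W -> smx W F -> smx W G -> W p ->
  'D_('e_k) (fun q => F q *m G q) p = 'D_('e_k) F p *m G p + F p *m 'D_('e_k) G p.
Proof.
move=> oW sF sG Wp; apply/matrixP => i j.
apply: etrans (smx_deriveE k i j (smx_mul oW sF sG) Wp) _.
have -> : ('D_('e_k) F p *m G p + F p *m 'D_('e_k) G p) i j =
    \sum_l (('D_('e_k) F p) i l * G p l j + F p i l * ('D_('e_k) G p) l j).
  by rewrite [LHS]mxE big_split; congr (_ + _); rewrite [LHS]mxE.
transitivity ('D_('e_k) (fun q => \sum_l F q i l * G q l j) p).
  by apply: eq_derive => q; rewrite mxE.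
rewrite (D_sumf (W := W)) //; last by move=> l; apply: Csmooth_mul.
apply: eq_bigr => l _.
rewrite (smx_deriveE k i l sF Wp) (smx_deriveE k l j sG Wp).
exact: D_mulf (sF i l) (sG l j) Wp.
Qed.

End SmoothMatrices.

(** * Hermitian structures at a point *)

(** Products of matrices are treated as atoms of an abelian group. *)
Ltac mx_atoms :=
  repeat match goal with |- context [@mulmx ?S ?m ?n ?p ?A ?B] =>
    let x := fresh in set x := (A *m B); clearbody x end.

Ltac mx_group :=
  mx_atoms; let i := fresh in let j := fresh in
  apply/matrixP => i j; rewrite !mxE; ring.

Section Pairing.
Context {R : realFieldType}.
Implicit Types (g A : 'M[R]_4) (T C : 'I_4 -> 'M[R]_4).

(** [T i] is the value of a matrix-valued 1-form on the [i]-th coordinate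
    vector. *)
Definition along T (X : 'rV[R]_4) : 'M[R]_4 := \sum_i X 0 i *: T i.

Definition pair g (X Y : 'rV[R]_4) : R := (X *m g *m Y^T) 0 0.

Lemma pairDl g X Y Z : pair g (X + Y) Z = pair g X Z + pair g Y Z.
Proof. by rewrite /pair !mulmxDl mxE. Qed.

Lemma pairZl g a X Y : pair g (a *: X) Y = a * pair g X Y.
Proof. by rewrite /pair -!scalemxAl mxE. Qed.

Lemma pairNl g X Y : pair g (- X) Y = - pair g X Y.
Proof. by rewrite -scaleN1r pairZl mulN1r. Qed.

Lemma pairDr g X Y Z : pair g X (Y + Z) = pair g X Y + pair g X Z.
Proof. by rewrite /pair linearD mulmxDr mxE. Qed.

Lemma pairZr g a X Y : pair g X (a *: Y) = a * pair g X Y.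
Proof. by rewrite /pair linearZ -scalemxAr mxE. Qed.

Lemma pairNr g X Y : pair g X (- Y) = - pair g X Y.
Proof. by rewrite -scaleN1r pairZr mulN1r. Qed.

Lemma pairMl A g X Y : pair (A *m g) X Y = pair g (X *m A) Y.
Proof. by rewrite /pair mulmxA. Qed.

Lemma pairMr A g X Y : pair (g *m A^T) X Y = pair g X (Y *m A).
Proof. by rewrite /pair trmx_mul !mulmxA. Qed.

Lemma pair_addm g h X Y : pair (g + h) X Y = pair g X Y + pair h X Y.
Proof. by rewrite /pair mulmxDr mulmxDl mxE. Qed.

Lemma pair_oppm g X Y : pair (- g) X Y = - pair g X Y.
Proof. by rewrite /pair mulmxN mulNmx mxE. Qed.

Lemma pair_scalem g a X Y : pair (a *: g) X Y = a * pair g X Y.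
Proof. by rewrite /pair -scalemxAr -scalemxAl mxE. Qed.

Lemma pair_tr g X Y : pair g^T X Y = pair g Y X.
Proof.
rewrite /pair; transitivity (((X *m g^T *m Y^T)^T) 0 0); first by rewrite [RHS]mxE.
by rewrite !trmx_mul !trmxK mulmxA.
Qed.

Lemma pair_sum g X Y : pair g X Y = \sum_i \sum_j X 0 i * Y 0 j * g i j.
Proof.
rewrite /pair mxE exchange_big; apply: eq_bigr => j _.
rewrite !mxE mulr_suml; apply: eq_bigr => i _.
by rewrite mulrAC.
Qed.

Lemma pair_delta g i j : pair g (delta_mx 0 i) (delta_mx 0 j) = g i j.
Proof. by rewrite /pair -rowE trmx_delta -colE !mxE. Qed.

Lemma pair_matP g h : (forall X Y, pair g X Y = pair h X Y) -> g = h.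
Proof. by move=> gh; apply/matrixP => i j; rewrite -!pair_delta. Qed.

Lemma alongZ T a X : along T (a *: X) = a *: along T X.
Proof.
by rewrite /along scaler_sumr; apply: eq_bigr => i _; rewrite mxE scalerA.
Qed.

Lemma alongN T X : along T (- X) = - along T X.
Proof. by rewrite -scaleN1r alongZ scaleN1r. Qed.

Lemma along_delta T i : along T (delta_mx 0 i) = T i.
Proof.
rewrite /along (bigD1 i) //= big1 ?addr0 ?mxE ?eqxx ?scale1r // => j ji.
by rewrite mxE eqxx (negbTE ji) scale0r.
Qed.

Lemma along_eq T T' X : (forall i, T i = T' i) -> along T X = along T' X.
Proof. by move=> TT'; apply: eq_bigr => i _; rewrite TT'. Qed.

Lemma along_add T T' X : along (fun i => T i + T' i) X = along T X + along T' X.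
Proof. by rewrite /along -big_split; apply: eq_bigr => i _; rewrite scalerDr. Qed.

Lemma along_opp T X : along (fun i => - T i) X = - along T X.
Proof. by rewrite /along -sumrN; apply: eq_bigr => i _; rewrite scalerN. Qed.

Lemma along_mulr T A X : along (fun i => T i *m A) X = along T X *m A.
Proof. by rewrite /along mulmx_suml; apply: eq_bigr => i _; rewrite scalemxAl. Qed.

Lemma along_mull T A X : along (fun i => A *m T i) X = A *m along T X.
Proof. by rewrite /along mulmx_sumr; apply: eq_bigr => i _; rewrite scalemxAr. Qed.

Lemma along_tr T X : along (fun i => (T i)^T) X = (along T X)^T.
Proof.
by rewrite /along linear_sum; apply: eq_bigr => i _; rewrite linearZ.
Qed.

Lemma along_scale (c : 'cV[R]_4) A X :
  along (fun i => c i 0 *: A) X = ((X *m c) 0 0) *: A.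
Proof.
by rewrite /along mxE scaler_suml; apply: eq_bigr => i _; rewrite scalerA.
Qed.

(** Row [i] of a Christoffel matrix [C k] is the covariant derivative of the
    [i]-th coordinate field along the [k]-th. *)
Definition torsion_free C : Prop := forall i k, row i (C k) = row k (C i).

Lemma torsion_freeP C X Y : torsion_free C -> Y *m along C X = X *m along C Y.
Proof.
move=> sC; rewrite [X in X *m _]row_sum_delta [X in _ = X *m _]row_sum_delta.
rewrite !mulmx_suml /along.
under eq_bigr do rewrite mulmx_sumr.
under [RHS]eq_bigr do rewrite mulmx_sumr.
rewrite exchange_big; apply: eq_bigr => i _; apply: eq_bigr => j _.
rewrite -!scalemxAr -!scalemxAl -!rowE (sC i j) !scalerA; congr (_ *: _).
exact: mulrC.
Qed.

(** The cyclic sum is trilinear, so coordinate vectors suffice. *)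
Lemma cyclic_multilinear T :
  (forall i j k, T i j k + T j k i + T k i j = 0) ->
  forall X Y Z, pair (along T X) Y Z + pair (along T Y) Z X
                + pair (along T Z) X Y = 0.
Proof.
move=> cT X Y Z.
have E (A B C : 'rV[R]_4) : pair (along T A) B C =
    \sum_i \sum_j \sum_k A 0 i * B 0 j * C 0 k * T i j k.
  rewrite pair_sum exchange_big /= [RHS]exchange_big /=.
  under eq_bigr => k _.
    under eq_bigr => j _ do rewrite /along summxE mulr_sumr.
    rewrite exchange_big /=.
    over.
  rewrite [RHS](eq_bigr (fun j => \sum_k \sum_i A 0 i * B 0 j * C 0 k * T i j k));
    last by move=> j _; rewrite exchange_big.
  rewrite [RHS]exchange_big /=; apply: eq_bigr => k _; rewrite exchange_big /=.
  apply: eq_bigr => j _; apply: eq_bigr => i _; rewrite mxE; ring.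
have -> : pair (along T Y) Z X =
    \sum_i \sum_j \sum_k X 0 i * Y 0 j * Z 0 k * T j k i.
  rewrite E [RHS]exchange_big /=; apply: eq_bigr => j _.
  rewrite [RHS]exchange_big /=; apply: eq_bigr => k _.
  by apply: eq_bigr => i _; ring.
have -> : pair (along T Z) X Y =
    \sum_i \sum_j \sum_k X 0 i * Y 0 j * Z 0 k * T k i j.
  rewrite E exchange_big /=; apply: eq_bigr => i _.
  rewrite exchange_big /=; apply: eq_bigr => j _.
  by apply: eq_bigr => k _; ring.
rewrite E -!big_split /= big1 // => i _; rewrite -!big_split /= big1 // => j _.
rewrite -!big_split /= big1 // => k _.
by rewrite -!mulrDr cT mulr0.
Qed.

Definition pos_def g : Prop := forall v : 'rV[R]_4, v != 0 -> 0 < pair g v v.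

Lemma pos_def_eq0 g X : pos_def g -> pair g X X = 0 -> X = 0.
Proof. by move=> gp e; apply/eqP; apply: contraTT isT => /gp; rewrite e ltxx. Qed.

Lemma pos_def_inj g X Y : pos_def g -> (forall Z, pair g X Z = pair g Y Z) -> X = Y.
Proof.
move=> gp e; apply/eqP; rewrite -subr_eq0; apply/eqP; apply: pos_def_eq0 gp _.
by rewrite pairDl pairNl e subrr.
Qed.

Lemma pos_def_unit g : pos_def g -> g \in unitmx.
Proof.
move=> gp; rewrite -row_free_unit -kermx_eq0; apply/eqP/row_matrixP => i.
rewrite row0; apply: (pos_def_inj gp) => Z.
have /sub_kermxP k0 : (row i (kermx g) <= kermx g)%MS by rewrite row_sub.
by rewrite /pair k0 !mul0mx.
Qed.

End Pairing.

Lemma hermitian_form_skew (R : realFieldType) (g I : 'M[R]_4) :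
  g^T = g -> I *m I = - 1%:M -> I *m g *m I^T = g -> (I *m g)^T = - (I *m g).
Proof.
move=> gsym I2 IgI; rewrite trmx_mul gsym -{2}IgI !mulmxA I2 mulNmx mul1mx.
by rewrite mulNmx opprK.
Qed.

Section HermitianPoint.
Context {R : realFieldType}.
(** One Hermitian structure at a point: [g] the metric, [I] the complex
    structure, [Gam] the Christoffel symbols, [dI] the coordinate derivatives
    of [I], [C] the Christoffel symbols of a torsion-free connection for which
    [I] is parallel, [theta] the Lee form. *)
Variables (g I : 'M[R]_4) (Gam C dI : 'I_4 -> 'M[R]_4) (theta : 'cV[R]_4).
Hypothesis gsym : g^T = g.
Hypothesis gpos : pos_def g.
Hypothesis I2 : I *m I = - 1%:M.
Hypothesis IgI : I *m g *m I^T = g.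
Hypothesis GamS : torsion_free Gam.
Hypothesis CS : torsion_free C.
Hypothesis dIE : forall k, dI k = C k *m I - I *m C k.
Hypothesis dI_skew : forall k,
  (dI k *m g + I *m (Gam k *m g + g *m (Gam k)^T))^T
  = - (dI k *m g + I *m (Gam k *m g + g *m (Gam k)^T)).
Hypothesis lee : forall i j k,
  let T l := dI l *m g + I *m (Gam l *m g + g *m (Gam l)^T)
             - (2 * theta l 0) *: (I *m g) in
  T i j k + T j k i + T k i j = 0.

Local Notation "<< X , Y >>" := (pair g X Y).

(** The covariant derivative of [I] along the [k]-th coordinate vector. *)
Definition cov_endo k : 'M[R]_4 := dI k + I *m Gam k - Gam k *m I.

Lemma pairC X Y : <<X, Y>> = <<Y, X>>.
Proof. by rewrite -pair_tr gsym. Qed.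

Lemma pairII X Y : <<X *m I, Y *m I>> = <<X, Y>>.
Proof. by rewrite -pairMl -pairMr IgI. Qed.

Lemma mulII (X : 'rV[R]_4) : X *m I *m I = - X.
Proof. by rewrite -mulmxA I2 mulmxN mulmx1. Qed.

Lemma pairI X Y : <<X *m I, Y>> = - <<X, Y *m I>>.
Proof. by rewrite -(pairII (X *m I)) mulII pairNl. Qed.

Local Notation H := (fun k => C k - Gam k).
Local Notation A := cov_endo.

Lemma cov_endoE k : A k = H k *m I - I *m H k.
Proof. by rewrite /cov_endo dIE /= mulmxBl mulmxBr; mx_group. Qed.

Local Notation a X Y Z := (<<Y *m along A X, Z>>).
Local Notation h X Y Z := (<<Y *m along H X, Z>>).
Local Notation th X := ((X *m theta) 0 0).

Lemma along_covE X : along A X = along H X *m I - I *m along H X.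
Proof.
rewrite (along_eq _ cov_endoE) (along_add (fun k => H k *m I)) along_opp.
by rewrite along_mulr along_mull.
Qed.

Let aE X Y Z : a X Y Z = - h X Y (Z *m I) - h X (Y *m I) Z.
Proof. by rewrite /= along_covE mulmxBr pairDl pairNl !mulmxA pairI. Qed.

Let hS X Y Z : h X Y Z = h Y X Z.
Proof.
rewrite /= (@torsion_freeP _ (fun k => C k - Gam k)) // => i k.
by rewrite !linearB /= GamS CS.
Qed.

Let aIY X Y Z : a X (Y *m I) Z = a X Y (Z *m I).
Proof.
rewrite !aE /= !mulII !mulNmx !(pairNl, pairNr); ring.
Qed.

Lemma cov_form_skew k : (A k *m g)^T = - (A k *m g).
Proof.
have wS := hermitian_form_skew gsym I2 IgI.
have -> : A k *m g = (dI k *m g + I *m (Gam k *m g + g *m (Gam k)^T))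
    - (Gam k *m (I *m g) - (Gam k *m (I *m g))^T).
  rewrite trmx_mul wS /cov_endo !mulmxBl !mulmxDl mulmxDr !mulmxA mulNmx.
  by rewrite -!mulmxA !mulmxA; mx_group.
rewrite linearB /= dI_skew linearB /= trmxK; mx_group.
Qed.

Let aS X Y Z : a X Y Z = - a X Z Y.
Proof.
rewrite /= -!pairMl -(pair_tr (along A X *m g)) -along_mulr -along_tr.
by rewrite (along_eq _ cov_form_skew) along_opp pair_oppm.
Qed.

(** Integrability enters through the symmetry of [H], the difference of two
    torsion-free connections.  The tensor [b] below is symmetric in its first
    two arguments and skew in the last two, hence zero. *)
Lemma integrable_cov X Y Z : a (X *m I) Y Z = - a X (Y *m I) Z.
Proof.
pose b X Y Z := a (X *m I) Y Z + a X (Y *m I) Z.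
have bS U V W : b U V W = b V U W.
  rewrite /b !aE /= !mulII !mulNmx !(pairNl, pairNr).
  have := hS (U *m I) V (W *m I); have := hS U (V *m I) (W *m I).
  have := hS (U *m I) (V *m I) W; have := hS U V W.
  move=> /= -> -> -> ->; ring.
have bK U V W : b U V W = - b U W V.
  by rewrite /b /= (aS (U *m I) V W) (aIY U V W) (aS U V (W *m I)) opprD.
have := (bS X Y Z, bS X Z Y, bS Y Z X, (bK X Y Z, bK Y X Z, bK Z X Y)).
move=> [[[b1 b2] b3] [[b4 b5] b6]].
suff : b X Y Z = 0 by rewrite /b => /eqP; rewrite addr_eq0 => /eqP.
lra.
Qed.

Let lee_cyc X Y Z :
  let w X Y := <<X *m I, Y>> in
  a X Y Z + a Y Z X + a Z X Y
  = 2 * (th X * w Y Z + th Y * w Z X + th Z * w X Y).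
Proof.
move=> w; have wC U V : w U V = - w V U by rewrite /w pairI pairC.
pose T l := dI l *m g + I *m (Gam l *m g + g *m (Gam l)^T)
             - (2 * theta l 0) *: (I *m g).
have TE l : T l = A l *m g + (Gam l *m (I *m g) + (I *m g) *m (Gam l)^T)
     - theta l 0 *: (2 *: (I *m g)).
  rewrite /T scalerA (mulrC (theta l 0)); congr (_ - _).
  rewrite /cov_endo !mulmxBl !mulmxDl !mulmxDr !mulmxA; mx_group.
have aT U V W : pair (along T U) V W = a U V W + (w (V *m along Gam U) W
    + w V (W *m along Gam U)) - th U * (2 * w V W).
  rewrite (along_eq _ TE) (along_add (fun l => A l *m g + _)) along_opp.
  rewrite (along_add (fun l => A l *m g)) along_mulr.
  rewrite (along_add (fun l => Gam l *m (I *m g))) along_mulr along_mull.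
  rewrite along_scale along_tr !(pair_addm, pair_oppm, pair_scalem).
  by rewrite (pairMr (along Gam U) (I *m g)) !pairMl /w.
have := cyclic_multilinear lee X Y Z; rewrite -/T !aT.
have -> : Y *m along Gam X = X *m along Gam Y by apply: torsion_freeP.
have -> : Z *m along Gam X = X *m along Gam Z by apply: torsion_freeP.
have -> : Z *m along Gam Y = Y *m along Gam Z by apply: torsion_freeP.
rewrite (wC Z (X *m _)) (wC Y (X *m _)) (wC X (Y *m _)).
lra.
Qed.

(** By [integrable_cov] the covariant derivative of [I] has no more components
    than the exterior derivative of the Kähler form, from which it is recovered
    by evaluating the Lee equation on [(Y, Z, X)] and on [(Y I, - Z I, X)]. *)
Lemma cov_lee X Y (xi : 'rV[R]_4) : xi *m g = theta^T ->
  Y *m along A X = th (Y *m I) *: X - <<X, Y *m I>> *: xi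
                   - th Y *: (X *m I) + <<X, Y>> *: (xi *m I).
Proof.
move=> xiE; apply: (pos_def_inj gpos) => Z.
have txi W : th W = <<xi, W>>.
  by rewrite /pair xiE -trmx_mul [RHS]mxE.
rewrite !(pairDl, pairNl, pairZl).
(* [c1] to [c6] eliminate the values of the covariant derivative that do not
   occur in the goal. *)
have e1 := lee_cyc (Y *m I) (- Z *m I) X; have e2 := lee_cyc Y Z X.
have c1 := integrable_cov Y (- Z *m I) X; have c2 := aIY X Y (- Z *m I).
have c3 := integrable_cov (- Z *m I) X Y.
have c4 := aIY Y (- Z *m I) X; have c5 := aIY (- Z *m I) X Y.
have c6 := aS X (Y *m I) (- Z *m I).
rewrite /= in e1 e2 c1 c2 c3 c4 c5 c6.
rewrite !mulNmx !mulII !opprK in e1 e2 c1 c2 c3 c4 c5 c6.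
rewrite !(pairNl, pairNr, alongN, mulmxN, mulNmx, pairII, mulII, opprK) in e1 e2 c1 c2 c3 c4 c5 c6.
rewrite /= in e1 e2 c1 c2 c3 c4 c5 c6.
have t0 : (- (Z *m I *m theta)) 0 0 = - <<xi, Z *m I>> by rewrite mxE txi.
rewrite t0 !txi in e1 e2 *.
rewrite (pairI X) (pairI Y) (pairC (Z *m I) X) in e2.
rewrite (pairC Z X) in e1.
rewrite (pairI X) (pairI xi).
lra.
Qed.

End HermitianPoint.

(** * Pairs of opposite structures at a point *)

Section PlaneInKernel.
Context {R : realFieldType}.

Lemma orthogonal_basis_kernel (g K : 'M[R]_4) (e f X : 'rV[R]_4) (n : R) :
  \rank (kermx K) = 2%N -> e *m K = 0 -> f *m K = 0 -> X *m K = 0 ->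
  n != 0 -> pair g e e = n -> pair g f f = n -> pair g e f = 0 -> pair g f e = 0 ->
  n *: X = pair g X e *: e + pair g X f *: f.
Proof.
move=> rK eK fK XK n0 ee ff ef fe.
pose B : 'M[R]_(1 + 1, 4) := col_mx e f.
have BK : (B <= kermx K)%MS by apply/sub_kermxP; rewrite mul_col_mx eK fK col_mx0.
have Bfree : row_free B.
  rewrite -kermx_eq0; apply/eqP/row_matrixP => i; rewrite row0.
  set r := row i _; have rB : r *m B = 0.
    by apply/sub_kermxP; rewrite /r row_sub.
  rewrite -[r]hsubmxK in rB *; move: (lsubmx r) (rsubmx r) rB => a b.
  rewrite mul_row_col [a]mx11_scalar [b]mx11_scalar !mul_scalar_mx => ab.
  have a0 : a 0 0 = 0.
    have := congr1 (fun v => pair g v e) ab; rewrite pairDl !pairZl ee fe /pair.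
    rewrite !mul0mx mxE mulr0 addr0 => /eqP; rewrite mulf_eq0 (negbTE n0) orbF.
    by move/eqP.
  have b0 : b 0 0 = 0.
    have := congr1 (fun v => pair g v f) ab; rewrite pairDl !pairZl ff ef /pair.
    rewrite !mul0mx mxE mulr0 add0r => /eqP; rewrite mulf_eq0 (negbTE n0) orbF.
    by move/eqP.
  by rewrite a0 b0 !raddf0 row_mx0.
have /eqmxP BE : (B == kermx K)%MS.
  by rewrite -(mxrank_leqif_eq BK) rK (eqP Bfree).
have /submxP[c XE] : (X <= B)%MS by rewrite BE; apply/sub_kermxP.
rewrite -[c]hsubmxK in XE; move: (lsubmx c) (rsubmx c) XE => a b.
rewrite mul_row_col [a]mx11_scalar [b]mx11_scalar !mul_scalar_mx => ->.
rewrite !pairDl !pairZl ee ff ef fe !mulr0 addr0 add0r scalerDr !scalerA.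
by rewrite mulrC (mulrC n).
Qed.

End PlaneInKernel.

Section OppositePoint.
Context {R : realFieldType}.
Variables (g J I : 'M[R]_4).
Hypothesis gsym : g^T = g.
Hypothesis gpos : pos_def g.
Hypothesis J2 : J *m J = - 1%:M.
Hypothesis JgJ : J *m g *m J^T = g.
Hypothesis I2 : I *m I = - 1%:M.
Hypothesis IgI : I *m g *m I^T = g.
Hypothesis IJC : I *m J = J *m I.
Hypothesis rankD : \rank (kermx (I - J)%R) = 2%N.

Implicit Types (X Y Z v xi : 'rV[R]_4).
Local Notation "<< X , Y >>" := (pair g X Y).
Local Notation inD X := (X *m I = X *m J).
Local Notation inP X := (X *m I = - (X *m J)).

Let gC := pairC gsym.
Let JJ := pairII JgJ.
Let II := pairII IgI.
Let mJJ := mulII J2.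
Let mII := mulII I2.
Let pJ := pairI J2 JgJ.
Let pI := pairI I2 IgI.

Lemma inD_ker X : inD X <-> X *m (I - J) = 0.
Proof.
by rewrite mulmxBr; split=> [->|/eqP]; [rewrite subrr|rewrite subr_eq0 => /eqP].
Qed.

Lemma inP_ker X : inP X <-> X *m (I + J) = 0.
Proof.
by rewrite mulmxDr; split=> [->|/eqP]; [rewrite addNr|rewrite addr_eq0 => /eqP].
Qed.

Lemma inD_J X : inD X -> inD (X *m J).
Proof. by move=> XD; rewrite -mulmxA -IJC mulmxA XD. Qed.

Lemma inP_J X : inP X -> inP (X *m J).
Proof. by move=> XD; rewrite -mulmxA -IJC mulmxA XD mulNmx. Qed.

Lemma inD_orth_inP X Y : inD X -> inP Y -> <<X, Y>> = 0.
Proof.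
move=> XD YP; have e : <<X, Y>> = - <<X, Y>>.
  by rewrite -{1}II XD YP pairNr JJ.
lra.
Qed.

Lemma inP_orth_inD X Y : inP X -> inD Y -> <<X, Y>> = 0.
Proof. by move=> XP YD; rewrite gC inD_orth_inP. Qed.

Lemma proj_inD X : inD (X - X *m I *m J).
Proof.
rewrite !mulmxBl -(mulmxA _ J I) -IJC !mulmxA mJJ mII mulNmx !opprK addrC.
by [].
Qed.

Lemma proj_inP X : inP (X + X *m I *m J).
Proof.
rewrite !mulmxDl -(mulmxA _ J I) -IJC !mulmxA mJJ mII mulNmx opprD opprK.
exact: addrC.
Qed.

(** [X - X I J] and [X + X I J] are twice the components of [X] along [D] and
    along its complement. *)
Lemma inD_inP_split (A B : 'M[R]_4) :
  (forall X : 'rV[R]_4, inD X -> X *m A = X *m B) ->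
  (forall X : 'rV[R]_4, inP X -> X *m A = X *m B) -> A = B.
Proof.
move=> hD hP; apply/row_matrixP => i; rewrite !rowE; set X := delta_mx 0 i.
have h1 := hD _ (proj_inD X); have h2 := hP _ (proj_inP X).
have : (X + X) *m A = (X + X) *m B.
  have -> : X + X = (X - X *m I *m J) + (X + X *m I *m J).
    by rewrite [RHS]addrACA addNr addr0.
  by rewrite mulmxDl h1 h2 -mulmxDl.
rewrite -mulr2n -scaler_nat -!scalemxAl => /(congr1 (fun v => 2^-1 *: v)).
by rewrite !scalerA mulVf ?pnatr_eq0 // !scale1r.
Qed.

Lemma orth_inD_inP X : (forall Y, inD Y -> <<X, Y>> = 0) -> inP X.
Proof.
move=> h; have XD := proj_inD X; have XP := proj_inP X; have e := h _ XD.
have : <<X - X *m I *m J, X - X *m I *m J>> = 0.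
  have : <<X + X, X - X *m I *m J>> = 0 by rewrite pairDl e addr0.
  have -> : X + X = (X - X *m I *m J) + (X + X *m I *m J).
    by rewrite [RHS]addrACA addNr addr0.
  by rewrite pairDl (inP_orth_inD XP XD) addr0.
move=> /(pos_def_eq0 gpos)/eqP; rewrite subr_eq0 => /eqP XE.
by rewrite {2}XE -!mulmxA J2 !mulmxN mulmx1 opprK.
Qed.

Lemma pairJ0 X : <<X, X *m J>> = 0.
Proof. by have := pJ X X; rewrite gC; lra. Qed.

Lemma rank_inP : \rank (kermx (I + J)%R) = 2%N.
Proof.
have prod0 : (I + J) *m (I - J) = 0.
  rewrite mulmxDl !mulmxBr I2 J2 IJC; mx_group.
have le1 : (\rank (I + J)%R <= 2)%N.
  by rewrite -[X in (_ <= X)%N]rankD; apply: mxrankS; apply/sub_kermxP.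
have cap0 : (kermx (I - J)%R :&: kermx (I + J)%R)%MS = 0.
  apply/eqP; rewrite -submx0; apply/row_subP => i; set r := row i _.
  have : (r <= kermx (I - J)%R :&: kermx (I + J)%R)%MS by rewrite row_sub.
  rewrite sub_capmx => /andP[/sub_kermxP/inD_ker rD /sub_kermxP/inP_ker rP].
  suff -> : r = 0 by exact: sub0mx.
  by apply: (pos_def_eq0 gpos); exact: inD_orth_inP.
have := mxrank_sum_cap (kermx (I - J)%R) (kermx (I + J)%R).
rewrite cap0 mxrank0 addn0 rankD => e.
have := rank_leq_row (kermx (I - J)%R + kermx (I + J)%R)%MS; rewrite e => le2.
apply/eqP; rewrite eqn_leq -(leq_add2l 2%N) le2 /= mxrank_ker.
by apply: leq_trans (leq_sub2l 4 le1).
Qed.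

Lemma exists_inP : exists2 Z : 'rV[R]_4, Z != 0 & inP Z.
Proof.
have : kermx (I + J)%R != 0 by rewrite -mxrank_eq0 rank_inP.
move=> /rowV0Pn [v /sub_kermxP/inP_ker vP v0]; by exists v.
Qed.

Lemma exists_inD : exists2 Y : 'rV[R]_4, Y != 0 & inD Y.
Proof.
have : kermx (I - J)%R != 0 by rewrite -mxrank_eq0 rankD.
move=> /rowV0Pn [v /sub_kermxP/inD_ker vP v0]; by exists v.
Qed.

Lemma inP_basis v X : v != 0 -> inP v -> inP X ->
  <<v, v>> *: X = <<X, v>> *: v + <<X, v *m J>> *: (v *m J).
Proof.
move=> v0 vP XP.
apply: (@orthogonal_basis_kernel _ g (I + J)) => //.
- exact: rank_inP.
- exact/inP_ker.
- exact/inP_ker/inP_J.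
- exact/inP_ker.
- by rewrite gt_eqF // gpos.
- exact: pairJ0.
- by rewrite gC pairJ0.
Qed.

Lemma inD_basis v X : <<v, v>> != 0 -> inD v -> inD X ->
  <<v, v>> *: X = <<X, v>> *: v + <<X, v *m J>> *: (v *m J).
Proof.
move=> v0 vD XD.
apply: (@orthogonal_basis_kernel _ g (I - J)) => //.
- exact/inD_ker.
- exact/inD_ker/inD_J.
- exact/inD_ker.
- exact: pairJ0.
- by rewrite gC pairJ0.
Qed.

(** The symmetry hypothesis is the involutivity of [D] when [A] is the covariant
    derivative of [I].  Applied to [Y] and [Y I], for one nonzero [Y] in [D], it
    expresses [xi] as a combination of [Y] and [Y I]. *)
Lemma lee_vector_inD (A : 'I_4 -> 'M[R]_4) (theta : 'cV[R]_4) (xi : 'rV[R]_4) :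
  (forall X Y, Y *m along A X = (Y *m I *m theta) 0 0 *: X - <<X, Y *m I>> *: xi
      - (Y *m theta) 0 0 *: (X *m I) + <<X, Y>> *: (xi *m I)) ->
  (forall Y Z : 'rV[R]_4, inD Y -> inD Z -> Z *m along A Y = Y *m along A Z) ->
  inD xi.
Proof.
move=> AE sym; have [Y Y0 YD] := exists_inD.
have YID : inD (Y *m I) by rewrite YD; exact: inD_J.
have YY : <<Y, Y>> != 0 by rewrite gt_eqF // gpos.
have := sym _ _ YD YID; rewrite !AE !mII !(mulNmx, pairNr).
have -> : <<Y, Y *m I>> = 0 by rewrite YD pairJ0.
have -> : <<Y *m I, Y>> = 0 by rewrite YD gC pairJ0.
rewrite II mxE => e.
set t := (Y *m theta) 0 0 in e; set s := (Y *m I *m theta) 0 0 in e.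
have xiE : <<Y, Y>> *: xi = t *: Y + s *: (Y *m I).
  apply/rowP => j; move/rowP/(_ j): e; rewrite !mxE.
  set a := xi 0 j; set b := Y 0 j; set c := (\sum_i _)%R; set d := (\sum_i _)%R.
  lra.
have := congr1 (fun v => v *m (I - J)) xiE.
rewrite mulmxDl -!scalemxAl (inD_ker Y).1 // (inD_ker (Y *m I)).1 // !scaler0 addr0.
move=> /eqP; rewrite scaler_eq0 (negbTE YY) => /eqP xiD; exact/inD_ker.
Qed.

(** In this section [theta] stands for [du], [xi] for the gradient of [u] and [N]
    for its Hessian; [NK] is what differentiating [xi (I - J) = 0] gives. *)
Section HessianPoint.
Variables (theta : 'cV[R]_4) (xi : 'rV[R]_4) (N : 'M[R]_4).
Let n := <<xi, xi>>.
Let a := \tr N / 2.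
Local Notation th X := ((X *m theta) 0 0).
Hypothesis xiE : xi *m g = theta^T.
Hypothesis xiD : inD xi.
Hypothesis Nsym : forall X Y, <<X *m N, Y>> = <<Y *m N, X>>.
Hypothesis NK : forall X, X *m N *m (I - J) =
  n *: (X *m I) - th (X *m I) *: xi - th X *: (xi *m I).
Hypothesis n0 : n != 0.

Lemma thE X : th X = <<X, xi>>.
Proof. by rewrite gC /pair xiE -trmx_mul [RHS]mxE. Qed.

Lemma hessian_inD Y : inD Y -> inD (Y *m N).
Proof.
move=> YD; apply/inD_ker; rewrite NK !thE.
have := inD_basis n0 xiD (inD_J YD); rewrite -YD -/n => ->.
by rewrite xiD YD JJ addrAC addrK subrr.
Qed.

(** Modulo [D] this is [NK]; there is no component along [D] because [N] is
    symmetric and preserves [D]. *)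
Lemma hessian_inP Z : inP Z -> Z *m N = (n / 2) *: Z.
Proof.
move=> ZP; pose w := Z *m N - (n / 2) *: Z.
have wD : inD w.
  apply/inD_ker; rewrite /w mulmxBl NK !thE.
  have -> : <<Z *m I, xi>> = 0.
    by rewrite ZP pairNl (inP_orth_inD (inP_J ZP) xiD) oppr0.
  rewrite (inP_orth_inD ZP xiD) !scale0r !subr0 -scalemxAl mulmxBr.
  rewrite -[Z *m J]opprK -ZP opprK -mulr2n -[Z *m I *+ 2]scaler_nat scalerA.
  by rewrite divfK ?pnatr_eq0 // subrr.
suff w0 : w = 0 by apply/eqP; rewrite -subr_eq0; apply/eqP.
apply: (pos_def_eq0 gpos).
rewrite {1}/w pairDl pairNl pairZl (inP_orth_inD ZP wD) mulr0 subr0.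
by rewrite Nsym; exact: inD_orth_inP (hessian_inD wD) ZP.
Qed.

(** Since [I J] is [-1] on [D] and [1] on its complement, [1 - I J] is twice the
    projection onto [D], of which [xi] and [xi J] are an orthogonal frame. *)
Lemma proj_frame :
  n *: (1%:M - I *m J) = 2 *: (theta *m xi - (J *m theta) *m (xi *m J)).
Proof.
apply: inD_inP_split => X XD; rewrite -!scalemxAr !mulmxBr mulmx1 !mulmxA XD.
  rewrite mJJ opprK -mulr2n -[X *+ 2]scaler_nat scalerA mulrC -scalerA.
  rewrite (inD_basis n0 xiD XD) -/n; congr (_ *: _).
  rewrite [X *m theta]mx11_scalar [X *m J *m theta]mx11_scalar !thE pJ.
  by rewrite -mulmxA !mul_scalar_mx scaleNr opprK.
rewrite mulNmx mJJ opprK subrr scaler0.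
have -> : X *m theta = 0.
  by rewrite [LHS]mx11_scalar thE (inP_orth_inD XD xiD) raddf0.
have -> : X *m J *m theta = 0.
  by rewrite [LHS]mx11_scalar thE (inP_orth_inD (inP_J XD) xiD) raddf0.
by rewrite !mul0mx subrr scaler0.
Qed.

Let mxtraceB m (A B : 'M[R]_m) : \tr (A - B) = \tr A - \tr B.
Proof. exact: linearB. Qed.

Let mxtraceN m (A : 'M[R]_m) : \tr (- A) = - \tr A.
Proof. exact: linearN. Qed.

Lemma trace_IJ : \tr (I *m J) = 0.
Proof.
have := congr1 mxtrace proj_frame.
rewrite !mxtraceZ !mxtraceB mxtrace1 [\tr (theta *m xi)]mxtrace_mulC.
rewrite [\tr (J *m theta *m _)]mxtrace_mulC !mulmxA mJJ mulNmx mxtraceN.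
rewrite trace_mx11 thE -/n opprK => e; apply: (mulfI n0); rewrite mulr0.
move: e; set t := \tr (I *m J); lra.
Qed.

(** The trace of [N] on the complement of [D] is [n], and the rest is computed in
    the frame [xi], [xi J] of [D]. *)
Lemma hessian_trace :
  n * (\tr N - n) = <<xi *m N, xi>> + <<xi *m J *m N, xi *m J>>.
Proof.
have NP : (1%:M + I *m J) *m N = (n / 2) *: (1%:M + I *m J).
  apply/row_matrixP => i; rewrite !rowE; set X := delta_mx 0 i.
  by rewrite -scalemxAr mulmxA mulmxDr mulmx1 mulmxA hessian_inP //; apply: proj_inP.
have trP : \tr ((1%:M + I *m J) *m N) = 2 * n.
  by rewrite NP mxtraceZ mxtraceD mxtrace1 trace_IJ; lra.
have := congr1 (fun A => \tr (A *m N)) proj_frame.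
have -> : 1%:M - I *m J = 2 *: 1%:M - (1%:M + I *m J).
  by rewrite scaler_nat mulr2n opprD addrA addrK.
rewrite -!scalemxAl !mxtraceZ !mulmxBl !mxtraceB trP -scalemxAl mul1mx mxtraceZ.
rewrite -(mulmxA theta) [\tr (theta *m _)]mxtrace_mulC trace_mx11 thE.
rewrite -(mulmxA (J *m theta)) [\tr (J *m theta *m _)]mxtrace_mulC trace_mx11 mulmxA thE.
rewrite pJ; set t := \tr N; lra.
Qed.

(** Both sides commute with [J] and preserve [D] and its complement, on each of
    which they are multiples of [J]; the trace fixes the multiple on [D]. *)
Lemma ddc_form : N *m J + J *m N = a *: J + (a - n) *: I.
Proof.
set M := N *m J + J *m N.
have ME X : X *m M = X *m N *m J + X *m J *m N by rewrite mulmxDr !mulmxA.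
have xM : xi *m M = (\tr N - n) *: (xi *m J).
  have MD : inD (xi *m M).
    rewrite ME !mulmxDl (inD_J (hessian_inD xiD)); congr (_ + _).
    exact: hessian_inD (inD_J xiD).
  have := inD_basis n0 xiD MD; rewrite -/n ME !pairDl JJ -hessian_trace pJ.
  rewrite [<<xi *m J *m N, xi>>]Nsym addNr scale0r add0r -ME => e.
  by apply: (scalerI n0); rewrite e scalerA.
apply: inD_inP_split => X XD.
  apply: (scalerI n0); rewrite !scalemxAl (inD_basis n0 xiD XD) !mulmxDl -!scalemxAl.
  have BE : xi *m (a *: J + (a - n) *: I) = (\tr N - n) *: (xi *m J).
    rewrite mulmxDr -!scalemxAr xiD -scalerDl; congr (_ *: _).
    rewrite /a; set t := \tr N; lra.
  rewrite xM BE; congr (_ + _ *: _).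
  have -> : xi *m J *m M = xi *m M *m J.
    by rewrite !ME mJJ mulmxDl mJJ mulNmx addrC.
  have -> : xi *m J *m (a *: J + (a - n) *: I) = xi *m (a *: J + (a - n) *: I) *m J.
    by rewrite !mulmxDr mulmxDl -!scalemxAr -!scalemxAl -(mulmxA xi J I) -IJC mulmxA.
  by rewrite xM BE.
rewrite ME (hessian_inP XD) (hessian_inP (inP_J XD)) -scalemxAl -[LHS]scalerDl.
rewrite mulmxDr -!scalemxAr XD scalerN -scaleNr -[RHS]scalerDl; congr (_ *: _).
rewrite /a; set t := \tr N; lra.
Qed.

(** Closedness of the 2-form [ddc_form], with [alpha] the differential of [a]
    and [dn] that of [n]. *)
Variables (alpha dn : 'cV[R]_4).
Hypothesis dnE : forall W : 'rV[R]_4, (W *m dn) 0 0 = 2 * <<W *m N, xi>>.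
Hypothesis closed_ddc : forall i j k,
  let T l := alpha l 0 *: (J *m g)
     + (alpha l 0 - dn l 0 + 2 * (a - n) * theta l 0) *: (I *m g) in
  T i j k + T j k i + T k i j = 0.

Let closed_ddc_vec X Y Z :
  let al X := (X *m alpha) 0 0 in
  let be X := (X *m alpha) 0 0 - (X *m dn) 0 0 + 2 * (a - n) * th X in
  al X * <<Y *m J, Z>> + be X * <<Y *m I, Z>>
  + (al Y * <<Z *m J, X>> + be Y * <<Z *m I, X>>)
  + (al Z * <<X *m J, Y>> + be Z * <<X *m I, Y>>) = 0.
Proof.
move=> al be.
pose c : 'cV[R]_4 := alpha - dn + (2 * (a - n)) *: theta.
have := cyclic_multilinear closed_ddc X Y Z.
have TE l : alpha l 0 *: (J *m g)
     + (alpha l 0 - dn l 0 + 2 * (a - n) * theta l 0) *: (I *m g)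
   = alpha l 0 *: (J *m g) + c l 0 *: (I *m g) by rewrite !mxE.
have E U V W : pair (along (fun l => alpha l 0 *: (J *m g)
     + (alpha l 0 - dn l 0 + 2 * (a - n) * theta l 0) *: (I *m g)) U) V W =
   al U * <<V *m J, W>> + be U * <<V *m I, W>>.
  rewrite (along_eq _ TE) (along_add (fun l => alpha l 0 *: (J *m g))) !along_scale.
  rewrite pair_addm !pair_scalem !pairMl; congr (_ * _ + _ * _).
  by rewrite /c /be mulmxDr mulmxBr -scalemxAr !mxE.
by rewrite !E.
Qed.

Lemma dn_inP Z : inP Z -> (Z *m dn) 0 0 = 0.
Proof.
by move=> ZP; rewrite dnE hessian_inP // pairZl (inP_orth_inD ZP xiD) !mulr0.
Qed.

(** Closedness tested on [xi], [xi J] and [Z]. *)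
Lemma alpha_inP Z : inP Z -> (Z *m alpha) 0 0 = 0.
Proof.
move=> ZP; have := closed_ddc_vec xi (xi *m J) Z => /=.
rewrite mJJ !(pairNl, pairNr).
rewrite (inP_orth_inD (inP_J ZP) xiD) (inD_orth_inP xiD ZP).
rewrite -[xi *m J *m I]mulmxA -IJC mulmxA xiD mJJ pairNl (inD_orth_inP xiD ZP).
rewrite ZP pairNl (inP_orth_inD (inP_J ZP) xiD) JJ -/n (dn_inP ZP).
rewrite !thE (inP_orth_inD ZP xiD); set t := (Z *m alpha) 0 0 => e.
have : n * t = 0 by lra.
by move=> /eqP; rewrite mulf_eq0 (negbTE n0) => /eqP.
Qed.

(** On [D] this is closedness tested on [X], [Z] and [Z J] with [Z] orthogonal to
    [D]; on the complement of [D] both sides vanish. *)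
Lemma dn_theta (W : 'rV[R]_4) : (W *m dn) 0 0 = 2 * (a - n) * th W.
Proof.
have dnD X : inD X -> (X *m dn) 0 0 = 2 * (a - n) * th X.
  move=> XD; have [Z Z0 ZP] := exists_inP.
  have := closed_ddc_vec X Z (Z *m J) => /=.
  rewrite XD (inP_J ZP) ZP mJJ !(pairNl, opprK) JJ.
  rewrite (inP_orth_inD ZP XD) (inD_orth_inP (inD_J XD) ZP).
  have : <<Z, Z>> != 0 by rewrite gt_eqF // gpos.
  set x := (X *m alpha) 0 0; set y := (X *m dn) 0 0; set z := th X; set q := <<Z, Z>>.
  move=> q0 e; apply: (mulfI q0); lra.
have e : dn *m (1%:M : 'M[R]_1) = (2 * (a - n)) *: theta *m (1%:M : 'M[R]_1).
  have : dn *m xi = ((2 * (a - n)) *: theta) *m xi.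
    apply: inD_inP_split => X XD; rewrite !mulmxA; congr (_ *m _).
      rewrite [LHS]mx11_scalar dnD // -scalemxAr [RHS]mx11_scalar; congr (_%:M).
      by rewrite [RHS]mxE.
    rewrite [LHS]mx11_scalar dn_inP // -scalemxAr [RHS]mx11_scalar; congr (_%:M).
    by rewrite [RHS]mxE thE (inP_orth_inD XD xiD) mulr0.
  move=> /(congr1 (fun A => A *m theta)); rewrite -!mulmxA => h.
  have xt : xi *m theta = n%:M by rewrite [LHS]mx11_scalar thE.
  rewrite xt -[n%:M]scalemx1 -!scalemxAr in h.
  exact: (scalerI n0 h).
rewrite !mulmx1 in e; by rewrite e -scalemxAr [LHS]mxE.
Qed.

(** By [dn_theta] the vector [xi] is an eigenvector of [N], and then [ddc_form]
    makes [xi J] one.  Adding the rank-one term [theta *m xi] equalizes the two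
    eigenvalues on [D]. *)
Lemma hessian_normal_form :
  N + theta *m xi = (n / 4 + a / 2)%:M + (n / 4 - a / 2) *: (I *m J).
Proof.
have xN : xi *m N = (a - n) *: xi.
  apply: (pos_def_inj gpos) => W; rewrite Nsym pairZl (gC xi W).
  by have := dn_theta W; rewrite dnE thE; move: (pair g _ _) (pair g _ _) a => x y z; lra.
have xJN : xi *m J *m N = a *: (xi *m J).
  have := congr1 (fun A => xi *m A) ddc_form.
  rewrite mulmxDr !mulmxA xN -scalemxAl mulmxDr -!scalemxAr xiD -scalerDl.
  move=> /(canRL (addKr _)) ->; rewrite -scaleNr -scalerDl.
  by congr (_ *: _); ring.
apply: inD_inP_split => X XD; rewrite !mulmxDr mul_mx_scalar -scalemxAr !mulmxA XD.
  rewrite mJJ scalerN.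
  have -> : X *m theta *m xi = <<X, xi>> *: xi.
    by rewrite [X *m theta]mx11_scalar thE mul_scalar_mx.
  rewrite -scalerBl (_ : _ - _ = a); last by lra.
  apply: (scalerI n0); rewrite scalerDr scalemxAl scalerA [RHS]scalerA.
  rewrite (mulrC n a) -[RHS]scalerA (inD_basis n0 xiD XD) -/n mulmxDl -!scalemxAl xN xJN.
  rewrite scalerDr !scalerA addrAC -scalerDl; congr (_ *: _ + _ *: _); ring.
rewrite hessian_inP // mulNmx mJJ opprK -scalerDl.
rewrite [X *m theta]mx11_scalar thE (inP_orth_inD XD xiD) raddf0 mul0mx addr0.
by congr (_ *: _); lra.
Qed.

End HessianPoint.
End OppositePoint.

(** * Curvature at a point *)

Section AdditiveMatrixOperations.
Context {R : realFieldType} {m n : nat}.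
Implicit Types A B : 'M[R]_(m, n).
Lemma rowD i A B : row i (A + B) = row i A + row i B. Proof. exact: linearD. Qed.
Lemma rowN i A : row i (- A) = - row i A. Proof. exact: linearN. Qed.
Lemma trmxD A B : (A + B)^T = A^T + B^T. Proof. exact: linearD. Qed.
Lemma trmxN A : (- A)^T = - A^T. Proof. exact: linearN. Qed.
End AdditiveMatrixOperations.

(** The curvature matrix [R(e_i, e_j)] from the Christoffel matrices [C] and
    their derivatives [D i j], of [C j] along [e_i]. *)
Definition curv_of {R : realFieldType} (D : 'I_4 -> 'I_4 -> 'M[R]_4)
    (C : 'I_4 -> 'M[R]_4) (i j : 'I_4) : 'M[R]_4 :=
  D i j - D j i + C j *m C i - C i *m C j.

Section CurvatureFormula.
Context {R : realFieldType}.
Variables (D : 'I_4 -> 'I_4 -> 'M[R]_4) (C : 'I_4 -> 'M[R]_4).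
Notation curv := (curv_of D C).

Lemma curv_of_alt i j : curv i j = - curv j i.
Proof. by rewrite /curv_of; mx_group. Qed.

Lemma curv_of_bianchi i j k : (forall a b c, row c (D a b) = row b (D a c)) ->
  torsion_free C ->
  row k (curv i j) + row i (curv j k) + row j (curv k i) = 0.
Proof.
move=> DS CS; have PS a b c : row c (C b *m C a) = row b (C c *m C a).
  by rewrite !row_mul (CS c b).
rewrite /curv_of !(rowD, rowN).
rewrite (DS i j k) (DS j k i) (DS k i j) (PS i j k) (PS j k i) (PS k i j).
set a1 := row j (D i k); set a2 := row k (D j i); set a3 := row i (D k j).
set a4 := row j (C k *m C i); set a5 := row k (C i *m C j).
set a6 := row i (C j *m C k); clearbody a1 a2 a3 a4 a5 a6.
by apply/rowP => l; rewrite !mxE; ring.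
Qed.

(** [DDh a b] is the second derivative of a parallel metric [h], expressed
    through the connection. *)
Lemma curv_of_skew (h : 'M[R]_4) i j : h^T = h ->
  let DDh a b := D a b *m h + C b *m (C a *m h + h *m (C a)^T)
     + ((C a *m h + h *m (C a)^T) *m (C b)^T + h *m (D a b)^T) in
  DDh i j = DDh j i -> (curv i j *m h)^T = - (curv i j *m h).
Proof.
move=> hs DDh; rewrite /DDh /curv_of; move: (D i j) (D j i) (C i) (C j) => a b c d.
rewrite trmx_mul hs !(trmxD, trmxN) !trmx_mul.
rewrite !(mulmxDl, mulmxDr, mulNmx, mulmxN) !mulmxA.
mx_atoms.
move=> e; apply/matrixP => k l.
have {e} := congr1 (fun A : 'M[R]_4 => A k l) e; rewrite !mxE; lra.
Qed.

Lemma curv_of_comm (J : 'M[R]_4) i j :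
  let DDJ a b := D a b *m J + C b *m (C a *m J - J *m C a)
   - ((C a *m J - J *m C a) *m C b + J *m D a b) in
  DDJ i j = DDJ j i -> curv i j *m J = J *m curv i j.
Proof.
move=> DDJ; rewrite /DDJ /curv_of; move: (D i j) (D j i) (C i) (C j) => a b c d.
rewrite !(mulmxDl, mulmxDr, mulNmx, mulmxN) !mulmxA.
mx_atoms.
move=> e; apply/matrixP => k l.
have {e} := congr1 (fun A : 'M[R]_4 => A k l) e; rewrite !mxE; lra.
Qed.

(** The Ricci identity for a vector field with value [x], first derivatives
    [dx], second derivatives [ddx] and covariant derivative [N]. *)
Lemma curv_of_ricci_identity (x : 'rV[R]_4) (dx : 'I_4 -> 'rV[R]_4)
    (ddx : 'I_4 -> 'I_4 -> 'rV[R]_4) (N : 'M[R]_4) (dN : 'I_4 -> 'M[R]_4) i j :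
  torsion_free C ->
  (forall a, row a N = dx a + x *m C a) ->
  (forall a b, row b (dN a) = ddx a b + (dx a *m C b + x *m D a b)) ->
  ddx i j = ddx j i ->
  x *m curv i j = row j (dN i + N *m C i - C i *m N)
                  - row i (dN j + N *m C j - C j *m N).
Proof.
move=> CS NE dNE ddxE; rewrite !(rowD, rowN) !row_mul !NE !dNE ddxE.
rewrite (CS j i) /curv_of; move: (ddx j i) (row i (C j) *m N) => e f.
move: (D i j) (D j i) (C i) (C j) (dx i) (dx j) => a b c d y z.
rewrite !(mulmxDl, mulmxDr, mulNmx, mulmxN) !mulmxA.
mx_atoms.
by apply/rowP => l; rewrite !mxE; ring.
Qed.

End CurvatureFormula.

Section CurvaturePoint.
Context {R : realFieldType}.
Variables (g J : 'M[R]_4) (Rc : 'I_4 -> 'I_4 -> 'M[R]_4).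
Hypothesis gsym : g^T = g.
Hypothesis gpos : pos_def g.
Hypothesis J2 : J *m J = - 1%:M.
Hypothesis JgJ : J *m g *m J^T = g.
Hypothesis Rc_alt : forall i j, Rc i j = - Rc j i.
Hypothesis Rc_skew : forall i j, (Rc i j *m g)^T = - (Rc i j *m g).
Hypothesis RcJ : forall i j, Rc i j *m J = J *m Rc i j.
Hypothesis bianchi : forall i j k,
  row k (Rc i j) + row i (Rc j k) + row j (Rc k i) = 0.
Implicit Types (X Y Z v : 'rV[R]_4).

Definition ric : 'M[R]_4 := \matrix_(j, k) \sum_i Rc i j k i.

Let Rm i j k l := (Rc i j *m g) k l.

(** The octahedron argument, left to linear arithmetic. *)
Lemma Rm_pair_sym i j k l : Rm i j k l = Rm k l i j.
Proof.
have alt a b c d : Rm a b c d = - Rm b a c d.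
  by rewrite /Rm Rc_alt mulNmx mxE.
have skew a b c d : Rm a b c d = - Rm a b d c.
  by have := congr1 (fun A : 'M[R]_4 => A d c) (Rc_skew a b); rewrite [LHS]mxE [RHS]mxE.
have bi a b c d : Rm a b c d + Rm b c a d + Rm c a b d = 0.
  have E (A : 'M[R]_4) x : (row x A *m g) 0 d = (A *m g) x d by rewrite -row_mul mxE.
  have := congr1 (fun v => (v *m g) 0 d) (bianchi a b c).
  by rewrite !mulmxDl mul0mx [LHS]mxE [X in X + _]mxE [RHS]mxE !E.
have := (bi i j k l, bi j k l i, bi k l i j, bi l i j k).
have := (skew i j l k, skew k l j i, skew j k l i, alt i k l j).
have := (skew k i l j, alt j l i k, skew l j i k, skew l i j k).
move=> [[[s1 s2] s3] s4] [[[s5 s6] s7] s8] [[[b1 b2] b3] b4].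
lra.
Qed.

Lemma ric_sym : ric^T = ric.
Proof.
have gu := pos_def_unit gpos; set G := invmx g.
have Gs : G^T = G by rewrite /G trmx_inv gsym.
have RE i j k l : Rc i j k l = \sum_m Rm i j k m * G m l.
  by rewrite -[in LHS](mulmxK gu (Rc i j)) mxE.
apply/matrixP => j k; rewrite !mxE.
under eq_bigr do rewrite RE; under [RHS]eq_bigr do rewrite RE.
rewrite exchange_big /=; apply: eq_bigr => l _; apply: eq_bigr => m _.
rewrite Rm_pair_sym /Rm Rc_alt mulNmx mxE.
have := congr1 (fun A : 'M[R]_4 => A k m) (Rc_skew l j).
rewrite [LHS]mxE [RHS]mxE => ->.
by rewrite opprK; congr (_ * _); rewrite -{1}Gs mxE.
Qed.

Definition Rc2 X Y : 'M[R]_4 := \sum_i \sum_j (X 0 i * Y 0 j) *: Rc i j.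

Let Rc2_form X Y k l : (Rc2 X Y *m g) k l = pair (Rc k l *m g) X Y.
Proof.
rewrite /Rc2 mulmx_suml summxE pair_sum; apply: eq_bigr => i _.
rewrite mulmx_suml summxE; apply: eq_bigr => j _.
by rewrite -scalemxAl mxE; congr (_ * _); apply: Rm_pair_sym.
Qed.

Let Rc2_JJ X Y : Rc2 (X *m J) (Y *m J) = Rc2 X Y.
Proof.
apply: (can_inj (mulmxK (pos_def_unit gpos))).
apply/matrixP => k l; rewrite !Rc2_form -pairMl mulmxA -RcJ -mulmxA.
by rewrite -pairMr -!mulmxA (mulmxA J) JgJ.
Qed.

Let Rc2Nr X Y : Rc2 X (- Y) = - Rc2 X Y.
Proof.
rewrite /Rc2 -sumrN; apply: eq_bigr => i _; rewrite -sumrN; apply: eq_bigr => j _.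
by rewrite mxE mulrN scaleNr.
Qed.

Let Rc2_Jl X Y : Rc2 (X *m J) Y = - Rc2 X (Y *m J).
Proof. by rewrite -Rc2Nr -(Rc2_JJ X) mulNmx (mulII J2) opprK. Qed.

Let Rc2J X Y : Rc2 X Y *m J = J *m Rc2 X Y.
Proof.
rewrite /Rc2 mulmx_suml mulmx_sumr; apply: eq_bigr => i _.
rewrite mulmx_suml mulmx_sumr; apply: eq_bigr => j _.
by rewrite -scalemxAl -scalemxAr RcJ.
Qed.

Let T Y Z : 'M[R]_4 := \matrix_i (Z *m Rc2 (delta_mx 0 i) Y).

Let Rc2_delta i Y : Rc2 (delta_mx 0 i) Y = along (Rc i) Y.
Proof.
rewrite /Rc2 (bigD1 i) //= [X in _ + X]big1 ?addr0; last first.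
  move=> l li; rewrite big1 // => j _.
  by rewrite !mxE eqxx (negbTE li) mul0r scale0r.
by apply: eq_bigr => j _; rewrite !mxE !eqxx mul1r.
Qed.

Lemma ric_pairE Y Z : pair ric Y Z = \sum_i (Z *m along (Rc i) Y) 0 i.
Proof.
rewrite pair_sum.
under eq_bigr => j _.
  under eq_bigr => k _ do rewrite mxE mulr_sumr.
  rewrite exchange_big /=; over.
rewrite exchange_big /=; apply: eq_bigr => i _.
rewrite mulmx_sumr summxE; apply: eq_bigr => j _.
rewrite -scalemxAr [RHS]mxE mxE mulr_sumr.
by apply: eq_bigr => k _; rewrite mulrA.
Qed.

Let ric_tr Y Z : pair ric Y Z = \tr (T Y Z).
Proof. by rewrite ric_pairE; apply: eq_bigr => i _; rewrite [RHS]mxE Rc2_delta. Qed.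

Let T_mull Y Z (X : 'rV[R]_4) : X *m T Y Z = Z *m Rc2 X Y.
Proof.
have rowT i : row i (T Y Z) = Z *m along (Rc i) Y by rewrite rowK /= Rc2_delta.
rewrite [X in X *m _]row_sum_delta mulmx_suml /Rc2 mulmx_sumr; apply: eq_bigr => i _.
rewrite -scalemxAl -rowE rowT /along !mulmx_sumr scaler_sumr.
by apply: eq_bigr => j _; rewrite -!scalemxAr scalerA.
Qed.

(** As [J] commutes with the curvature, the endomorphism whose trace is Ric
    changes by a conjugation when both arguments are rotated by [J]. *)
Lemma ric_J Y Z : pair ric (Y *m J) (Z *m J) = pair ric Y Z.
Proof.
rewrite !ric_tr.
have -> : T (Y *m J) (Z *m J) = - (J *m T Y Z *m J).
  apply/row_matrixP => i; rewrite rowK linearN /= row_mul row_mul T_mull rowE.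
  by rewrite Rc2_Jl -mulmxA -Rc2J mulmxA mulmxN mulNmx opprK.
by rewrite linearN /= mxtrace_mulC mulmxA J2 mulNmx mul1mx linearN /= opprK.
Qed.

End CurvaturePoint.

Section RicciPoint.
Context {R : realFieldType}.
Variables (g J I : 'M[R]_4) (Rc : 'I_4 -> 'I_4 -> 'M[R]_4).
Hypothesis gsym : g^T = g.
Hypothesis gpos : pos_def g.
Hypothesis J2 : J *m J = - 1%:M.
Hypothesis JgJ : J *m g *m J^T = g.
Hypothesis I2 : I *m I = - 1%:M.
Hypothesis IgI : I *m g *m I^T = g.
Hypothesis IJC : I *m J = J *m I.
Hypothesis rankD : \rank (kermx (I - J)%R) = 2%N.
Hypothesis Rc_alt : forall i j, Rc i j = - Rc j i.
Hypothesis Rc_skew : forall i j, (Rc i j *m g)^T = - (Rc i j *m g).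
Hypothesis RcJ : forall i j, Rc i j *m J = J *m Rc i j.
Hypothesis bianchi : forall i j k,
  row k (Rc i j) + row i (Rc j k) + row j (Rc k i) = 0.
Implicit Types (X Y Z v : 'rV[R]_4).
Local Notation "<< X , Y >>" := (pair g X Y).
Local Notation inD X := (X *m I = X *m J).
Local Notation inP X := (X *m I = - (X *m J)).

Variables (theta dn : 'cV[R]_4) (xi : 'rV[R]_4) (N : 'M[R]_4) (c : R)
  (A L : 'I_4 -> 'M[R]_4).
Hypothesis xiE : xi *m g = theta^T.
Hypothesis xiD : inD xi.
Hypothesis n0 : <<xi, xi>> != 0.
Hypothesis xiND : inD (xi *m N).
Hypothesis Nsym : forall X Y, <<X *m N, Y>> = <<Y *m N, X>>.
Hypothesis AE : forall X Y, Y *m along A X =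
  (Y *m I *m theta) 0 0 *: X - <<X, Y *m I>> *: xi
  - (Y *m theta) 0 0 *: (X *m I) + <<X, Y>> *: (xi *m I).
Hypothesis RcE : forall i j, xi *m Rc i j = row j (L i) - row i (L j).
Hypothesis LE : forall i Y, inP Y -> Y *m L i =
  (dn i 0 / 2) *: Y + c *: (Y *m A i *m J) - <<Y, row i N>> *: xi.
Hypothesis dnP : forall Y, inP Y -> (Y *m dn) 0 0 = 0.
Hypothesis trL : forall Y, inP Y -> \tr (along L Y) = 0.

Let diag_sum (v X : 'rV[R]_4) : \sum_i <<v, delta_mx 0 i>> * X 0 i = <<v, X>>.
Proof.
by rewrite /pair mxE; apply: eq_bigr => i _; rewrite trmx_delta -colE !mxE.
Qed.

(** Here [L] is the covariant derivative of the Hessian and [RcE] is the Ricci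
    identity.  By the normal form of the Hessian every term of the contraction
    pairs a vector of [D] with one of its complement. *)
Lemma ric_xi_inP Y : inP Y -> pair (ric Rc) Y xi = 0.
Proof.
move=> YP; have YJP := inP_J IJC YP.
have gC := pairC gsym.
have orth X Z : inP X -> inD Z -> <<X, Z>> = 0.
  by move=> XP ZD; apply: (inP_orth_inD gsym JgJ IgI XP ZD).
rewrite ric_pairE.
have E i : (xi *m along (Rc i) Y) 0 i = (Y *m L i) 0 i - (along L Y) i i.
  rewrite mulmx_sumr summxE.
  under eq_bigr do rewrite -scalemxAr RcE.
  rewrite mxE summxE -sumrB; apply: eq_bigr => j _.
  by rewrite !mxE mulrBr.
rewrite (eq_bigr _ (fun i _ => E i)) sumrB -/(\tr (along L Y)) trL // subr0.
have th0 : Y *m theta = 0.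
  by rewrite [LHS]mx11_scalar (thE gsym xiE) orth // raddf0.
have thI0 : Y *m I *m theta = 0.
  by rewrite YP mulNmx [Y *m J *m theta]mx11_scalar (thE gsym xiE) orth // raddf0 oppr0.
have AiE i : Y *m A i = <<Y, delta_mx 0 i>> *: (xi *m I) - <<Y *m I, delta_mx 0 i>> *: xi.
  by rewrite -(along_delta A i) AE th0 thI0 !mxE !scale0r subr0 add0r addrC
     (gC (delta_mx 0 i)) (gC (delta_mx 0 i)).
have LiE i : (Y *m L i) 0 i = Y 0 i * dn i 0 / 2
   + c * (<<Y, delta_mx 0 i>> * (xi *m I *m J) 0 i - <<Y *m I, delta_mx 0 i>> * (xi *m J) 0 i)
   - <<delta_mx 0 i *m N, Y>> * xi 0 i.
  rewrite (LE i YP) AiE mulmxBl -!scalemxAl rowE (gC Y (delta_mx 0 i *m N)).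
  move: (xi *m I *m J) (xi *m J) => U V; rewrite !mxE; ring.
rewrite (eq_bigr _ (fun i _ => LiE i)) sumrB big_split /=.
have -> : \sum_i Y 0 i * dn i 0 / 2 = 0.
  by rewrite -mulr_suml; have := dnP YP; rewrite mxE => ->; rewrite mul0r.
rewrite -mulr_sumr sumrB !diag_sum.
have -> : \sum_i <<delta_mx 0 i *m N, Y>> * xi 0 i = <<Y *m N, xi>>.
  by rewrite -diag_sum; apply: eq_bigr => i _; rewrite Nsym.
have -> : <<Y *m N, xi>> = 0 by rewrite Nsym gC orth.
have -> : <<Y, xi *m I *m J>> = 0 by rewrite xiD (mulII J2) pairNr orth // oppr0.
have -> : <<Y *m I, xi *m J>> = 0.
  by rewrite YP pairNl orth ?oppr0 //; apply: inD_J.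
by ring.
Qed.

(** Ric is symmetric and [J]-invariant and does not mix [D] with its complement,
    a plane on which a [J]-invariant symmetric form is a multiple of the
    metric. *)
Lemma ric_inP_eigen v : v != 0 -> inP v ->
  exists a : R, v *m (ric Rc *m invmx g) = a *: v.
Proof.
move=> v0 vP; have gu := pos_def_unit gpos.
have rJ := ric_J gpos J2 JgJ Rc_alt Rc_skew RcJ bianchi.
have rS Y Z : pair (ric Rc) Y Z = pair (ric Rc) Z Y.
  by rewrite -pair_tr (ric_sym gsym gpos Rc_alt Rc_skew bianchi).
have vv : <<v, v>> != 0 by rewrite gt_eqF // gpos.
exists (pair (ric Rc) v v / <<v, v>>); set a := _ / _.
have rD : pair (ric Rc) v xi = 0 by apply: ric_xi_inP.
have rDJ : pair (ric Rc) v (xi *m J) = 0.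
  by rewrite -rJ (mulII J2) pairNr ric_xi_inP ?oppr0 //; apply: inP_J.
have rvJ : pair (ric Rc) v (v *m J) = 0.
  have : pair (ric Rc) v (v *m J) = - pair (ric Rc) v (v *m J).
    by rewrite -{1}rJ (mulII J2) pairNr rS.
  lra.
have orth X Z : inP X -> inD Z -> <<X, Z>> = 0.
  by move=> XP ZD; apply: (inP_orth_inD gsym JgJ IgI XP ZD).
(* A covector [pair B v] that vanishes on [D] and at [v J] is determined by its
   value at [v]; this is used for Ric and for the metric. *)
have key (B : 'M[R]_4) (Z : 'rV[R]_4) : pair B v xi = 0 -> pair B v (xi *m J) = 0 ->
   pair B v (v *m J) = 0 ->
   2 * (<<v, v>> * pair B v Z) = <<Z + Z *m I *m J, v>> * pair B v v.
  move=> Bx BxJ BvJ.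
  have ZD := proj_inD J2 I2 IJC Z; have ZP := proj_inP J2 I2 IJC Z.
  have hD : pair B v (Z - Z *m I *m J) = 0.
    apply: (mulfI n0); rewrite mulr0 -pairZr.
    rewrite (inD_basis gsym J2 JgJ IJC rankD n0 xiD ZD).
    by rewrite pairDr !pairZr Bx BxJ !mulr0 addr0.
  have hP := congr1 (pair B v) (inP_basis gsym gpos J2 JgJ I2 IgI IJC rankD v0 vP ZP).
  rewrite pairDr !pairZr BvJ mulr0 addr0 in hP; rewrite -hP.
  rewrite pairDr; rewrite pairDr pairNr in hD.
  have -> : pair B v (Z *m I *m J) = pair B v Z by lra.
  by ring.
have rE : pair (ric Rc) v =1 pair (a *: g) v.
  move=> Z; rewrite pair_scalem.
  have k1 := key _ Z rD rDJ rvJ.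
  have k2 := key g Z (orth _ _ vP xiD) (orth _ _ vP (inD_J IJC xiD))
     (pairJ0 gsym J2 JgJ v).
  have : 2 * (<<v, v>> * <<v, v>>) != 0 by rewrite !mulf_neq0 ?pnatr_eq0.
  move=> h; apply: (mulfI h).
  have -> : 2 * (<<v, v>> * <<v, v>>) * pair (ric Rc) v Z =
     <<v, v>> * (2 * (<<v, v>> * pair (ric Rc) v Z)) by ring.
  have -> : 2 * (<<v, v>> * <<v, v>>) * (a * <<v, Z>>) =
     a * <<v, v>> * (2 * (<<v, v>> * <<v, Z>>)) by ring.
  by rewrite k1 k2 /a divfK //; ring.
suff E : v *m ric Rc = a *: v *m g by rewrite mulmxA E mulmxK.
apply/rowP => i; have := rE (delta_mx 0 i).
by rewrite /pair trmx_delta -!colE [LHS]mxE [RHS]mxE => ->; rewrite -scalemxAr scalemxAl.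
Qed.

End RicciPoint.

(** * The Levi-Civita connection in coordinates *)

Section ChristoffelPoint.
Context {R : realFieldType}.
Variables (g : 'M[R]_4) (dg : 'I_4 -> 'M[R]_4).
Hypothesis gsym : g^T = g.
Hypothesis gpos : pos_def g.
Hypothesis dgsym : forall k, (dg k)^T = dg k.

(** Entry [(i, l)] is the lowered symbol: g(nabla_{e_k} e_i, e_l). *)
Definition christoffel_low (h : 'I_4 -> 'M[R]_4) (k : 'I_4) : 'M[R]_4 :=
  \matrix_(i, l) (2^-1 * (h k i l + h i k l - h l i k)).

Let dgS k i l : dg k i l = dg k l i.
Proof. by rewrite -{1}dgsym mxE. Qed.

Lemma christoffel_low_torsion_free :
  torsion_free (fun k => christoffel_low dg k *m invmx g).
Proof.
move=> i k; rewrite !row_mul; congr (_ *m _).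
apply/rowP => l; rewrite !mxE (dgS l k i); congr (_ * (_ - _)); exact: addrC.
Qed.

Lemma christoffel_low_metric k (C := christoffel_low dg k *m invmx g) :
  dg k = C *m g + g *m C^T.
Proof.
have -> : g *m C^T = (C *m g)^T by rewrite [RHS]trmx_mul gsym.
rewrite /C mulmxKV ?pos_def_unit //; apply/matrixP => i l; rewrite !mxE.
by rewrite (dgS k l i) (dgS i k l) (dgS l k i) (dgS i l k) (dgS l i k); lra.
Qed.

End ChristoffelPoint.

Lemma koszul_point {R : realFieldType} (g : 'M[R]_4) (x y z xy yx xz zx yz zy : 'rV[R]_4) :
  g^T = g ->
  pair g xy z + pair g y xz + (pair g yx z + pair g x yz)
  - (pair g zx y + pair g x zy) + pair g (xy - yx) z - pair g (xz - zx) y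
  - pair g (yz - zy) x = 2 * pair g xy z.
Proof.
move=> gs; rewrite !(pairDl, pairNl) (pairC gs y xz) (pairC gs x yz) (pairC gs x zy).
by ring.
Qed.

Section Christoffel.
Context {R : realType}.
Notation E := 'rV[R]_4.
Variables (W : set E) (g : E -> 'M[R]_4).
Hypothesis oW : open W.
Hypothesis sg : smx W g.
Hypothesis gsym : forall q, W q -> (g q)^T = g q.
Hypothesis gpos : forall q, W q -> pos_def (g q).

Definition christoffel (h : E -> 'M[R]_4) (k : 'I_4) (q : E) : 'M[R]_4 :=
  christoffel_low (fun i => 'D_('e_i) h q) k *m invmx (h q).

Lemma smx_ginv : smx W (fun q => invmx (g q)).
Proof. by apply: smx_inv => // q Wq; apply: pos_def_unit; apply: gpos. Qed.

Lemma smx_christoffel k : smx W (christoffel g k).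
Proof.
apply: smx_mul => //; last exact: smx_ginv.
move=> i l; rewrite (_ : (fun q => _) = (fun q => 2^-1 * (('D_('e_k) g q) i l
   + ('D_('e_i) g q) k l - ('D_('e_l) g q) i k))); last first.
  by apply/funext => q; rewrite mxE.
apply: Csmooth_mul => //; first exact: Csmooth_cst.
have sD a i' j' := @smx_D _ _ _ _ _ a oW sg i' j'.
apply: Csmooth_sub_fun => //; last exact: sD.
by apply: Csmooth_add => //; exact: sD.
Qed.

Lemma derive_gsym k q : W q -> ('D_('e_k) g q)^T = 'D_('e_k) g q.
Proof.
by move=> Wq; apply: etrans (esym (D_tr k sg Wq)) (derive_eq_mx _ oW gsym Wq).
Qed.

Lemma christoffel_torsion_free q : W q -> torsion_free (christoffel g ^~ q).
Proof. by move=> Wq; apply: christoffel_low_torsion_free => k; apply: derive_gsym. Qed.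

Lemma christoffel_metric k q : W q ->
  'D_('e_k) g q = christoffel g k q *m g q + g q *m (christoffel g k q)^T.
Proof.
move=> Wq; apply: (@christoffel_low_metric _ (g q) (fun i => 'D_('e_i) g q)).
- exact: gsym.
- exact: gpos.
- by move=> i; apply: derive_gsym.
Qed.

(** The directional derivative of [F] along [X], without connection terms. *)
Definition along_field (X : E -> 'rV[R]_4) m n (F : E -> 'M[R]_(m, n)) (q : E) :=
  \sum_k X q 0 k *: 'D_('e_k) F q.

Definition bracket_hat (X Y : E -> 'rV[R]_4) (q : E) : 'rV[R]_4 :=
  along_field X Y q - along_field Y X q.

Definition cov_hat (g : E -> 'M[R]_4) (X Y : E -> E) (q : E) : E :=
  along_field X Y q + Y q *m along (christoffel g ^~ q) (X q).

Lemma along_fieldE (X Y : E -> E) q j : smx W Y -> W q ->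
  along_field X Y q 0 j = \sum_k X q 0 k * 'D_('e_k) (fun x => Y x 0 j) q.
Proof.
move=> sY Wq; rewrite /along_field summxE; apply: eq_bigr => k _.
by rewrite [LHS]mxE (smx_deriveE k 0 j sY Wq).
Qed.

Lemma lie_bracket_hat (X Y : E -> E) (w : E -> R) q :
  smx W X -> smx W Y -> Csmooth W w -> W q ->
  let L (Z : E -> E) f x := \sum_k Z x 0 k * 'D_('e_k) f x in
  L X (L Y w) q - L Y (L X w) q = L (bracket_hat X Y) w q.
Proof.
move=> sX sY sw Wq L.
have LE (A B : E -> E) : smx W A -> smx W B -> L A (L B w) q =
   \sum_k (\sum_l A q 0 l * 'D_('e_l) (fun x => B x 0 k) q) * 'D_('e_k) w q
   + \sum_k \sum_l A q 0 l * B q 0 k * 'D_('e_l) ('D_('e_k) w) q.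
  move=> sA sB; rewrite -big_split /=.
  have e l : 'D_('e_l) (L B w) q = \sum_k ('D_('e_l) (fun x => B x 0 k) q * 'D_('e_k) w q
      + B q 0 k * 'D_('e_l) ('D_('e_k) w) q).
    have sk k : Csmooth W (fun x => B x 0 k * 'D_('e_k) w x).
      by apply: Csmooth_mul => //; apply: CsmoothD_e.
    apply: etrans (D_sumf l sk Wq) _; apply: eq_bigr => k _.
    exact: D_mulf (sB 0 k) (CsmoothD_e k sw) Wq.
  have alg (r s t : 'I_4 -> R) (d h : 'I_4 -> 'I_4 -> R) :
     \sum_l r l * (\sum_k (d l k * s k + t k * h l k)) =
     \sum_k ((\sum_l r l * d l k) * s k + \sum_l r l * t k * h l k).
    under eq_bigr do rewrite mulr_sumr.
    rewrite exchange_big /=; apply: eq_bigr => k _.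
    rewrite mulr_suml -big_split /=; apply: eq_bigr => l _.
    by rewrite mulrDr !mulrA.
  apply: etrans (eq_bigr _ (fun l _ => congr1 (fun t => A q 0 l * t) (e l))) _.
  exact: alg.
rewrite (LE X Y sX sY) (LE Y X sY sX).
have -> : \sum_k \sum_l Y q 0 l * X q 0 k * 'D_('e_l) ('D_('e_k) w) q
  = \sum_k \sum_l X q 0 l * Y q 0 k * 'D_('e_l) ('D_('e_k) w) q.
  rewrite exchange_big /=; apply: eq_bigr => k _; apply: eq_bigr => l _.
  by rewrite (Csmooth_schwarz l k oW sw Wq) mulrC [X in _ * X]mulrC mulrC.
rewrite opprD addrACA subrr addr0 -sumrB /L; apply: eq_bigr => k _.
rewrite -mulrBl; congr (_ * _); rewrite /bracket_hat.
by rewrite mxE [X in _ = _ + X]mxE (along_fieldE X k sY Wq) (along_fieldE Y k sX Wq).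
Qed.

Lemma Csmooth_pair X Y : smx W X -> smx W Y ->
  Csmooth W (fun q => pair (g q) (X q) (Y q)).
Proof.
move=> sX sY; have := smx_mul oW (smx_mul oW sX sg) (smx_tr sY); exact.
Qed.

Lemma derive_pair X Y k q : smx W X -> smx W Y -> W q ->
  'D_('e_k) (fun q => pair (g q) (X q) (Y q)) q =
  pair (g q) ('D_('e_k) X q + X q *m christoffel g k q) (Y q)
  + pair (g q) (X q) ('D_('e_k) Y q + Y q *m christoffel g k q).
Proof.
move=> sX sY Wq.
have sXg := smx_mul oW sX sg; have s := smx_mul oW sXg (smx_tr sY).
apply: etrans (esym (smx_deriveE k 0 0 s Wq)) _.
rewrite (D_mul k oW sXg (smx_tr sY) Wq) (D_mul k oW sX sg Wq) (D_tr k sY Wq).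
rewrite (christoffel_metric k Wq).
move: (christoffel g k q) ('D_('e_k) X q) ('D_('e_k) Y q) (X q) (Y q) (g q) => C a b x y h.
rewrite !(pairDl, pairDr) -pairMr -pairMl /pair.
rewrite !(mulmxDl, mulmxDr) !mulmxA.
move: (a *m h *m y^T) (x *m C *m h *m y^T) (x *m h *m C^T *m y^T) (x *m h *m b^T) => m1 m2 m3 m4.
by rewrite ![in LHS]mxE; ring.
Qed.

Lemma smx_along_field X Y : smx W X -> smx W Y -> smx W (along_field X Y : E -> E).
Proof.
move=> sX sY i j; rewrite ord1.
apply: (@Csmooth_eq _ _ (fun q => \sum_k X q 0 k * 'D_('e_k) (fun x => Y x 0 j) q)) => //.
  by move=> q Wq; rewrite (along_fieldE X j sY Wq).
by apply: Csmooth_sum => // k; apply: Csmooth_mul => //; apply: CsmoothD_e.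
Qed.

Lemma smx_cov_hat X Y : smx W X -> smx W Y -> smx W (cov_hat g X Y).
Proof.
move=> sX sY; apply: smx_add => //; first exact: smx_along_field.
apply: smx_mul => // i j.
rewrite (_ : (fun q => _) = (fun q => \sum_k X q 0 k * christoffel g k q i j)).
  apply: Csmooth_sum => // k; apply: Csmooth_mul => //.
  exact: smx_christoffel.
by apply/funext => q; rewrite /along summxE; apply: eq_bigr => k _; rewrite mxE.
Qed.

Lemma cov_hat_torsion (X Y : E -> E) q : W q ->
  cov_hat g X Y q - cov_hat g Y X q = bracket_hat X Y q.
Proof.
move=> Wq; rewrite /cov_hat /bracket_hat.
rewrite (torsion_freeP (X q) (Y q) (christoffel_torsion_free Wq)).
move: (along_field X Y q) (along_field Y X q) (X q *m _) => a b c.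
by rewrite opprD addrACA subrr addr0.
Qed.

Lemma cov_hat_metric (X Y Z : E -> E) q : smx W Y -> smx W Z -> W q ->
  \sum_k X q 0 k * 'D_('e_k) (fun x => pair (g x) (Y x) (Z x)) q
  = pair (g q) (cov_hat g X Y q) (Z q) + pair (g q) (Y q) (cov_hat g X Z q).
Proof.
move=> sY sZ Wq.
have d k : 'D_('e_k) (fun x => pair (g x) (Y x) (Z x)) q =
  pair (g q) ('D_('e_k) Y q + Y q *m christoffel g k q) (Z q)
  + pair (g q) (Y q) ('D_('e_k) Z q + Z q *m christoffel g k q).
  exact: (derive_pair k sY sZ Wq).
under eq_bigr => k _ do rewrite d mulrDr -pairZl -pairZr.
rewrite big_split /=.
have sl (F : 'I_4 -> 'rV[R]_4) A : \sum_k pair (g q) (F k) A = pair (g q) (\sum_k F k) A.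
  by rewrite /pair !mulmx_suml summxE.
have sr (F : 'I_4 -> 'rV[R]_4) A : \sum_k pair (g q) A (F k) = pair (g q) A (\sum_k F k).
  by rewrite pairC ?gsym // -sl; apply: eq_bigr => k _; rewrite pairC ?gsym.
have e (A : E -> 'rV[R]_4) :
   \sum_k X q 0 k *: ('D_('e_k) A q + A q *m christoffel g k q) = cov_hat g X A q.
  rewrite /cov_hat /along_field /along mulmx_sumr -big_split /=; apply: eq_bigr => k _.
  by rewrite scalerDr scalemxAr.
by rewrite sl sr !e.
Qed.

(** Metric compatibility expands the three derivatives of the metric, and the
    absence of torsion collects the resulting terms. *)
Lemma koszul_hat (X Y Z : E -> E) q : smx W X -> smx W Y -> smx W Z -> W q ->
  let L (A B C : E -> E) :=
    \sum_k A q 0 k * 'D_('e_k) (fun x => pair (g x) (B x) (C x)) q in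
  L X Y Z + L Y X Z - L Z X Y + pair (g q) (bracket_hat X Y q) (Z q)
  - pair (g q) (bracket_hat X Z q) (Y q) - pair (g q) (bracket_hat Y Z q) (X q)
  = 2 * pair (g q) (cov_hat g X Y q) (Z q).
Proof.
move=> sX sY sZ Wq L.
rewrite /L (cov_hat_metric X sY sZ Wq) (cov_hat_metric Y sX sZ Wq).
rewrite (cov_hat_metric Z sX sY Wq) -!(cov_hat_torsion _ _ Wq).
exact: koszul_point (gsym Wq).
Qed.

End Christoffel.

(** * Opposite structures in coordinates *)

Local Opaque christoffel derive.

(** Coordinate form, on an open set of R^4, of a Kähler structure [(g, J)] with
    an opposite Hermitian structure [I] of Lee form [du], the distribution
    [ker (I - J)] being involutive. *)
Record local_geometry (R : realType) (W : set 'rV[R]_4)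
    (g J I : 'rV[R]_4 -> 'M[R]_4) (u : 'rV[R]_4 -> R) : Prop := LocalGeometry {
  lg_open : open W;
  lg_sg : smx W g;
  lg_sJ : smx W J;
  lg_sI : smx W I;
  lg_su : Csmooth W u;
  lg_sym : forall q, W q -> (g q)^T = g q;
  lg_pos : forall q, W q -> pos_def (g q);
  lg_J2 : forall q, W q -> J q *m J q = - 1%:M;
  lg_JgJ : forall q, W q -> J q *m g q *m (J q)^T = g q;
  lg_I2 : forall q, W q -> I q *m I q = - 1%:M;
  lg_IgI : forall q, W q -> I q *m g q *m (I q)^T = g q;
  lg_IJ : forall q, W q -> I q *m J q = J q *m I q;
  lg_rank : forall q, W q -> \rank (kermx (I q - J q)%R) = 2%N;
  lg_intJ : forall q, W q -> exists C, torsion_free C /\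
    forall k, 'D_('e_k) J q = C k *m J q - J q *m C k;
  lg_intI : forall q, W q -> exists C, torsion_free C /\
    forall k, 'D_('e_k) I q = C k *m I q - I q *m C k;
  lg_closedJ : forall q, W q -> forall i j k,
    let T l := 'D_('e_l) (fun x => J x *m g x) q in
    T i j k + T j k i + T k i j = 0;
  lg_lee : forall q, W q -> forall i j k,
    let T l := 'D_('e_l) (fun x => I x *m g x) q
               - (2 * 'D_('e_l) u q) *: (I q *m g q) in
    T i j k + T j k i + T k i j = 0;
  lg_involutive : forall q, W q -> forall Y Z : 'rV[R]_4,
    Y *m I q = Y *m J q -> Z *m I q = Z *m J q ->
    let T k := 'D_('e_k) (fun x => I x - J x) q in
    Z *m along T Y = Y *m along T Z
}.

Lemma local_geometry_sub (R : realType) (W W' : set 'rV[R]_4) g J I u :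
  open W' -> W' `<=` W ->
  local_geometry W g J I u -> local_geometry W' g J I u.
Proof.
move=> oW' sW [_ f2 f3 f4 f5 f6 f7 f8 f9 f10 f11 f12 f13 f14 f15 f16 f17 f18].
exact: (LocalGeometry oW' (fun i j => Csmooth_sub sW (f2 i j))
  (fun i j => Csmooth_sub sW (f3 i j)) (fun i j => Csmooth_sub sW (f4 i j))
  (Csmooth_sub sW f5) (fun q Wq => f6 q (sW q Wq)) (fun q Wq => f7 q (sW q Wq))
  (fun q Wq => f8 q (sW q Wq)) (fun q Wq => f9 q (sW q Wq))
  (fun q Wq => f10 q (sW q Wq)) (fun q Wq => f11 q (sW q Wq))
  (fun q Wq => f12 q (sW q Wq)) (fun q Wq => f13 q (sW q Wq))
  (fun q Wq => f14 q (sW q Wq)) (fun q Wq => f15 q (sW q Wq))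
  (fun q Wq => f16 q (sW q Wq)) (fun q Wq => f17 q (sW q Wq))
  (fun q Wq => f18 q (sW q Wq))).
Qed.

Section LocalGeometry.
Context {R : realType}.
Notation E := 'rV[R]_4.
Variables (W : set E) (g J I : E -> 'M[R]_4) (u : E -> R).
Hypothesis LG : local_geometry W g J I u.

Let oW := lg_open LG.
Let sg := lg_sg LG.
Let sJ := lg_sJ LG.
Let sI := lg_sI LG.
Let su := lg_su LG.
Let gsym := lg_sym LG.
Let gpos := lg_pos LG.
Let J2 := lg_J2 LG.
Let JgJ := lg_JgJ LG.
Let I2 := lg_I2 LG.
Let IgI := lg_IgI LG.
Let IJC := lg_IJ LG.
Let rankD := lg_rank LG.

Notation Gam := (christoffel g).
Let sGam k : smx W (Gam k) := smx_christoffel oW sg gpos k.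
Let GamS q (Wq : W q) := christoffel_torsion_free oW sg gsym Wq.
Let GamG k q (Wq : W q) := christoffel_metric oW sg gsym gpos k Wq.

Definition cov (h : E -> 'M[R]_4) (A : E -> 'M[R]_4) (q : E) (k : 'I_4) : 'M[R]_4 :=
  cov_endo (A q) (christoffel h ^~ q) (fun k => 'D_('e_k) A q) k.

Definition covector (f : E -> R) (q : E) : 'cV[R]_4 := \col_i 'D_('e_i) f q.

Definition grad (h : E -> 'M[R]_4) (f : E -> R) (q : E) : 'rV[R]_4 :=
  (covector f q)^T *m invmx (h q).

Lemma smx_covector f : Csmooth W f -> smx W (covector f).
Proof.
move=> sf i j; rewrite (_ : (fun q => _) = 'D_('e_i) f); first exact: CsmoothD_e.
by apply/funext => q; rewrite /covector mxE.
Qed.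

Lemma smx_grad f : Csmooth W f -> smx W (grad g f).
Proof.
move=> sf; apply: smx_mul => //; last exact: smx_ginv.
exact/smx_tr/smx_covector.
Qed.

Lemma gradE f q : W q -> grad g f q *m g q = (covector f q)^T.
Proof. by move=> Wq; rewrite /grad mulmxKV // pos_def_unit //; apply: gpos. Qed.

Lemma derive_form (A : E -> 'M[R]_4) k q : smx W A -> W q ->
  'D_('e_k) (fun x => A x *m g x) q
  = 'D_('e_k) A q *m g q + A q *m (Gam k q *m g q + g q *m (Gam k q)^T).
Proof.
move=> sA Wq; apply: etrans (D_mul k oW sA sg Wq) _.
by congr (_ + _ *m _); apply: GamG.
Qed.

Lemma derive_form_skew (A : E -> 'M[R]_4) k q : smx W A ->
  (forall x, W x -> A x *m A x = - 1%:M) ->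
  (forall x, W x -> A x *m g x *m (A x)^T = g x) -> W q ->
  let B := 'D_('e_k) A q *m g q + A q *m (Gam k q *m g q + g q *m (Gam k q)^T) in
  B^T = - B.
Proof.
move=> sA A2 AgA Wq B; rewrite /B -(derive_form k sA Wq).
have sAg : smx W (fun x => A x *m g x) by apply: smx_mul.
apply: etrans (esym (D_tr k sAg Wq)) _.
apply: etrans _ (D_opp k sAg Wq).
apply: (derive_eq_mx _ oW _ Wq) => x Wx.
exact: hermitian_form_skew (gsym Wx) (A2 x Wx) (AgA x Wx).
Qed.

(** A Kähler form is closed: the case [theta = 0] of [cov_lee]. *)
Lemma cov_J k q : W q -> cov g J q k = 0.
Proof.
move=> Wq; have [C [CS CE]] := lg_intJ LG Wq.
apply/row_matrixP => i; rewrite row0 rowE.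
have := @cov_lee R (g q) (J q) (Gam ^~ q) C (fun k => 'D_('e_k) J q) 0 (gsym Wq)
  (gpos Wq) (J2 Wq) (JgJ Wq) (GamS Wq) CS CE
  (fun k => derive_form_skew k sJ J2 JgJ Wq) _ (delta_mx 0 k) (delta_mx 0 i) 0.
rewrite along_delta /cov => ->; rewrite ?mul0mx ?trmx0 //.
- by rewrite !mulmx0 !mxE !(scaler0, scale0r) !(subr0, addr0).
- move=> a b c; have := lg_closedJ LG Wq a b c => /=.
  have TE l : 'D_('e_l) J q *m g q + J q *m (Gam l q *m g q + g q *m (Gam l q)^T)
     - (2 * (0 : 'cV[R]_4) l 0) *: (J q *m g q) = 'D_('e_l) (fun x => J x *m g x) q.
    by rewrite mxE mulr0 scale0r subr0 (derive_form l sJ Wq).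
  by rewrite (TE a) (TE b) (TE c).
Qed.

Notation th := (covector u).
Notation xi := (grad g u).

Lemma cov_I q X Y : W q -> Y *m along (cov g I q) X =
  (Y *m I q *m th q) 0 0 *: X - pair (g q) X (Y *m I q) *: xi q
  - (Y *m th q) 0 0 *: (X *m I q) + pair (g q) X Y *: (xi q *m I q).
Proof.
move=> Wq; have [C [CS CE]] := lg_intI LG Wq.
apply: (@cov_lee R (g q) (I q) (Gam ^~ q) C (fun k => 'D_('e_k) I q) (th q)) => //.
- exact: gsym.
- exact: gpos.
- exact: I2.
- exact: IgI.
- exact: GamS.
- by move=> k; exact: derive_form_skew.
- move=> a b c T; have := lg_lee LG Wq a b c => /=.
  have TE l : T l = 'D_('e_l) (fun x => I x *m g x) q
               - (2 * 'D_('e_l) u q) *: (I q *m g q).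
    by rewrite /T /covector mxE (derive_form l sI Wq).
  by rewrite (TE a) (TE b) (TE c).
- exact: gradE.
Qed.

Lemma derive_J k q : W q -> 'D_('e_k) J q = Gam k q *m J q - J q *m Gam k q.
Proof.
move=> Wq; have := cov_J k Wq; rewrite /cov /cov_endo.
move: ('D_('e_k) J q) (J q *m _) (_ *m J q) => a b c /eqP.
by rewrite subr_eq0 => /eqP <-; rewrite addrK.
Qed.

Lemma derive_I k q : W q ->
  'D_('e_k) I q = cov g I q k + Gam k q *m I q - I q *m Gam k q.
Proof.
move=> Wq; rewrite /cov /cov_endo.
move: ('D_('e_k) I q) (I q *m _) (_ *m I q) => a b c.
by rewrite subrK addrK.
Qed.

Lemma derive_ImJ k q : W q -> 'D_('e_k) (fun x => I x - J x) q =
    cov g I q k + Gam k q *m (I q - J q) - (I q - J q) *m Gam k q.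
Proof.
move=> Wq; apply: etrans (D_sub k sI sJ Wq) _.
rewrite (derive_I k Wq) (derive_J k Wq) mulmxBr mulmxBl; mx_group.
Qed.

(** The derivative of [I - J] in the involutivity condition may be replaced by
    the covariant one, as the connection has no torsion. *)
Lemma xi_inD q : W q -> xi q *m I q = xi q *m J q.
Proof.
move=> Wq; apply: (@lee_vector_inD R (g q) (J q) (I q) _ _ _ _ _ _ _ _
  (cov g I q) (th q)); rewrite ?gsym ?J2 ?JgJ ?I2 ?IgI ?IJC ?rankD //.
- exact: gpos.
- by move=> X Y; apply: cov_I.
move=> Y Z YD ZD; have := lg_involutive LG Wq YD ZD => /=.
rewrite !(along_eq _ (fun k => derive_ImJ k Wq)) !(along_add (fun k => cov g I q k + _)) !along_opp.
rewrite !(along_add (cov g I q)) !(along_mulr (Gam ^~ q)) !(along_mull (Gam ^~ q)).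
have YK : Y *m (I q - J q) = 0 by apply/inD_ker.
have ZK : Z *m (I q - J q) = 0 by apply/inD_ker.
move: (I q - J q) YK ZK => K YK ZK.
rewrite !mulmxBr !mulmxDr !mulmxA YK ZK !mul0mx !subr0.
have -> : Z *m along (Gam^~ q) Y = Y *m along (Gam^~ q) Z.
  by apply: torsion_freeP; exact: GamS.
exact: addIr.
Qed.

(** The Hessian as an endomorphism: it sends [X] to the covariant derivative of
    the gradient along [X]. *)
Definition hessmx (h : E -> 'M[R]_4) (f : E -> R) (q : E) : 'M[R]_4 :=
  \matrix_k ('D_('e_k) (grad h f) q + grad h f q *m christoffel h k q).

Lemma row_hessmx f q k :
  row k (hessmx g f q) = 'D_('e_k) (grad g f) q + grad g f q *m Gam k q.
Proof. exact: rowK. Qed.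

Lemma smx_hessmx f : Csmooth W f -> smx W (hessmx g f).
Proof.
move=> sf i j.
have sr : smx W (fun q => 'D_('e_i) (grad g f) q + grad g f q *m Gam i q).
  apply: smx_add => //; first by apply: smx_D => //; apply: smx_grad.
  by apply: smx_mul => //; apply: smx_grad.
apply: (Csmooth_eq oW _ (sr 0 j)) => q _.
by rewrite [RHS]mxE.
Qed.

Lemma covectorE f q : W q -> covector f q = g q *m (grad g f q)^T.
Proof. by move=> Wq; rewrite -[LHS]trmxK -gradE // trmx_mul gsym. Qed.

Lemma derive_covector f k q : Csmooth W f -> W q ->
  'D_('e_k) (covector f) q
  = Gam k q *m covector f q + g q *m (row k (hessmx g f q))^T.
Proof.
move=> sf Wq; have sG := smx_grad sf.
apply: etrans (derive_eq_mx _ oW (@covectorE f) Wq) _.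
apply: etrans (D_mul k oW sg (smx_tr sG) Wq) _.
rewrite (D_tr k sG Wq) row_hessmx (GamG k Wq) covectorE //.
move: (Gam k q) ('D_('e_k) (grad g f) q) (grad g f q) (g q) => C d x h.
by rewrite linearD /= trmx_mul mulmxDr mulmxDl !mulmxA -!addrA [X in _ + X]addrC.
Qed.

Lemma hessmx_form f q i j : Csmooth W f -> W q ->
  (hessmx g f q *m g q) i j
  = 'D_('e_i) ('D_('e_j) f) q - (Gam i q *m covector f q) j 0.
Proof.
move=> sf Wq; have := derive_covector i sf Wq.
move=> /(congr1 (fun A : 'cV[R]_4 => A j 0)) e.
have e1 : ('D_('e_i) (covector f) q) j 0 = 'D_('e_i) ('D_('e_j) f) q.
  apply: etrans (smx_deriveE i j 0 (smx_covector sf) Wq) _.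
  by apply: eq_derive => x; rewrite mxE.
have -> : (hessmx g f q *m g q) i j = (g q *m (row i (hessmx g f q))^T) j 0.
  rewrite -[g q in RHS]gsym // -trmx_mul -row_mul.
  by rewrite [RHS]mxE [RHS]mxE.
rewrite -e1 e; move: (Gam i q *m _) (g q *m _) => a b.
by rewrite [(a + b) j 0]mxE addrAC subrr add0r.
Qed.

Lemma hessmx_sym f q X Y : Csmooth W f -> W q ->
  pair (g q) (X *m hessmx g f q) Y = pair (g q) (Y *m hessmx g f q) X.
Proof.
move=> sf Wq; rewrite -!pairMl -pair_tr; congr (pair _ _ _).
apply/matrixP => i j; rewrite [LHS]mxE !hessmx_form //.
have -> : 'D_('e_j) ('D_('e_i) f) q = 'D_('e_i) ('D_('e_j) f) q.
  exact: Csmooth_schwarz oW sf Wq.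
congr (_ - _); have := congr1 (fun v => (v *m covector f q) 0 0) (GamS Wq i j).
by rewrite -!row_mul [LHS]mxE [RHS]mxE.
Qed.

Notation N := (hessmx g u).
Notation nrm2 := (fun q => pair (g q) (xi q) (xi q)).

(** The derivative of [xi (I - J) = 0], with the derivative of [I] given by [cov_I]. *)
Lemma hessian_mod_D q X : W q -> X *m N q *m (I q - J q) =
  pair (g q) (xi q) (xi q) *: (X *m I q) - (X *m I q *m th q) 0 0 *: xi q
  - (X *m th q) 0 0 *: (xi q *m I q).
Proof.
move=> Wq; have sxi := smx_grad su.
have K0 x : W x -> xi x *m (I x - J x) = 0 by move=> Wx; apply/inD_ker; apply: xi_inD.
have rowN k : row k (N q) *m (I q - J q) = - (xi q *m cov g I q k).
  have := derive_eq_mx 'e_k oW K0 Wq; rewrite D_cst.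
  rewrite (D_mul k oW sxi (smx_sub oW sI sJ) Wq) (derive_ImJ k Wq) row_hessmx.
  have := K0 q Wq; move: (I q - J q) ('D_('e_k) xi q) => K d xK.
  rewrite mulmxDl mulmxBr mulmxDr !mulmxA xK !mul0mx subr0.
  move: (xi q *m cov _ _ _ _) (xi q *m _ *m _) (d *m _) => a b c /eqP.
  by rewrite addrCA addr_eq0 => /eqP ->; rewrite opprK.
have -> : X *m N q *m (I q - J q) = - (xi q *m along (cov g I q) X).
  rewrite -mulmxA [X in X *m _]row_sum_delta mulmx_suml /along mulmx_sumr -sumrN.
  apply: eq_bigr => k _; rewrite -scalemxAl mulmxA -rowE rowN -scalemxAr.
  exact: scalerN.
rewrite cov_I //.
have E Y : (Y *m th q) 0 0 = pair (g q) Y (xi q) by apply: thE; [exact: gsym|exact: gradE].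
have pI Y Z : pair (g q) (Y *m I q) Z = - pair (g q) Y (Z *m I q).
  by apply: pairI; [exact: I2|exact: IgI].
rewrite !E -[pair (g q) X (xi q *m I q)]opprK -pI.
have -> : pair (g q) (xi q *m I q) (xi q) = 0.
  by have := pI (xi q) (xi q); rewrite [X in _ = - X]pairC ?gsym //; lra.
rewrite scale0r add0r scaleNr opprK.
move: (_ *: xi q) (_ *: (X *m I q)) (_ *: (xi q *m I q)) => a b c.
by rewrite !opprD opprK addrAC addrC addrA.
Qed.

Lemma th_pair q Y : W q -> (Y *m th q) 0 0 = pair (g q) Y (xi q).
Proof. by move=> Wq; apply: thE; [exact: gsym|exact: gradE]. Qed.

Lemma Csmooth_nrm2 : Csmooth W nrm2.
Proof. by apply: Csmooth_pair => //; apply: smx_grad. Qed.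

Lemma derive_nrm2 k q : W q ->
  'D_('e_k) nrm2 q = 2 * pair (g q) (row k (N q)) (xi q).
Proof.
move=> Wq; apply: etrans (derive_pair oW sg gsym gpos k (smx_grad su) (smx_grad su) Wq) _.
rewrite row_hessmx; move: ('D_('e_k) xi q + _) => d.
by rewrite (pairC (gsym Wq) (xi q)); ring.
Qed.

Lemma covector_nrm2 q (X : 'rV[R]_4) : W q ->
  (X *m covector nrm2 q) 0 0 = 2 * pair (g q) (X *m N q) (xi q).
Proof.
move=> Wq; rewrite mxE.
under eq_bigr => k _ do rewrite [covector nrm2 q k 0]mxE (derive_nrm2 k Wq).
rewrite [X in pair _ (X *m _) _]row_sum_delta mulmx_suml /pair !mulmx_suml summxE.
rewrite mulr_sumr; apply: eq_bigr => k _.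
rewrite -!scalemxAl [in RHS]mxE -rowE; move: ((_ *m _) 0 0) => x; ring.
Qed.

Let beta q := J q *m th q.
Let B q := (N q *m J q + J q *m N q) *m g q.

Let smx_beta : smx W beta.
Proof. by apply: smx_mul => //; apply: smx_covector. Qed.

Let derive_beta i q : W q -> 'D_('e_i) beta q
  = Gam i q *m beta q + J q *m (g q *m (row i (N q))^T).
Proof.
move=> Wq; apply: etrans (D_mul i oW sJ (smx_covector su) Wq) _.
rewrite (derive_J i Wq) (derive_covector i su Wq) /beta.
move: (Gam i q) (J q) (th q) (g q *m _) => C j t v.
by rewrite mulmxBl mulmxDr !mulmxA addrA subrK.
Qed.

Let B_entry q i j : W q -> B q i j =
  'D_('e_j) (fun x => beta x i 0) q - 'D_('e_i) (fun x => beta x j 0) q.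
Proof.
move=> Wq; pose Q := J q *m g q *m (N q)^T.
have NG : N q *m g q = g q *m (N q)^T.
  apply: pair_matP => X Y; rewrite pairMl (hessmx_sym _ _ su Wq) pairMr.
  by rewrite pairC // gsym.
have BE : B q = Q - Q^T.
  rewrite /B /Q mulmxDl !trmx_mul trmxK (gsym Wq) -!mulmxA.
  have -> : J q *m g q = - (g q *m (J q)^T).
    rewrite -[J q *m g q]opprK -(hermitian_form_skew (gsym Wq) (J2 Wq) (JgJ Wq)).
    by rewrite trmx_mul gsym.
  by rewrite mulmxN NG addrC.
have QE a b : Q b a = 'D_('e_a) (fun x => beta x b 0) q - (Gam a q *m beta q) b 0.
  rewrite -(smx_deriveE a b 0 smx_beta Wq) (derive_beta a Wq).
  rewrite [((_ + _) : 'cV_4) b 0]mxE addrAC subrr add0r mulmxA.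
  by rewrite tr_row colE mulmxA -colE [RHS]mxE.
rewrite BE [LHS]mxE [(- Q^T) i j]mxE [Q^T i j]mxE !QE.
have -> : (Gam j q *m beta q) i 0 = (Gam i q *m beta q) j 0.
  have := congr1 (fun v => (v *m beta q) 0 0) (GamS Wq i j).
  by rewrite -!row_mul [LHS]mxE [RHS]mxE.
by rewrite opprB addrA subrK.
Qed.

Let smx_B : smx W B.
Proof.
have sN := smx_hessmx su.
by apply: smx_mul => //; apply: smx_add => //; apply: smx_mul.
Qed.

(** By [B_entry], [B] is the exterior derivative of the 1-form [- beta]. *)
Let B_closed q : W q -> forall i j k, let T l := 'D_('e_l) B q in
  T i j k + T j k i + T k i j = 0.
Proof.
move=> Wq i j k T.
have sD a b : Csmooth W ('D_('e_a) (fun x => beta x b 0)).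
  exact/CsmoothD_e/smx_beta.
pose X a b c := 'D_('e_a) ('D_('e_b) (fun x => beta x c 0)) q.
have TE a b c : T a b c = X a c b - X a b c.
  apply: etrans (smx_deriveE a b c smx_B Wq) _.
  apply: etrans (derive_eq_on 'e_a oW (fun x Wx => B_entry b c Wx) Wq) _.
  exact: (deriveB (Csmooth_derivable (sD c b) Wq) (Csmooth_derivable (sD b c) Wq)).
have sw a b c : X a b c = X b a c by exact: Csmooth_schwarz oW (smx_beta c 0) Wq.
clearbody T X.
rewrite (TE i j k) (TE j k i) (TE k i j) (sw i k j) (sw j i k) (sw k j i).
by ring.
Qed.

Definition curv (h : E -> 'M[R]_4) (q : E) : 'I_4 -> 'I_4 -> 'M[R]_4 :=
  curv_of (fun i j => 'D_('e_i) (christoffel h j) q) (christoffel h ^~ q).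

Lemma derive_row m n (F : E -> 'M[R]_(m, n)) (a : 'I_m) k q : smx W F -> W q ->
  'D_('e_k) (fun x => row a (F x)) q = row a ('D_('e_k) F q).
Proof.
move=> sF Wq; have sr : smx W (fun x => row a (F x)).
  move=> i j; rewrite (_ : (fun x => _) = (fun x => F x a j)) //.
  by apply/funext => x; rewrite mxE.
apply/rowP => j; apply: etrans (smx_deriveE k 0 j sr Wq) _.
rewrite [RHS]mxE; apply: etrans _ (esym (smx_deriveE k a j sF Wq)).
by apply: eq_derive => x; rewrite mxE.
Qed.

Lemma curv_skew i j q : W q -> (curv g q i j *m g q)^T = - (curv g q i j *m g q).
Proof.
move=> Wq; apply: curv_of_skew => /=; first exact: gsym.
have DD a b : 'D_('e_a) ('D_('e_b) g) q =
   'D_('e_a) (Gam b) q *m g q + Gam b q *m (Gam a q *m g q + g q *m (Gam a q)^T)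
   + ((Gam a q *m g q + g q *m (Gam a q)^T) *m (Gam b q)^T
      + g q *m ('D_('e_a) (Gam b) q)^T).
  apply: etrans (derive_eq_mx 'e_a oW (fun x Wx => GamG b Wx) Wq) _.
  apply: etrans (D_add _ (smx_mul oW (sGam b) sg) (smx_mul oW sg (smx_tr (sGam b))) Wq) _.
  rewrite (D_mul _ oW (sGam b) sg Wq) (D_mul _ oW sg (smx_tr (sGam b)) Wq).
  by rewrite (D_tr _ (sGam b) Wq) (GamG a Wq).
exact: etrans (esym (DD i j)) (etrans (smx_schwarz i j oW sg Wq) (DD j i)).
Qed.

Lemma curv_J i j q : W q -> curv g q i j *m J q = J q *m curv g q i j.
Proof.
move=> Wq; apply: curv_of_comm => /=.
have DD a b : 'D_('e_a) ('D_('e_b) J) q =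
   'D_('e_a) (Gam b) q *m J q + Gam b q *m (Gam a q *m J q - J q *m Gam a q)
   - ((Gam a q *m J q - J q *m Gam a q) *m Gam b q + J q *m 'D_('e_a) (Gam b) q).
  apply: etrans (derive_eq_mx 'e_a oW (fun x Wx => derive_J b Wx) Wq) _.
  apply: etrans (D_sub _ (smx_mul oW (sGam b) sJ) (smx_mul oW sJ (sGam b)) Wq) _.
  rewrite (D_mul _ oW (sGam b) sJ Wq) (D_mul _ oW sJ (sGam b) Wq).
  by rewrite (derive_J a Wq).
exact: etrans (esym (DD i j)) (etrans (smx_schwarz i j oW sJ Wq) (DD j i)).
Qed.

Lemma curv_bianchi i j k q : W q ->
  row k (curv g q i j) + row i (curv g q j k) + row j (curv g q k i) = 0.
Proof.
move=> Wq; apply: curv_of_bianchi; last exact: GamS.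
move=> a b c; apply: etrans (esym (derive_row c _ (sGam b) Wq)) _.
apply: etrans (derive_row b _ (sGam c) Wq).
by apply: (derive_eq_mx _ oW _ Wq) => x Wx; apply: GamS.
Qed.

Definition cov_hess (q : E) (i : 'I_4) : 'M[R]_4 :=
  'D_('e_i) N q + N q *m Gam i q - Gam i q *m N q.

Lemma curv_xi i j q : W q ->
  xi q *m curv g q i j = row j (cov_hess q i) - row i (cov_hess q j).
Proof.
move=> Wq; have sxi := smx_grad su; have sN := smx_hessmx su.
apply: (curv_of_ricci_identity (dx := fun a => 'D_('e_a) xi q)
  (ddx := fun a b => 'D_('e_a) ('D_('e_b) xi) q)
  (dN := fun a => 'D_('e_a) N q)) => [|a|a b|].
- exact: GamS.
- exact: row_hessmx.
- apply: etrans (esym (derive_row b _ sN Wq)) _.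
  apply: etrans (derive_eq_mx 'e_a oW (fun x _ => row_hessmx u x b) Wq) _.
  apply: etrans (D_add _ (smx_D _ oW sxi) (smx_mul oW sxi (sGam b)) Wq) _.
  by rewrite (D_mul _ oW sxi (sGam b) Wq).
- exact: smx_schwarz oW sxi Wq.
Qed.

Let a x := \tr (N x) / 2.

Lemma Csmooth_half_trace : Csmooth W a.
Proof.
apply: Csmooth_mul => //; last exact: Csmooth_cst.
exact: Csmooth_tr (smx_hessmx su).
Qed.

Section Nondegenerate.
Hypothesis n0 : forall q, W q -> nrm2 q != 0.

(** [ddc_form] multiplied by the metric: [- d(J du)] as a combination of the two
    Kähler forms. *)
Let ddc_formE q : W q -> B q = a q *: (J q *m g q) + (a q - nrm2 q) *: (I q *m g q).
Proof.
move=> Wq; rewrite /B.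
rewrite (@ddc_form R (g q) (J q) (I q) (gsym Wq) (gpos Wq) (J2 Wq) (JgJ Wq) (I2 Wq)
  (IgI Wq) (IJC Wq) (rankD Wq) (th q) (xi q)).
- by rewrite mulmxDl -!scalemxAl.
- exact: gradE.
- exact: xi_inD.
- by move=> X Y; apply: hessmx_sym.
- by move=> X; apply: hessian_mod_D.
- exact: n0.
Qed.

(** The exterior derivative of [ddc_formE]: the left-hand side is closed, the
    first Kähler form is closed, and the second one obeys the Lee equation. *)
Let closed_ddc q : W q -> forall i j k,
  let T l := covector a q l 0 *: (J q *m g q)
     + (covector a q l 0 - covector nrm2 q l 0 + 2 * (a q - nrm2 q) * th q l 0)
       *: (I q *m g q) in
  T i j k + T j k i + T k i j = 0.
Proof.
move=> Wq i j k T.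
have sa := Csmooth_half_trace; have sn := Csmooth_nrm2.
have sJg := smx_mul oW sJ sg; have sIg := smx_mul oW sI sg.
have san := Csmooth_sub_fun oW sa sn.
pose U l := 'D_('e_l) (fun x => J x *m g x) q.
pose V l := 'D_('e_l) (fun x => I x *m g x) q - (2 * 'D_('e_l) u q) *: (I q *m g q).
pose Z l := 'D_('e_l) B q.
have ZE l : Z l = T l + a q *: U l + (a q - nrm2 q) *: V l.
  apply: etrans (derive_eq_mx 'e_l oW ddc_formE Wq) _.
  apply: etrans (D_add _ (smx_scale oW sa sJg) (smx_scale oW san sIg) Wq) _.
  rewrite (D_scale _ oW sa sJg Wq) (D_scale _ oW san sIg Wq) -/(U l).
  have -> : 'D_('e_l) (fun x => a x - nrm2 x) q = 'D_('e_l) a q - 'D_('e_l) nrm2 q.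
    exact: (deriveB (Csmooth_derivable sa Wq) (Csmooth_derivable sn Wq)).
  rewrite /T /V /covector ![(\col__ _) _ _]mxE.
  move: ('D_('e_l) a q) ('D_('e_l) nrm2 q) ('D_('e_l) u q) => x y z.
  move: ('D_('e_l) _ q) (U l) (J q *m g q) (I q *m g q) (a q) (pair _ _ _).
  move=> D1 D2 D3 D4 b c.
  by apply/matrixP => r s; rewrite !mxE; ring.
have hU : U i j k + U j k i + U k i j = 0 := lg_closedJ LG Wq i j k.
have hV : V i j k + V j k i + V k i j = 0 := lg_lee LG Wq i j k.
have hZ : Z i j k + Z j k i + Z k i j = 0 := B_closed Wq i j k.
move: hZ; rewrite (ZE i) (ZE j) (ZE k); clearbody T U V.
move: (T i) (T j) (T k) (U i) (U j) (U k) (V i) (V j) (V k) hU hV.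
move=> t1 t2 t3 u1 u2 u3 v1 v2 v3 hU hV; rewrite !mxE.
set b := a q; set c := pair _ _ _.
have -> : t1 j k + b * u1 j k + (b - c) * v1 j k
   + (t2 k i + b * u2 k i + (b - c) * v2 k i)
   + (t3 i j + b * u3 i j + (b - c) * v3 i j)
   = (t1 j k + t2 k i + t3 i j) + b * (u1 j k + u2 k i + u3 i j)
     + (b - c) * (v1 j k + v2 k i + v3 i j) by ring.
by rewrite hU hV !mulr0 !addr0.
Qed.

Lemma hessian_form q : W q -> N q + th q *m xi q =
  (nrm2 q / 4 + a q / 2)%:M + (nrm2 q / 4 - a q / 2) *: (I q *m J q).
Proof.
move=> Wq.
apply: (@hessian_normal_form R (g q) (J q) (I q) (gsym Wq) (gpos Wq) (J2 Wq)
  (JgJ Wq) (I2 Wq) (IgI Wq) (IJC Wq) (rankD Wq) (th q) (xi q) (N q) (gradE u Wq)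
  (xi_inD Wq) _ _ (n0 Wq) (covector a q) (covector nrm2 q)).
- by move=> X Y; apply: hessmx_sym.
- by move=> X; apply: hessian_mod_D.
- by move=> X; apply: covector_nrm2.
- exact: closed_ddc.
Qed.

(** The derivative of the normal form [hessian_form], evaluated on a vector [Y]
    which [theta] kills and on which [I J] is the identity. *)
Lemma cov_hess_inP i q (Y : 'rV[R]_4) : W q -> Y *m I q = - (Y *m J q) ->
  Y *m cov_hess q i = (covector nrm2 q i 0 / 2) *: Y
    + (nrm2 q / 4 - a q / 2) *: (Y *m cov g I q i *m J q)
    - pair (g q) Y (row i (N q)) *: xi q.
Proof.
move=> Wq YP.
pose c1 x := nrm2 x / 4 + a x / 2; pose c2 x := nrm2 x / 4 - a x / 2.
have sa := Csmooth_half_trace; have sn := Csmooth_nrm2.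
have sc (c : R) : Csmooth W (fun=> c) by apply: Csmooth_cst.
have s1 : Csmooth W c1 by apply: Csmooth_add => //; apply: Csmooth_mul.
have s2 : Csmooth W c2 by apply: Csmooth_sub_fun => //; apply: Csmooth_mul.
have sIJ := smx_mul oW sI sJ; have sth := smx_covector su; have sxi := smx_grad su.
have stx := smx_mul oW sth sxi.
have NE x : W x -> N x = c1 x *: 1%:M + c2 x *: (I x *m J x) - th x *m xi x.
  by move=> Wx; rewrite scalemx1 -hessian_form // addrK.
have dN : 'D_('e_i) N q = 'D_('e_i) c1 q *: 1%:M + ('D_('e_i) c2 q *: (I q *m J q)
   + c2 q *: (('D_('e_i) I q) *m J q + I q *m 'D_('e_i) J q))
   - ('D_('e_i) th q *m xi q + th q *m 'D_('e_i) xi q).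
  have k1 := smx_scale oW s1 (smx_cst W (1%:M : 'M[R]_4)).
  have k2 := smx_scale oW s2 sIJ.
  apply: etrans (derive_eq_mx 'e_i oW NE Wq) _.
  apply: etrans (D_sub _ (smx_add oW k1 k2) stx Wq) _.
  rewrite (D_add _ k1 k2 Wq) (D_scale _ oW s1 (smx_cst W (1%:M : 'M[R]_4)) Wq).
  rewrite (D_scale _ oW s2 sIJ Wq) (D_mul _ oW sI sJ Wq) (D_mul _ oW sth sxi Wq).
  by rewrite D_cst scaler0 addr0.
have d12 : 'D_('e_i) c1 q + 'D_('e_i) c2 q = covector nrm2 q i 0 / 2.
  apply: etrans (esym (D_addf _ s1 s2 Wq)) _.
  have -> : 'D_('e_i) (fun x => c1 x + c2 x) q = 'D_('e_i) (fun x => nrm2 x * 2^-1) q.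
    by apply: eq_derive => x; rewrite /c1 /c2; lra.
  apply: etrans (D_mulf _ sn (sc 2^-1) Wq) _.
  by rewrite D_cstf mulr0 addr0 /covector mxE.
have dxi : 'D_('e_i) xi q = row i (N q) - xi q *m Gam i q.
  by rewrite row_hessmx addrK.
have Yth : Y *m th q = 0.
  rewrite [LHS]mx11_scalar th_pair // (inP_orth_inD (gsym Wq) (JgJ Wq) (IgI Wq) YP) ?raddf0 //.
  exact: xi_inD.
have YIJ : Y *m I q *m J q = Y by rewrite YP mulNmx (mulII (J2 Wq)) opprK.
rewrite -d12 /cov_hess dN (derive_I i Wq) (derive_J i Wq) (derive_covector i su Wq) dxi.
have -> : pair (g q) Y (row i (N q)) *: xi q = Y *m g q *m (row i (N q))^T *m xi q.
  by rewrite [Y *m g q *m _]mx11_scalar mul_scalar_mx.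
move: (row i (N q)) => r; rewrite NE // -/(c2 q).
move: ('D_('e_i) c1 q) ('D_('e_i) c2 q) (c1 q) (c2 q) => e1 e2 f1 f2.
move: (cov g I q i) (Gam i q) => A C.
move: (I q) (J q) (th q) (xi q) (g q) YIJ Yth => K L t x h YIJ Yth.
rewrite !(mulmxDl, mulmxDr, mulmxN, mulNmx, =^~ scalemxAl, =^~ scalemxAr, mulmx1, mul1mx).
rewrite !mulmxA YIJ Yth !mul0mx.
by mx_group.
Qed.

Lemma trace_cov_hess i q : W q -> \tr (cov_hess q i) = 2 * covector a q i 0.
Proof.
move=> Wq; have sN := smx_hessmx su.
rewrite /cov_hess linearB linearD /= (mxtrace_mulC (N q)) addrK.
have -> : \tr ('D_('e_i) N q) = 'D_('e_i) (fun x => \tr (N x)) q.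
  rewrite /mxtrace (D_sumf _ (fun j => sN j j) Wq); apply: eq_bigr => j _.
  exact: smx_deriveE sN Wq.
have -> : 'D_('e_i) (fun x => \tr (N x)) q = 'D_('e_i) (fun x => 2 * a x) q.
  by apply: eq_derive => x; rewrite /a mulrC divfK ?pnatr_eq0.
apply: etrans (D_mulf _ (Csmooth_cst W (2 : R)) Csmooth_half_trace Wq) _.
by rewrite D_cstf mul0r add0r /covector mxE.
Qed.

(** The trace hypothesis of [ric_inP_eigen] is [alpha_inP]: the trace of the
    Hessian is constant along the complement of [D]. *)
Lemma ricci_eigen q (v : 'rV[R]_4) : W q -> v != 0 -> v *m I q = - (v *m J q) ->
  exists c : R, v *m (ric (curv g q) *m invmx (g q)) = c *: v.
Proof.
move=> Wq.
have Ns X Y : pair (g q) (X *m N q) Y = pair (g q) (Y *m N q) X by apply: hessmx_sym.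
have NK X := hessian_mod_D X Wq.
have xiD := xi_inD Wq.
have xiND : xi q *m N q *m I q = xi q *m N q *m J q.
  exact: (hessian_inD (gsym Wq) (J2 Wq) (JgJ Wq) (IJC Wq) (rankD Wq) (gradE u Wq)
    xiD NK (n0 Wq) xiD).
have NP (Y : 'rV[R]_4) : Y *m I q = - (Y *m J q) -> Y *m N q = (nrm2 q / 2) *: Y.
  exact: (hessian_inP (gsym Wq) (gpos Wq) (J2 Wq) (JgJ Wq) (IgI Wq)
    (IJC Wq) (rankD Wq) (gradE u Wq) xiD Ns NK (n0 Wq)).
apply: (ric_inP_eigen (gsym Wq) (gpos Wq) (J2 Wq) (JgJ Wq) (I2 Wq) (IgI Wq) (IJC Wq)
  (rankD Wq) (fun i j => curv_of_alt _ _ i j) (fun i j => curv_skew i j Wq)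
  (fun i j => curv_J i j Wq) (fun i j k => curv_bianchi i j k Wq)
  (dn := covector nrm2 q) (c := nrm2 q / 4 - a q / 2) (L := cov_hess q)
  (gradE u Wq) xiD (n0 Wq) xiND Ns (fun X Y => cov_I X Y Wq)
  (fun i j => curv_xi i j Wq) (fun i Y YP => cov_hess_inP i Wq YP)).
- move=> Y YP; rewrite covector_nrm2 // NP // pairZl.
  by rewrite (inP_orth_inD (gsym Wq) (JgJ Wq) (IgI Wq) YP xiD) !mulr0.
- move=> Y YP; rewrite /along linear_sum /=.
  under eq_bigr => i _ do rewrite linearZ /= trace_cov_hess //.
  have := alpha_inP (gsym Wq) (gpos Wq) (J2 Wq) (JgJ Wq) (IgI Wq) (IJC Wq) (rankD Wq)
    (gradE u Wq) xiD Ns NK (n0 Wq) (fun X => covector_nrm2 X Wq) (closed_ddc Wq) YP.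
  rewrite mxE => e; transitivity (2 * \sum_i Y 0 i * covector a q i 0).
    by rewrite mulr_sumr; apply: eq_bigr => i _; rewrite mulrCA.
  by rewrite e mulr0.
Qed.

Lemma hessian_eigen q (v : 'rV[R]_4) : W q -> v *m I q = - (v *m J q) ->
  v *m N q = (nrm2 q / 2) *: v.
Proof.
move=> Wq vP.
have Ns X Y : pair (g q) (X *m N q) Y = pair (g q) (Y *m N q) X by apply: hessmx_sym.
exact: (hessian_inP (gsym Wq) (gpos Wq) (J2 Wq) (JgJ Wq) (IgI Wq) (IJC Wq)
    (rankD Wq) (gradE u Wq) (xi_inD Wq) Ns (fun X => hessian_mod_D X Wq) (n0 Wq) vP).
Qed.

End Nondegenerate.

(** For the vector fields [V] below, [A] is the endomorphism that sends [Y] to the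
    covariant derivative of [V] along [Y]. *)
Lemma cov_hat_endo V Y q (A : 'M[R]_4) :
  (forall k, 'D_('e_k) V q + V q *m Gam k q = row k A) ->
  cov_hat g Y V q = Y q *m A.
Proof.
move=> VA; rewrite [X in _ = X *m A]row_sum_delta mulmx_suml /cov_hat.
rewrite /along mulmx_sumr -big_split; apply: eq_bigr => k _ /=.
by rewrite -scalemxAl -rowE -VA -scalemxAr scalerDr.
Qed.

(** The Lie derivative of the metric is twice the symmetric part of [A]. *)
Lemma killing_hat V Y Z q (A : 'M[R]_4) : smx W Y -> smx W Z -> W q ->
  (forall k, 'D_('e_k) V q + V q *m Gam k q = row k A) ->
  (forall X1 X2, pair (g q) (X1 *m A) X2 = - pair (g q) X1 (X2 *m A)) ->
  \sum_k V q 0 k * 'D_('e_k) (fun x => pair (g x) (Y x) (Z x)) q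
  - pair (g q) (bracket_hat V Y q) (Z q) - pair (g q) (Y q) (bracket_hat V Z q) = 0.
Proof.
move=> sY sZ Wq VA As; rewrite (cov_hat_metric oW sg gsym gpos V sY sZ Wq).
rewrite -!(cov_hat_torsion oW sg gsym _ _ Wq) !(cov_hat_endo _ VA).
by rewrite !(pairDl, pairDr, pairNl, pairNr) As; ring.
Qed.

(** As [J] is parallel, the Lie derivative of [J] is the commutator of [J] with
    [A]. *)
Lemma holomorphic_hat V Y q (A : 'M[R]_4) : smx W Y -> W q ->
  (forall k, 'D_('e_k) V q + V q *m Gam k q = row k A) ->
  A *m J q = J q *m A ->
  bracket_hat V (fun x => Y x *m J x) q = bracket_hat V Y q *m J q.
Proof.
move=> sY Wq VA AJ; rewrite -!(cov_hat_torsion oW sg gsym _ _ Wq) !(cov_hat_endo _ VA) /cov_hat.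
have -> : along_field V (fun x => Y x *m J x) q = along_field V Y q *m J q
   + Y q *m (along (Gam ^~ q) (V q) *m J q - J q *m along (Gam ^~ q) (V q)).
  rewrite /along_field mulmx_suml /along mulmx_suml !mulmx_sumr -sumrB mulmx_sumr -big_split.
  apply: eq_bigr => k _ /=.
  rewrite (D_mul k oW sY sJ Wq) (derive_J k Wq) scalerDr -!scalemxAl.
  by rewrite -!scalemxAr -scalerBr -scalemxAr.
rewrite !(mulmxDl, mulmxDr, mulNmx, mulmxN) -!mulmxA AJ.
move: (along (Gam ^~ q) (V q)) => C; rewrite !mulmxA.
move: (along_field V Y q *m J q) => d; mx_group.
Qed.

End LocalGeometry.

(** * The function exp u in coordinates *)

Section ExponentialPotential.
Context {R : realType}.
Notation E := 'rV[R]_4.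

Lemma open_neq0 (W : set E) (f : E -> R) : open W -> Csmooth W f ->
  open (W `&` [set x | f x != 0]).
Proof.
move=> oW sf; rewrite openE => x [Wx fx]; apply: filterI.
  exact: open_nbhs_nbhs.
have /= cf := Csmooth_cont sf Wx.
by apply: (cf [set y | y != 0]); apply: open_nbhs_nbhs; split => //; exact: open_neq.
Qed.

Variables (W : set E) (g J I : E -> 'M[R]_4) (u : E -> R).
Hypothesis LG : local_geometry W g J I u.

Let oW := lg_open LG.
Let sg := lg_sg LG.
Let sJ := lg_sJ LG.
Let su := lg_su LG.
Let gsym := lg_sym LG.
Let gpos := lg_pos LG.
Let J2 := lg_J2 LG.
Let JgJ := lg_JgJ LG.

Notation Gam := (christoffel g).
Notation xi := (grad g u).
Notation th := (covector u).
Notation N := (hessmx g u).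
Notation nrm2 := (fun q => pair (g q) (xi q) (xi q)).

Lemma grad_neq0 q : W q -> th q != 0 -> nrm2 q != 0.
Proof.
move=> Wq t0; rewrite gt_eqF //; apply: gpos => //.
by apply: contraNneq t0 => x0; rewrite (covectorE LG u Wq) x0 trmx0 mulmx0.
Qed.

Lemma grad_eq0 q : W q -> nrm2 q = 0 -> xi q = 0.
Proof. by move=> Wq; apply: pos_def_eq0; apply: gpos. Qed.

(** Up to the factor [exp u], the Hessian of [exp u]; see [hessmx_tau]. *)
Definition shape q : 'M[R]_4 := N q + th q *m xi q.

Let nondegenerate_geometry :
  local_geometry (W `&` [set x | nrm2 x != 0]) g J I u.
Proof.
apply: local_geometry_sub LG => [|x []//]; apply: open_neq0 => //.
exact: (Csmooth_nrm2 LG).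
Qed.

Let nondegenerate_neq0 q : (W `&` [set x | nrm2 x != 0]) q -> nrm2 q != 0.
Proof. by case. Qed.

(** Where [du <> 0] the normal form of the Hessian commutes with [J].  The set
    where the commutator is nonzero is open, so [du] vanishes on all of it, and
    with it the operator: this set is empty. *)
Lemma shape_comm q : W q -> shape q *m J q = J q *m shape q.
Proof.
move=> Wq; have sN := smx_hessmx LG su; have sxi := smx_grad LG su.
have sS : smx W shape.
  by apply: smx_add => //; apply: smx_mul => //; apply: smx_covector.
pose F x := shape x *m J x - J x *m shape x.
have sF : smx W F by apply: smx_sub => //; apply: smx_mul.
have F0 x : W x -> nrm2 x != 0 -> F x = 0.
  move=> Wx nx; rewrite /F /shape.
  have := @hessian_form _ _ _ _ _ _ nondegenerate_geometry nondegenerate_neq0 x (conj Wx nx).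
  move=> ->; rewrite mulmxDl mulmxDr scalar_mxC -scalemxAl -scalemxAr mulmxA.
  by rewrite (lg_IJ LG Wx) subrr.
apply/eqP; rewrite -subr_eq0; apply: contraT => /matrix0Pn [i [j Fij]].
have oO := open_neq0 oW (sF i j).
set O := (W `&` _) in oO.
have Oq : O q by [].
have xi0 x : O x -> xi x = 0.
  move=> [Wx Fx]; apply: grad_eq0 => //; apply/eqP; apply: contraT => nx.
  by move: Fx; rewrite /= F0 // mxE eqxx.
have th0 : th q = 0 by rewrite (covectorE LG u Wq) (xi0 q Oq) trmx0 mulmx0.
have N0 : N q = 0.
  apply/row_matrixP => k; rewrite row_hessmx row0 (xi0 q Oq) mul0mx addr0.
  have e := @derive_eq_mx R 1 4 O xi (fun=> 0) q 'e_k oO xi0 Oq.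
  exact: etrans e (D_cst 0 q k).
by move: Fij; rewrite /F /shape N0 th0 mul0mx addr0 mul0mx mulmx0 subrr mxE eqxx.
Qed.

Notation tau := (fun x => expR (u x)).

Lemma Csmooth_tau : Csmooth W tau.
Proof. exact: Csmooth_exp. Qed.

Lemma covector_tau q : W q -> covector tau q = expR (u q) *: th q.
Proof.
move=> Wq; apply/colP => i; rewrite [LHS]mxE.
apply: etrans (@derive_val _ _ _ _ _ _ _ (derive_exp i oW su Wq)) _.
by rewrite [RHS]mxE /covector mxE.
Qed.

Lemma grad_tau q : W q -> grad g tau q = expR (u q) *: xi q.
Proof. by move=> Wq; rewrite /grad covector_tau // linearZ /= scalemxAl. Qed.

Lemma hessmx_tau q : W q -> hessmx g tau q = expR (u q) *: shape q.
Proof.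
move=> Wq; apply/row_matrixP => k; rewrite row_hessmx linearZ /= /shape rowD row_hessmx.
rewrite (derive_eq_mx _ oW grad_tau Wq) (D_scale _ oW Csmooth_tau (smx_grad LG su) Wq).
have -> : 'D_('e_k) tau q = expR (u q) * th q k 0.
  by have := covector_tau Wq => /colP/(_ k); rewrite [LHS]mxE => ->; rewrite mxE.
have -> : row k (th q *m xi q) = th q k 0 *: xi q.
  by rewrite row_mul [row k _]mx11_scalar mul_scalar_mx mxE.
rewrite grad_tau // -scalemxAl -scalerA.
move: ('D_('e_k) xi q) (xi q *m Gam k q) (xi q) => a b c.
by rewrite !scalerDr -addrA addrC.
Qed.

Definition killing_field (x : E) : 'rV[R]_4 := grad g tau x *m J x.

Lemma smx_killing_field : smx W killing_field.
Proof. by apply: smx_mul => //; apply: (smx_grad LG); apply: Csmooth_tau. Qed.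

Lemma cov_killing_field k q : W q ->
  'D_('e_k) killing_field q + killing_field q *m Gam k q
  = row k (hessmx g tau q *m J q).
Proof.
move=> Wq; have sG := smx_grad LG Csmooth_tau.
rewrite row_mul row_hessmx /killing_field (D_mul _ oW sG sJ Wq) (derive_J LG k Wq).
move: ('D_('e_k) _ q) (grad g tau q) (Gam k q) (J q) => d x C j.
by rewrite mulmxBr mulmxDl !mulmxA addrA subrK.
Qed.

Lemma hess_tau_comm q : W q ->
  hessmx g tau q *m J q *m J q = J q *m (hessmx g tau q *m J q).
Proof.
move=> Wq; rewrite hessmx_tau // -!scalemxAl -!scalemxAr; congr (_ *: _).
by rewrite mulmxA -shape_comm.
Qed.

Lemma hess_tau_skew q X Y : W q ->
  pair (g q) (X *m (hessmx g tau q *m J q)) Y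
  = - pair (g q) X (Y *m (hessmx g tau q *m J q)).
Proof.
move=> Wq; have st := Csmooth_tau.
have comm : hessmx g tau q *m J q = J q *m hessmx g tau q.
  by rewrite hessmx_tau // -!scalemxAl -!scalemxAr shape_comm.
rewrite mulmxA (pairI (J2 Wq) (JgJ Wq)) (hessmx_sym LG _ _ st Wq) comm mulmxA.
by rewrite pairC // gsym.
Qed.

Lemma killing_tau Y Z q : smx W Y -> smx W Z -> W q ->
  \sum_k killing_field q 0 k * 'D_('e_k) (fun x => pair (g x) (Y x) (Z x)) q
  - pair (g q) (bracket_hat killing_field Y q) (Z q)
  - pair (g q) (Y q) (bracket_hat killing_field Z q) = 0.
Proof.
move=> sY sZ Wq; apply: (killing_hat LG sY sZ Wq).
  by move=> k; apply: cov_killing_field.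
by move=> X1 X2; apply: hess_tau_skew.
Qed.

Lemma holomorphic_tau Y q : smx W Y -> W q ->
  bracket_hat killing_field (fun x => Y x *m J x) q
  = bracket_hat killing_field Y q *m J q.
Proof.
move=> sY Wq; apply: (holomorphic_hat LG sY Wq).
  by move=> k; apply: cov_killing_field.
exact: hess_tau_comm.
Qed.

Lemma orth_grad_inP q (v : 'rV[R]_4) : W q -> nrm2 q != 0 ->
  pair (g q) v (xi q) = 0 -> pair (g q) v (xi q *m J q) = 0 ->
  v *m I q = - (v *m J q).
Proof.
move=> Wq nq v1 v2.
apply: (orth_inD_inP (gsym Wq) (gpos Wq) (J2 Wq) (JgJ Wq) (lg_I2 LG Wq) (lg_IgI LG Wq)
  (lg_IJ LG Wq)) => Y YD.
apply: (mulfI nq); rewrite mulr0 -pairZr.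
rewrite (inD_basis (gsym Wq) (J2 Wq) (JgJ Wq) (lg_IJ LG Wq) (lg_rank LG Wq) nq
  (xi_inD LG Wq) YD).
by rewrite pairDr !pairZr v1 v2 !mulr0 addr0.
Qed.

Lemma hess_tau_eigen q (v : 'rV[R]_4) : W q -> nrm2 q != 0 ->
  v *m I q = - (v *m J q) -> exists c, v *m hessmx g tau q = c *: v.
Proof.
move=> Wq nq vP; exists (expR (u q) * (nrm2 q / 2)).
rewrite hessmx_tau // -scalemxAr /shape mulmxDr mulmxA.
rewrite (@hessian_eigen _ _ _ _ _ _ nondegenerate_geometry nondegenerate_neq0) //.
rewrite [v *m th q]mx11_scalar (th_pair LG) //.
rewrite (inP_orth_inD (gsym Wq) (JgJ Wq) (lg_IgI LG Wq) vP (xi_inD LG Wq)).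
by rewrite raddf0 mul0mx addr0 scalerA.
Qed.

Lemma ricci_tau_eigen q (v : 'rV[R]_4) : W q -> nrm2 q != 0 -> v != 0 ->
  v *m I q = - (v *m J q) ->
  exists c, v *m (ric (curv g q) *m invmx (g q)) = c *: v.
Proof.
move=> Wq nq; apply: (@ricci_eigen _ _ _ _ _ _ nondegenerate_geometry) => //.
Qed.

End ExponentialPotential.

(** * Fields read in a chart *)

Local Notation coord := Defs.coord.

Section ChartImages.
Context {R : realType} {T : topologicalType}.
Implicit Types (c : chart R T) (V : set T).

Definition img c V : set 'rV[R]_4 := cmap c @` (V `&` cdom c).

Lemma img_cmap c V z : V z -> cdom c z -> img c V (cmap c z).
Proof. by move=> Vz cz; exists z. Qed.

Lemma img_cinv c V p : img c V p ->
  [/\ V (cinv c p), cdom c (cinv c p) & cmap c (cinv c p) = p].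
Proof. by case=> z [Vz cz] <-; rewrite cmapK. Qed.

Lemma img_open c V : open V -> open (img c V).
Proof.
move=> oV; have oVc : open (V `&` cdom c) by apply: openI => //; apply: cdom_open.
rewrite openE => p ip; have [Vp cp pE] := img_cinv ip.
have Op : (cmap c @` cdom c) p by exists (cinv c p).
have n1 : nbhs p (cmap c @` cdom c).
  by apply: open_nbhs_nbhs; split => //; apply: cimg_open.
have n2 : \forall q \near p, (V `&` cdom c) (cinv c q).
  apply: (cinv_continuous Op); apply: open_nbhs_nbhs; split => //.
apply: (@filterS _ _ (nbhs_filter p) _ _ _ (@filterI _ _ (nbhs_filter p) _ _ n1 n2)) => q [[z cz zE] [Vq cq]].
by exists (cinv c q) => //; rewrite -zE cmapK.
Qed.

Lemma img_sub c V V' : V `<=` V' -> img c V `<=` img c V'.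
Proof. by move=> VV' p [z [Vz cz] zE]; exists z => //; split => //; apply: VV'. Qed.

End ChartImages.
Arguments img_open {R T} c [V].
Arguments img_cmap {R T} c [V z].

Section ManifoldCalculus.
Context {R : realType} {M : manifold4 R}.
Notation E := 'rV[R]_4.
Implicit Types (c : chart R M) (V : set M) (f : M -> R) (x y z : M) (X Y Z : M -> E).

Lemma compatible_chart_at x : compatible_chart (chart_at x).
Proof. by move=> y; split; apply: chart_at_smooth. Qed.

Definition hatf c f : E -> R := f \o cinv c.

Lemma transition_smooth c c' i : smooth_transition c c' ->
  Csmooth (img c (cdom c')) (hatf c (coord c' i)).
Proof. by move=> s; rewrite /img setIC; apply: s. Qed.

Lemma smooth_fun_sub V V' f : V' `<=` V -> smooth_fun V f -> smooth_fun V' f.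
Proof. by move=> VV' sf y; apply: Csmooth_sub (sf y); apply: img_sub. Qed.

(** The transition maps carry smoothness to the other charts. *)
Lemma smooth_fun_of_chart V f y : open V -> V `<=` cdom (chart_at y) ->
  Csmooth (img (chart_at y) V) (hatf (chart_at y) f) -> smooth_fun V f.
Proof.
move=> oV Vy sf y'.
pose w q := cmap (chart_at y) (cinv (chart_at y') q).
have oV' := img_open (chart_at y') oV.
apply: (@Csmooth_eq _ _ (fun q => hatf (chart_at y) f (w q))) => //.
  by move=> q /img_cinv [Vq _ _]; rewrite /hatf /= /w cmapK //; apply: Vy.
apply: (Csmooth_comp (img_open (chart_at y) oV) oV' sf).
  by move=> q /img_cinv [Vq _ _]; apply: img_cmap => //; apply: Vy.
move=> j; have s := transition_smooth j (chart_at_smooth y' y).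
by apply: Csmooth_sub s; apply: img_sub.
Qed.

(** [dmx c z] is the differential at [z] of the change of coordinates from the
    preferred chart at [z] to [c], and [tmx c z] that of its inverse. *)
Definition dmx c z : 'M[R]_4 :=
  \matrix_(i, j) 'D_('e_i) (hatf (chart_at z) (coord c j)) (cmap (chart_at z) z).

Definition tmx c z : 'M[R]_4 :=
  \matrix_(i, j) 'D_('e_i) (hatf c (coord (chart_at z) j)) (cmap c z).

Lemma coord_vfE y i z : coord_vf y i z = row i (tmx (chart_at y) z).
Proof. by apply/rowP => j; rewrite !mxE. Qed.

Lemma chart_diffE c z v : compatible_chart c -> cdom c z ->
  chart_diff c z v = v *m dmx c z.
Proof.
move=> cc cz; apply/rowP => j; rewrite [LHS]mxE [RHS]mxE /tangent_deriv.
have iz : img (chart_at z) (cdom c) (cmap (chart_at z) z).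
  by apply: img_cmap => //; apply: chart_at_dom.
have s := transition_smooth j (cc z).2.
have d := Csmooth_derive v (img_open (chart_at z) (@cdom_open _ _ c)) s iz.
apply: etrans (@derive_val _ _ _ _ _ _ _ d) _.
by apply: eq_bigr => i _; rewrite mxE.
Qed.

Lemma tangent_derivE c (W : set E) z v f : compatible_chart c -> cdom c z ->
  open W -> W (cmap c z) -> Csmooth W (hatf c f) ->
  tangent_deriv z v f = (v *m dmx c z *m covector (hatf c f) (cmap c z)) 0 0.
Proof.
move=> cc cz oW Wz sf; rewrite /tangent_deriv -chart_diffE //.
pose cz' := chart_at z; pose p := cmap cz' z.
have iz : img cz' (cdom c) p by apply: img_cmap => //; apply: chart_at_dom.
have oI := img_open cz' (@cdom_open _ _ c).
pose w q := cmap c (cinv cz' q).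
have wp : w p = cmap c z by rewrite /w /p cmapK //; apply: chart_at_dom.
have dw j : derivable (fun q => w q 0 j) p v.
  have d := Csmooth_derive v oI (transition_smooth j (cc z).2) iz.
  exact: (@ex_derive _ _ _ _ _ _ _ d).
have Wwp : W (w p) by rewrite wp.
have := chain_rule oW sf Wwp dw => d.
transitivity ('D_v (fun q => hatf c f (w q)) p).
  apply: near_eq_derive; apply: near_open oI iz _ => q /img_cinv [cq _ _].
  by rewrite /hatf /= /w cmapK.
apply: etrans (@derive_val _ _ _ _ _ _ _ d) _; rewrite wp [RHS]mxE.
by apply: eq_bigr => j _; rewrite [covector _ _ _ _]mxE [chart_diff _ _ _ _ _]mxE.
Qed.

Lemma coord_id_derive x i j (W : set E) p : open W -> W p ->
  (forall q, W q -> (cmap (chart_at x) @` cdom (chart_at x)) q) ->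
  'D_('e_i) (hatf (chart_at x) (coord (chart_at x) j)) p = (i == j)%:R.
Proof.
move=> oW Wp WO.
transitivity ('D_('e_i) (fun q : E => q 0 j) p).
  apply: near_eq_derive; apply: near_open oW Wp _ => q /WO [z cz <-].
  by rewrite /hatf /coord /= cmapK.
have dd : derivable (id : E -> E) p 'e_i by apply: derivable_id.
have := derive_mx dd; rewrite derive_id => /rowP/(_ j); rewrite [RHS]mxE => <-.
by rewrite mxE eqxx /= eq_sym.
Qed.

Lemma dmx_tmx c z : compatible_chart c -> cdom c z -> dmx c z *m tmx c z = 1%:M.
Proof.
move=> cc cz; apply/matrixP => i j.
have s := transition_smooth j (cc z).1.
have iz : img c (cdom (chart_at z)) (cmap c z).
  by apply: img_cmap => //; apply: chart_at_dom.
have oI := img_open c (@cdom_open _ _ (chart_at z)).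
have := tangent_derivE 'e_i cc cz oI iz s.
have -> : tangent_deriv z 'e_i (coord (chart_at z) j) = (i == j)%:R.
  apply: (@coord_id_derive z i j (cmap (chart_at z) @` cdom (chart_at z))) => //.
    exact: cimg_open.
  by exists z => //; apply: chart_at_dom.
rewrite -rowE -row_mul => e; rewrite [RHS]mxE e.
rewrite [RHS]mxE [LHS]mxE [RHS]mxE; apply: eq_bigr => k _.
by congr (_ * _); rewrite [LHS]mxE [RHS]mxE.
Qed.

Lemma tmx_dmx c z : compatible_chart c -> cdom c z -> tmx c z *m dmx c z = 1%:M.
Proof. by move=> cc cz; apply: mulmx1C; apply: dmx_tmx. Qed.

Lemma dmx_self z : dmx (chart_at z) z = 1%:M.
Proof.
apply/matrixP => i j; rewrite [LHS]mxE [RHS]mxE.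
apply: (@coord_id_derive z i j (cmap (chart_at z) @` cdom (chart_at z))) => //.
  exact: cimg_open.
by exists z => //; apply: chart_at_dom.
Qed.

Lemma tmx_self z : tmx (chart_at z) z = 1%:M.
Proof.
have := dmx_tmx (@compatible_chart_at z) (chart_at_dom z).
by rewrite dmx_self mul1mx.
Qed.

End ManifoldCalculus.

Section Hats.
Context {R : realType} {M : manifold4 R}.
Notation E := 'rV[R]_4.
Implicit Types (c : chart R M) (V : set M) (f : M -> R) (x y z : M) (X Y Z : M -> E).

(** A vector, a bilinear form and an endomorphism at [cinv c p], converted from
    the preferred chart at that point, in which fields on [M] are read, to the
    chart [c]. *)
Definition hatv c X (p : E) : E := X (cinv c p) *m dmx c (cinv c p).
Definition hatb c (B : M -> 'M[R]_4) (p : E) : 'M[R]_4 :=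
  tmx c (cinv c p) *m B (cinv c p) *m (tmx c (cinv c p))^T.
Definition hate c (J : M -> 'M[R]_4) (p : E) : 'M[R]_4 :=
  tmx c (cinv c p) *m J (cinv c p) *m dmx c (cinv c p).

Lemma hatv_cmap c X z : cdom c z -> hatv c X (cmap c z) = X z *m dmx c z.
Proof. by move=> cz; rewrite /hatv cmapK. Qed.

Lemma hatb_cmap c B z : cdom c z ->
  hatb c B (cmap c z) = tmx c z *m B z *m (tmx c z)^T.
Proof. by move=> cz; rewrite /hatb cmapK. Qed.

Lemma hate_cmap c J z : cdom c z -> hate c J (cmap c z) = tmx c z *m J z *m dmx c z.
Proof. by move=> cz; rewrite /hate cmapK. Qed.

Lemma lie_funE c V X f z : compatible_chart c -> cdom c z -> open V -> V z ->
  Csmooth (img c V) (hatf c f) ->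
  lie_fun X f z = \sum_k hatv c X (cmap c z) 0 k * 'D_('e_k) (hatf c f) (cmap c z).
Proof.
move=> cc cz oV Vz sf; rewrite hatv_cmap //.
apply: etrans (tangent_derivE (X z) cc cz (img_open c oV) (img_cmap c Vz cz) sf) _.
by rewrite mxE; apply: eq_bigr => k _; congr (_ * _); apply: mxE.
Qed.

Lemma smooth_vf_sub V V' X : V' `<=` V -> smooth_vf V X -> smooth_vf V' X.
Proof.
move=> VV' sX y i; apply: smooth_fun_sub (sX y i) => z [Vz yz].
by split => //; apply: VV'.
Qed.

Lemma hatv_lie V X y (j : 'I_4) p : img (chart_at y) V p ->
  hatv (chart_at y) X p 0 j = hatf (chart_at y) (lie_fun X (coord (chart_at y) j)) p.
Proof.
move=> /img_cinv [_ cp _]; rewrite /hatv /hatf /=.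
by rewrite -chart_diffE //; [rewrite mxE|apply: compatible_chart_at].
Qed.

Lemma hatv_smooth V X y : open V -> smooth_vf V X ->
  smx (img (chart_at y) V) (hatv (chart_at y) X).
Proof.
move=> oV sX i j; rewrite ord1.
have s := sX y j y.
apply: (Csmooth_eq (img_open (chart_at y) oV) (fun p pV => esym (hatv_lie X j pV))).
apply: Csmooth_sub s => p [z [Vz yz] <-]; exists z => //; split => //.
Qed.

Lemma smooth_vf_hatv V X : open V ->
  (forall y, smx (img (chart_at y) V) (hatv (chart_at y) X)) -> smooth_vf V X.
Proof.
move=> oV sX y j.
have oVy : open (V `&` cdom (chart_at y)) by apply: openI => //; apply: cdom_open.
apply: (smooth_fun_of_chart (y := y) oVy) => [z [] //|].
have oI := img_open (chart_at y) oVy.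
apply: (Csmooth_eq oI (fun p pV => hatv_lie X j pV)).
by apply: Csmooth_sub (sX y 0 j); apply: img_sub => z [].
Qed.

Lemma lie_coord_vf y i f z (V : set M) : cdom (chart_at y) z -> open V -> V z ->
  Csmooth (img (chart_at y) V) (hatf (chart_at y) f) ->
  lie_fun (coord_vf y i) f z = 'D_('e_i) (hatf (chart_at y) f) (cmap (chart_at y) z).
Proof.
move=> yz oV Vz sf; rewrite (lie_funE _ (@compatible_chart_at _ _ y) yz oV Vz sf).
rewrite hatv_cmap // coord_vfE -row_mul tmx_dmx //; last exact: compatible_chart_at.
rewrite (bigD1 i) //= big1 ?addr0 => [|k ki]; first by rewrite !mxE eqxx mul1r.
by rewrite !mxE eq_sym (negbTE ki) mul0r.
Qed.

Lemma smooth_coord_vf y i : smooth_vf (cdom (chart_at y)) (coord_vf y i).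
Proof.
have oy := @cdom_open _ _ (chart_at y).
move=> y' j; have oy' := @cdom_open _ _ (chart_at y').
have oyy' : open (cdom (chart_at y) `&` cdom (chart_at y')) by exact: openI.
apply: (smooth_fun_of_chart (y := y) oyy') => [z [] //|].
have s := transition_smooth j (chart_at_smooth y y').
have oI := img_open (chart_at y) oyy'.
apply: (@Csmooth_eq _ _ ('D_('e_i) (hatf (chart_at y) (coord (chart_at y') j)))) => //.
  move=> p ip; have [[yp y'p] _ pE] := img_cinv ip.
  apply: esym; rewrite /hatf /= (lie_coord_vf i yp oy' y'p s).
  by rewrite pE.
by apply: Csmooth_sub (CsmoothD_e i s); apply: img_sub => z [].
Qed.

Lemma hatv_coord_vf y i p : (cmap (chart_at y) @` cdom (chart_at y)) p ->
  hatv (chart_at y) (coord_vf y i) p = 'e_i.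
Proof.
move=> [z yz <-]; rewrite hatv_cmap // coord_vfE -row_mul tmx_dmx ?row1 //.
exact: compatible_chart_at.
Qed.

Lemma hatb_entry y B p i j : hatb (chart_at y) B p i j =
  hatf (chart_at y) (bil_app B (coord_vf y i) (coord_vf y j)) p.
Proof.
rewrite /hatb /hatf /= /bil_app !coord_vfE; move: (tmx _ _) (B _) => t b.
by rewrite tr_row -row_mul colE mulmxA -row_mul -colE [RHS]mxE [RHS]mxE.
Qed.

Lemma hatb_smooth V B y : open V -> smooth_bil V B ->
  smx (img (chart_at y) V) (hatb (chart_at y) B).
Proof.
move=> oV sB i j.
have oVy : open (V `&` cdom (chart_at y)) by apply: openI => //; apply: cdom_open.
have sc k : smooth_vf (V `&` cdom (chart_at y)) (coord_vf y k).
  by apply: smooth_vf_sub (smooth_coord_vf y k) => z [].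
have s := sB _ _ _ oVy (fun z h => h.1) (sc i) (sc j) y.
apply: (@Csmooth_eq _ _ (hatf (chart_at y) (bil_app B (coord_vf y i) (coord_vf y j)))).
- exact: img_open.
- by move=> p _; rewrite hatb_entry.
by apply: Csmooth_sub s => p [z [Vz yz] <-]; exists z.
Qed.

Lemma hate_smooth V J y : open V -> smooth_endo V J ->
  smx (img (chart_at y) V) (hate (chart_at y) J).
Proof.
move=> oV sJ i j.
have oVy : open (V `&` cdom (chart_at y)) by apply: openI => //; apply: cdom_open.
have sc k : smooth_vf (V `&` cdom (chart_at y)) (coord_vf y k).
  by apply: smooth_vf_sub (smooth_coord_vf y k) => z [].
have s := hatv_smooth y oVy (sJ _ _ oVy (fun z h => h.1) (sc i)).
apply: (@Csmooth_eq _ _ (fun p => hatv (chart_at y) (endo_app J (coord_vf y i)) p 0 j)).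
- exact: img_open.
- move=> p _; rewrite /hate /hatv /endo_app coord_vfE -!row_mul.
  by rewrite [LHS]mxE.
by apply: Csmooth_sub (s 0 j) => p [z [Vz yz] <-]; exists z.
Qed.

Lemma bil_hat c B X Y z : compatible_chart c -> cdom c z ->
  bil_app B X Y z =
  pair (hatb c B (cmap c z)) (hatv c X (cmap c z)) (hatv c Y (cmap c z)).
Proof.
move=> cc cz; rewrite hatb_cmap // !hatv_cmap // /pair /bil_app trmx_mul.
have e := dmx_tmx cc cz; have e' : (tmx c z)^T *m (dmx c z)^T = 1%:M.
  by rewrite -trmx_mul e trmx1.
rewrite -!mulmxA (mulmxA (dmx c z)) e mul1mx !mulmxA.
by rewrite -(mulmxA _ (tmx c z)^T) e' mulmx1.
Qed.

Lemma hatv_endo c J X p : compatible_chart c -> cdom c (cinv c p) ->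
  hatv c (endo_app J X) p = hatv c X p *m hate c J p.
Proof.
move=> cc cp; rewrite /hatv /hate /endo_app !mulmxA -(mulmxA _ (dmx _ _)).
by rewrite dmx_tmx // mulmx1.
Qed.

End Hats.

Section BracketInCharts.
Context {R : realType} {M : manifold4 R}.
Notation E := 'rV[R]_4.
Implicit Types (c : chart R M) (V : set M) (f : M -> R) (x y z : M) (X Y Z : M -> E).

Lemma hatf_lie y V X f p : open V -> smooth_vf V X -> smooth_fun V f ->
  img (chart_at y) V p ->
  hatf (chart_at y) (lie_fun X f) p =
  \sum_k hatv (chart_at y) X p 0 k * 'D_('e_k) (hatf (chart_at y) f) p.
Proof.
move=> oV sX sf ip; have [Vp cp pE] := img_cinv ip.
rewrite /hatf /= (lie_funE X (@compatible_chart_at _ _ y) cp oV Vp (sf y)).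
by rewrite pE.
Qed.

Lemma smooth_lie V X f : open V -> smooth_vf V X -> smooth_fun V f ->
  smooth_fun V (lie_fun X f).
Proof.
move=> oV sX sf y.
apply: (Csmooth_eq (img_open (chart_at y) oV)
  (fun p ip => esym (hatf_lie (f := f) oV sX sf ip))).
apply: Csmooth_sum; first exact: img_open.
move=> k; apply: Csmooth_mul; first exact: img_open.
  exact: (hatv_smooth y oV sX).
by apply: CsmoothD_e; apply: sf.
Qed.

(** The brackets of [M] are defined by coordinate functions of one chart; this
    is their action on an arbitrary function, in an arbitrary chart. *)
Lemma lie_bracket V X Y f z : open V -> V z ->
  smooth_vf V X -> smooth_vf V Y -> smooth_fun V f ->
  forall y, cdom (chart_at y) z ->
  lie_fun X (lie_fun Y f) z - lie_fun Y (lie_fun X f) z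
  = \sum_k bracket_hat (hatv (chart_at y) X) (hatv (chart_at y) Y)
              (cmap (chart_at y) z) 0 k
           * 'D_('e_k) (hatf (chart_at y) f) (cmap (chart_at y) z).
Proof.
move=> oV Vz sX sY sf y yz; set p := cmap _ z; set c := chart_at y.
have ip : img c V p by apply: img_cmap.
have oI := img_open c oV.
have := lie_bracket_hat oI (hatv_smooth y oV sX) (hatv_smooth y oV sY) (sf y) ip.
move=> /= <-.
have L A B : smooth_vf V A -> smooth_vf V B -> lie_fun A (lie_fun B f) z =
   \sum_k hatv c A p 0 k * 'D_('e_k)
     (fun q => \sum_l hatv c B q 0 l * 'D_('e_l) (hatf c f) q) p.
  move=> sA sB.
  have := hatf_lie oV sA (smooth_lie oV sB sf) ip.
  rewrite /hatf /= cmapK // => ->; apply: eq_bigr => k _; congr (_ * _).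
  by apply: (derive_eq_on _ oI _ ip) => q iq; exact: (hatf_lie oV sB sf iq).
by rewrite (L X Y sX sY) (L Y X sY sX).
Qed.

Lemma smooth_coord y j : smooth_fun (cdom (chart_at y)) (coord (chart_at y) j).
Proof.
move=> y'; apply: Csmooth_sub (transition_smooth j (chart_at_smooth y' y)).
by move=> p.
Qed.

Lemma hatf_coord_derive y i j p : (cmap (chart_at y) @` cdom (chart_at y)) p ->
  'D_('e_i) (hatf (chart_at y) (coord (chart_at y) j)) p = (i == j)%:R.
Proof. by move=> ip; apply: (coord_id_derive i j (cimg_open (c := chart_at y)) ip). Qed.

Lemma bracketE V X Y z j : open V -> V z -> smooth_vf V X -> smooth_vf V Y ->
  bracket X Y z 0 j = bracket_hat (hatv (chart_at z) X) (hatv (chart_at z) Y)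
                        (cmap (chart_at z) z) 0 j.
Proof.
move=> oV Vz sX sY; rewrite [LHS]mxE.
have zz := chart_at_dom z; have oz := @cdom_open _ _ (chart_at z).
have oVz : open (V `&` cdom (chart_at z)) by exact: openI.
have sXz := smooth_vf_sub (@subIsetl _ V (cdom (chart_at z))) sX.
have sYz := smooth_vf_sub (@subIsetl _ V (cdom (chart_at z))) sY.
have sc := smooth_fun_sub (@subIsetr _ V (cdom (chart_at z))) (smooth_coord z j).
rewrite (lie_bracket oVz (conj Vz zz) sXz sYz sc zz).
have iz : (cmap (chart_at z) @` cdom (chart_at z)) (cmap (chart_at z) z) by exists z.
rewrite (bigD1 j) //= big1 ?addr0 => [|k kj].
  by rewrite hatf_coord_derive // eqxx mulr1.
by rewrite hatf_coord_derive // (negbTE kj) mulr0.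
Qed.

Lemma bracket_hatE V X Y z y : open V -> V z -> smooth_vf V X -> smooth_vf V Y ->
  cdom (chart_at y) z -> bracket X Y z *m dmx (chart_at y) z =
  bracket_hat (hatv (chart_at y) X) (hatv (chart_at y) Y) (cmap (chart_at y) z).
Proof.
move=> oV Vz sX sY yz; apply/rowP => j.
have zz := chart_at_dom z; have oy := @cdom_open _ _ (chart_at y).
have oVy : open (V `&` cdom (chart_at y)) by exact: openI.
have sXy := smooth_vf_sub (@subIsetl _ V (cdom (chart_at y))) sX.
have sYy := smooth_vf_sub (@subIsetl _ V (cdom (chart_at y))) sY.
have sc := smooth_fun_sub (@subIsetr _ V (cdom (chart_at y))) (smooth_coord y j).
have L := lie_bracket oVy (conj Vz yz) sXy sYy sc.
have iy : (cmap (chart_at y) @` cdom (chart_at y)) (cmap (chart_at y) z) by exists z.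
have e1 := L z zz; rewrite (L y yz) in e1.
rewrite (bigD1 j) //= big1 ?addr0 in e1; last first.
  by move=> k kj; rewrite hatf_coord_derive // (negbTE kj) mulr0.
rewrite hatf_coord_derive // eqxx mulr1 in e1.
rewrite e1 mxE; apply: eq_bigr => k _; rewrite (bracketE k oV Vz sX sY).
by congr (_ * _); rewrite mxE.
Qed.

End BracketInCharts.

(** * The Levi-Civita connection on the manifold *)

Section Connection.
Context {R : realType} {M : manifold4 R}.
Notation E := 'rV[R]_4.
Implicit Types (c : chart R M) (V : set M) (f : M -> R) (x y z : M) (X Y Z : M -> E).
Variable g : M -> 'M[R]_4.
Hypothesis hg : riemannian setT g.

Lemma tmx_unit c z : compatible_chart c -> cdom c z -> tmx c z \in unitmx.
Proof. by move=> cc cz; have /mulmx1_unit[] := tmx_dmx cc cz. Qed.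

Lemma dmx_unit c z : compatible_chart c -> cdom c z -> dmx c z \in unitmx.
Proof. by move=> cc cz; have /mulmx1_unit[] := tmx_dmx cc cz. Qed.

Notation Om y := (img (chart_at y) setT).
Notation gh y := (hatb (chart_at y) g).

Lemma Om_open y : open (Om y).
Proof. by apply: img_open; exact: openT. Qed.

Lemma gh_smooth y : smx (Om y) (gh y).
Proof. by apply: hatb_smooth; [exact: openT|case: hg]. Qed.

Lemma gh_sym y p : Om y p -> (gh y p)^T = gh y p.
Proof.
move=> _; case: hg => _ gs _; rewrite /hatb !trmx_mul trmxK gs //.
by rewrite mulmxA.
Qed.

Lemma g_pos x : pos_def (g x).
Proof. by case: hg => _ _ gp v v0; apply: gp. Qed.

Lemma gh_pos y p : Om y p -> pos_def (gh y p).
Proof.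
move=> ip v v0; have [_ yp _] := img_cinv ip; rewrite /hatb -mulmxA pairMl pairMr.
apply: g_pos; apply: contraNneq v0 => vt.
have tu := tmx_unit (@compatible_chart_at _ _ y) yp.
by rewrite -(mulmxK tu v) vt mul0mx.
Qed.

(** The chart used at [x] is the preferred one, and so jumps with [x]; that the
    result is nevertheless a smooth field is [nabla_smooth]. *)
Definition nabla X Y : M -> E := fun x =>
  cov_hat (gh x) (hatv (chart_at x) X) (hatv (chart_at x) Y) (cmap (chart_at x) x).

Lemma Om_sub V y : img (chart_at y) V `<=` Om y.
Proof. exact: img_sub. Qed.

Lemma Om_cmap y z : cdom (chart_at y) z -> Om y (cmap (chart_at y) z).
Proof. by move=> yz; apply: img_cmap. Qed.

Lemma bil_hat_on y X Y p : Om y p ->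
  hatf (chart_at y) (bil_app g X Y) p =
  pair (gh y p) (hatv (chart_at y) X p) (hatv (chart_at y) Y p).
Proof.
move=> ip; have [_ yp pE] := img_cinv ip.
by rewrite /hatf /= (bil_hat _ _ _ (@compatible_chart_at _ _ y) yp) pE.
Qed.

Lemma lie_bil_hat V X Y Z y z : open V -> V z -> smooth_vf V X -> smooth_vf V Y ->
  smooth_vf V Z -> cdom (chart_at y) z ->
  lie_fun X (bil_app g Y Z) z =
  \sum_k hatv (chart_at y) X (cmap (chart_at y) z) 0 k *
    'D_('e_k) (fun q => pair (gh y q) (hatv (chart_at y) Y q) (hatv (chart_at y) Z q))
      (cmap (chart_at y) z).
Proof.
move=> oV Vz sX sY sZ yz; have oI := img_open (chart_at y) oV.
have sg : smooth_fun V (bil_app g Y Z) by case: hg => sg _ _; apply: sg.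
have iz := img_cmap (chart_at y) Vz yz.
rewrite (lie_funE X (@compatible_chart_at _ _ y) yz oV Vz (sg y)).
apply: eq_bigr => k _; congr (_ * _).
by apply: (derive_eq_on _ oI _ iz) => q iq; apply: bil_hat_on; apply: Om_sub iq.
Qed.

Lemma bil_bracket_hat V X Y Z y z : open V -> V z -> smooth_vf V X -> smooth_vf V Y ->
  cdom (chart_at y) z ->
  bil_app g (bracket X Y) Z z =
  pair (gh y (cmap (chart_at y) z))
    (bracket_hat (hatv (chart_at y) X) (hatv (chart_at y) Y) (cmap (chart_at y) z))
    (hatv (chart_at y) Z (cmap (chart_at y) z)).
Proof.
move=> oV Vz sX sY yz; rewrite (bil_hat _ _ _ (@compatible_chart_at _ _ y) yz).
by rewrite (hatv_cmap (bracket X Y) yz) (bracket_hatE oV Vz sX sY yz).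
Qed.

Let congr_koszul (a a' b b' c c' d d' e e' k k' : R) : a = a' -> b = b' -> c = c' ->
  d = d' -> e = e' -> k = k' ->
  a + b - c + d - e - k = a' + b' - c' + d' - e' - k'.
Proof. by move=> -> -> -> -> -> ->. Qed.

Lemma koszul_chart V X Y Z y z : open V -> V z -> smooth_vf V X -> smooth_vf V Y ->
  smooth_vf V Z -> cdom (chart_at y) z ->
  lie_fun X (bil_app g Y Z) z + lie_fun Y (bil_app g X Z) z
  - lie_fun Z (bil_app g X Y) z + bil_app g (bracket X Y) Z z
  - bil_app g (bracket X Z) Y z - bil_app g (bracket Y Z) X z =
  2 * pair (gh y (cmap (chart_at y) z))
    (cov_hat (gh y) (hatv (chart_at y) X) (hatv (chart_at y) Y) (cmap (chart_at y) z))
    (hatv (chart_at y) Z (cmap (chart_at y) z)).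
Proof.
move=> oV Vz sX sY sZ yz.
apply: etrans (congr_koszul (lie_bil_hat oV Vz sX sY sZ yz)
  (lie_bil_hat oV Vz sY sX sZ yz) (lie_bil_hat oV Vz sZ sX sY yz)
  (bil_bracket_hat Z oV Vz sX sY yz) (bil_bracket_hat Y oV Vz sX sZ yz)
  (bil_bracket_hat X oV Vz sY sZ yz)) _.
have iz := img_cmap (chart_at y) Vz yz; have oI := img_open (chart_at y) oV.
have sg := fun i j => Csmooth_sub (@Om_sub V y) (gh_smooth y i j).
exact: (koszul_hat oI sg (fun q iq => gh_sym (Om_sub iq)) (fun q iq => gh_pos (Om_sub iq))
  (hatv_smooth y oV sX) (hatv_smooth y oV sY) (hatv_smooth y oV sZ) iz).
Qed.

(** The left-hand side of Koszul's formula is independent of the chart, hence so is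
    the covariant derivative, computed in [chart_at z] on the left and in
    [chart_at y] on the right. *)
Lemma nabla_hat V X Y y z : open V -> V z -> smooth_vf V X -> smooth_vf V Y ->
  cdom (chart_at y) z ->
  nabla X Y z *m dmx (chart_at y) z =
  cov_hat (gh y) (hatv (chart_at y) X) (hatv (chart_at y) Y) (cmap (chart_at y) z).
Proof.
move=> oV Vz sX sY yz; have zz := chart_at_dom z.
have cy := @compatible_chart_at _ _ y.
apply: (pos_def_inj (gh_pos (Om_cmap yz))) => Z0.
pose V' := V `&` cdom (chart_at z).
have oV' : open V' by apply: openI => //; apply: cdom_open.
have sX' := smooth_vf_sub (@subIsetl _ V (cdom (chart_at z))) sX.
have sY' := smooth_vf_sub (@subIsetl _ V (cdom (chart_at z))) sY.
have n2 : (2 : R) != 0 by rewrite pnatr_eq0.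
have key l : pair (gh y (cmap (chart_at y) z)) (nabla X Y z *m dmx (chart_at y) z)
     (coord_vf z l z *m dmx (chart_at y) z) =
   pair (gh y (cmap (chart_at y) z))
     (cov_hat (gh y) (hatv (chart_at y) X) (hatv (chart_at y) Y) (cmap (chart_at y) z))
     (coord_vf z l z *m dmx (chart_at y) z).
  have sl := smooth_vf_sub (@subIsetr _ V (cdom (chart_at z))) (smooth_coord_vf z l).
  have k1 := koszul_chart oV' (conj Vz zz) sX' sY' sl yz.
  have k2 := koszul_chart oV' (conj Vz zz) sX' sY' sl zz.
  have e := mulfI n2 (etrans (esym k1) k2).
  rewrite -(hatv_cmap (nabla X Y) yz) -(hatv_cmap (coord_vf z l) yz).
  apply: etrans (esym (bil_hat g _ _ cy yz)) _; apply: etrans (esym e).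
  apply: etrans (bil_hat g _ _ (@compatible_chart_at _ _ z) zz) _.
  by rewrite (hatv_cmap (nabla X Y) zz) dmx_self mulmx1.
have -> : Z0 = \sum_l (Z0 *m tmx (chart_at y) z) 0 l *: (coord_vf z l z *m dmx (chart_at y) z).
  under eq_bigr => l _ do rewrite coord_vfE tmx_self row1 scalemxAl.
  rewrite -mulmx_suml -row_sum_delta -mulmxA tmx_dmx ?mulmx1 //.
have sr (A : E) (F : 'I_4 -> E) : pair (gh y (cmap (chart_at y) z)) A (\sum_k F k)
   = \sum_k pair (gh y (cmap (chart_at y) z)) A (F k).
  by rewrite /pair linear_sum mulmx_sumr summxE.
rewrite !sr; apply: eq_bigr => l _; rewrite !pairZr; congr (_ * _); exact: key.
Qed.

Lemma nabla_smooth V X Y : open V -> smooth_vf V X -> smooth_vf V Y ->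
  smooth_vf V (nabla X Y).
Proof.
move=> oV sX sY; apply: smooth_vf_hatv => // y.
have oI := img_open (chart_at y) oV.
have sg := fun i j => Csmooth_sub (@Om_sub V y) (gh_smooth y i j).
have s := smx_cov_hat oI sg (fun q iq => gh_pos (Om_sub iq)) (hatv_smooth y oV sX) (hatv_smooth y oV sY).
apply: (smx_eq oI _ s) => p ip; have [Vp yp pE] := img_cinv ip.
by rewrite /hatv (nabla_hat oV Vp sX sY yp) pE.
Qed.

End Connection.

Section CoordinateConnection.
Context {R : realType}.
Notation E := 'rV[R]_4.
Variables (W : set E) (g : E -> 'M[R]_4).
Hypothesis oW : open W.

Lemma cov_hat_addl (X A B Y : E -> E) q : X q = A q + B q ->
  cov_hat g X Y q = cov_hat g A Y q + cov_hat g B Y q.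
Proof.
move=> XE; have s m n (F : 'I_4 -> 'M[R]_(m, n)) : \sum_k X q 0 k *: F k =
    \sum_k A q 0 k *: F k + \sum_k B q 0 k *: F k.
  by rewrite -big_split; apply: eq_bigr => k _; rewrite XE mxE scalerDl.
by rewrite /cov_hat /along_field /along !s mulmxDr addrACA.
Qed.

Lemma cov_hat_scalel (X A Y : E -> E) a q : X q = a *: A q ->
  cov_hat g X Y q = a *: cov_hat g A Y q.
Proof.
move=> XE; have s m n (F : 'I_4 -> 'M[R]_(m, n)) : \sum_k X q 0 k *: F k =
    a *: \sum_k A q 0 k *: F k.
  by rewrite scaler_sumr; apply: eq_bigr => k _; rewrite XE mxE scalerA.
by rewrite /cov_hat /along_field /along !s -scalemxAr scalerDr.
Qed.

Lemma cov_hat_addr (X Y Z : E -> E) q : smx W Y -> smx W Z -> W q ->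
  cov_hat g X (fun x => Y x + Z x) q = cov_hat g X Y q + cov_hat g X Z q.
Proof.
move=> sY sZ Wq; rewrite /cov_hat /along_field addrACA -mulmxDl -big_split /=.
congr (_ + _); apply: eq_bigr => k _; rewrite -scalerDr; congr (_ *: _).
exact: D_add sY sZ Wq.
Qed.

Lemma cov_hat_leibniz (X Y : E -> E) f q : Csmooth W f -> smx W Y -> W q ->
  cov_hat g X (fun x => f x *: Y x) q =
  (\sum_k X q 0 k * 'D_('e_k) f q) *: Y q + f q *: cov_hat g X Y q.
Proof.
move=> sf sY Wq; rewrite /cov_hat /along_field scalerDr addrA -scalemxAl.
congr (_ + _); rewrite scaler_suml scaler_sumr -big_split /=.
apply: eq_bigr => k _; rewrite (D_scale k oW sf sY Wq).
by rewrite scalerDr !scalerA [X in X *: 'D_('e_k) Y q]mulrC.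
Qed.

Lemma cov_hat_basis (X Y : E -> E) i q : X q = 'e_i ->
  cov_hat g X Y q = 'D_('e_i) Y q + Y q *m christoffel g i q.
Proof.
move=> XE; rewrite /cov_hat /along_field /along XE.
have e m n (F : 'I_4 -> 'M[R]_(m, n)) : \sum_k ('e_i : E) 0 k *: F k = F i.
  rewrite (bigD1 i) //= big1 ?addr0 => [|k ki].
    by rewrite mxE !eqxx scale1r.
  by rewrite mxE (negbTE ki) andbF scale0r.
by rewrite !e.
Qed.

End CoordinateConnection.

Section LeviCivita.
Context {R : realType} {M : manifold4 R}.
Notation E := 'rV[R]_4.
Implicit Types (c : chart R M) (V : set M) (f : M -> R) (x y z : M) (X Y Z : M -> E).
Variable g : M -> 'M[R]_4.
Hypothesis hg : riemannian setT g.
Notation gh y := (hatb (chart_at y) g).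
Notation nabla := (nabla g).
Notation pt x := (cmap (chart_at x) x).

Lemma hatvD c X Y : hatv c (fun z => X z + Y z) = fun p => hatv c X p + hatv c Y p.
Proof. by apply/funext => p; rewrite /hatv mulmxDl. Qed.

Lemma hatvZ c f X : hatv c (fun z => f z *: X z) = fun p => hatf c f p *: hatv c X p.
Proof. by apply/funext => p; rewrite /hatv /hatf /= scalemxAl. Qed.

Lemma hatv_self X x : hatv (chart_at x) X (pt x) = X x.
Proof. by rewrite hatv_cmap ?dmx_self ?mulmx1 //; apply: chart_at_dom. Qed.

Lemma hatf_self f x : hatf (chart_at x) f (pt x) = f x.
Proof. by rewrite /hatf /= cmapK //; apply: chart_at_dom. Qed.

Lemma hatb_self B x : hatb (chart_at x) B (pt x) = B x.
Proof. by rewrite hatb_cmap ?tmx_self ?trmx1 ?mulmx1 ?mul1mx //; apply: chart_at_dom. Qed.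

Lemma hate_self B x : hate (chart_at x) B (pt x) = B x.
Proof. by rewrite hate_cmap ?tmx_self ?dmx_self ?mulmx1 ?mul1mx //; apply: chart_at_dom. Qed.

Lemma bil_self X Y x : bil_app g X Y x = pair (gh x (pt x)) (X x) (Y x).
Proof. by rewrite hatb_self. Qed.

Lemma bracket_self V X Y x : open V -> V x -> smooth_vf V X -> smooth_vf V Y ->
  bracket X Y x = bracket_hat (hatv (chart_at x) X) (hatv (chart_at x) Y) (pt x).
Proof.
move=> oV Vx sX sY; have := bracket_hatE oV Vx sX sY (chart_at_dom x).
by rewrite dmx_self mulmx1.
Qed.

Lemma nabla_levi_civita : levi_civita g nabla.
Proof.
move=> V X Y Z f oV sX sY sZ sf; split; first exact: nabla_smooth.
move=> x Vx; have xx := chart_at_dom x; have ix := img_cmap (chart_at x) Vx xx.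
have oI := img_open (chart_at x) oV; have sub := @Om_sub _ _ V x.
have iO := sub _ ix.
have hX := hatv_smooth x oV sX; have hY := hatv_smooth x oV sY.
have hZ := hatv_smooth x oV sZ; have hf := sf x.
split.
- split; rewrite /nabla.
    by apply: cov_hat_addl; rewrite hatvD.
  by apply: cov_hat_scalel; rewrite hatvZ -(hatf_self f).
- by rewrite /nabla hatvD; apply: cov_hat_addr hY hZ ix.
- rewrite /nabla hatvZ (@cov_hat_leibniz _ _ (gh x) oI _ _ (hatf (chart_at x) f) _ hf hY ix) -(hatf_self f) hatv_self.
  by rewrite (lie_funE X (@compatible_chart_at _ _ x) xx oV Vx hf) !hatv_self.
- rewrite (bracket_self oV Vx sX sY).
  have := cov_hat_torsion (@Om_open _ _ x) (gh_smooth hg x)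
    (fun q => @gh_sym _ _ _ hg x q) (hatv (chart_at x) X) (hatv (chart_at x) Y) iO.
  exact.
apply: etrans (lie_bil_hat hg oV Vx sX sY sZ xx) _.
apply: etrans (cov_hat_metric oI (fun i j => Csmooth_sub sub (gh_smooth hg x i j))
  (fun q iq => gh_sym hg (sub _ iq)) (fun q iq => gh_pos hg (sub _ iq))
  (hatv (chart_at x) X) hY hZ ix) _.
by rewrite !bil_self !hatv_self.
Qed.

Lemma nabla_coord x j k p : (cmap (chart_at x) @` cdom (chart_at x)) p ->
  hatv (chart_at x) (nabla (coord_vf x j) (coord_vf x k)) p
  = row k (christoffel (gh x) j p).
Proof.
move=> [z xz <-]; have oc := @cdom_open _ _ (chart_at x).
have iz : (cmap (chart_at x) @` cdom (chart_at x)) (cmap (chart_at x) z) by exists z.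
rewrite hatv_cmap // (nabla_hat hg oc xz (smooth_coord_vf x j) (smooth_coord_vf x k) xz).
rewrite (@cov_hat_basis _ (gh x) _ _ j) ?hatv_coord_vf // rowE.
have e0 := @derive_eq_mx R _ _ _ (hatv (chart_at x) (coord_vf x k)) (fun=> 'e_k) _ 'e_j
  (@cimg_open _ _ (chart_at x)) (fun q iq => hatv_coord_vf k iq) iz.
by rewrite (etrans e0 (D_cst _ _ _)) add0r.
Qed.

Lemma hessianE f x j k : smooth_fun setT f ->
  hessian nabla f x j k =
  'D_('e_j) ('D_('e_k) (hatf (chart_at x) f)) (pt x)
  - (christoffel (gh x) j (pt x) *m covector (hatf (chart_at x) f) (pt x)) k 0.
Proof.
move=> sf; have oc := @cdom_open _ _ (chart_at x); have xx := chart_at_dom x.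
have sf' := smooth_fun_sub (@subsetT _ (cdom (chart_at x))) sf.
have oI := img_open (chart_at x) oc; have ix := img_cmap (chart_at x) xx xx.
have sk := smooth_lie oc (smooth_coord_vf x k) sf'.
have e1 : lie_fun (coord_vf x j) (lie_fun (coord_vf x k) f) x =
    'D_('e_j) ('D_('e_k) (hatf (chart_at x) f)) (pt x).
  apply: etrans (lie_coord_vf j xx oc xx (sk x)) _.
  apply: (derive_eq_on _ oI _ ix) => q iq; have [cq _ qE] := img_cinv iq.
  by apply: etrans (lie_coord_vf k cq oc cq (sf' x)) _; rewrite qE.
have e2 : lie_fun (nabla (coord_vf x j) (coord_vf x k)) f x =
    (christoffel (gh x) j (pt x) *m covector (hatf (chart_at x) f) (pt x)) k 0.
  apply: etrans (lie_funE _ (@compatible_chart_at _ _ x) xx oc xx (sf' x)) _.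
  rewrite nabla_coord; last by exists x.
  rewrite [RHS]mxE; apply: eq_bigr => l _; congr (_ * _); first by rewrite mxE.
  by rewrite [RHS]mxE.
by rewrite [LHS]mxE; exact: (f_equal2 (fun a b => a - b) e1 e2).
Qed.

Lemma bracket_coord y i j z : cdom (chart_at y) z ->
  bracket (coord_vf y i) (coord_vf y j) z = 0.
Proof.
move=> yz; have oc := @cdom_open _ _ (chart_at y).
set p := cmap (chart_at y) z.
have ip : (cmap (chart_at y) @` cdom (chart_at y)) p by exists z.
have du := dmx_unit (@compatible_chart_at _ _ y) yz.
apply: (can_inj (mulmxK du)); rewrite mul0mx.
rewrite (bracket_hatE oc yz (smooth_coord_vf y i) (smooth_coord_vf y j) yz).
have e0 (X : E -> E) l : along_field X (hatv (chart_at y) (coord_vf y l)) p = 0.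
  rewrite /along_field big1 // => m _.
  have e0 := @derive_eq_mx R _ _ _ (hatv (chart_at y) (coord_vf y l)) (fun=> 'e_l) _ 'e_m
    (@cimg_open _ _ (chart_at y)) (fun q iq => hatv_coord_vf l iq) ip.
  by rewrite (etrans e0 (D_cst _ _ _)) scaler0.
exact: (etrans (f_equal2 (fun a b : E => a - b) (e0 (hatv (chart_at y) (coord_vf y i)) j)
  (e0 (hatv (chart_at y) (coord_vf y j)) i)) (subrr 0)).
Qed.

Lemma curvature_coord x i j k :
  curvature nabla (coord_vf x i) (coord_vf x j) (coord_vf x k) x
  = row k (curv (gh x) (pt x) i j).
Proof.
have oc := @cdom_open _ _ (chart_at x); have xx := chart_at_dom x.
have oO := @cimg_open _ _ (chart_at x).
have ix : (cmap (chart_at x) @` cdom (chart_at x)) (pt x) by exists x.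
have OE q : (cmap (chart_at x) @` cdom (chart_at x)) q -> img (chart_at x) setT q.
  by move=> [z cz <-]; exists z.
have sG a : smx (cmap (chart_at x) @` cdom (chart_at x)) (christoffel (gh x) a).
  move=> a' b'; apply: Csmooth_sub OE _.
  exact: (smx_christoffel (@Om_open _ _ x) (gh_smooth hg x)
    (fun q iq => gh_pos hg iq)).
have e a b : nabla (coord_vf x a) (nabla (coord_vf x b) (coord_vf x k)) x =
  row k ('D_('e_a) (christoffel (gh x) b) (pt x)
         + christoffel (gh x) b (pt x) *m christoffel (gh x) a (pt x)).
  rewrite /nabla (@cov_hat_basis _ (gh x) _ _ a) ?hatv_coord_vf //.
  rewrite (nabla_coord b k ix) rowD -row_mul; congr (_ + _).
  apply: etrans (derive_eq_mx _ oO (fun q iq => nabla_coord b k iq) ix) _.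
  exact: derive_row (sG b) ix.
have e0 : nabla (bracket (coord_vf x i) (coord_vf x j)) (coord_vf x k) x = 0.
  rewrite /nabla; apply: etrans (@cov_hat_scalel _ (gh x) _ (fun=> 0) _ 0 _ _) (scale0r _).
  by rewrite hatv_self (bracket_coord i j xx) scaler0.
apply: etrans (f_equal2 (fun a b : E => a - b)
  (f_equal2 (fun a b : E => a - b) (e i j) (e j i)) e0) _.
rewrite subr0 /curv /curv_of -rowN -rowD.
by rewrite opprD addrACA addrA.
Qed.

Lemma ricciE x : ricci nabla x = ric (curv (gh x) (pt x)).
Proof.
apply/matrixP => j k; rewrite [LHS]mxE [RHS]mxE; apply: eq_bigr => i _.
by rewrite curvature_coord [LHS]mxE.
Qed.

End LeviCivita.

(** * From the structures on the manifold to their coordinate form *)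

Section OppositeAlgebra.
Context {R : realFieldType}.
Variables (g J D I : 'M[R]_4).
Hypothesis gpos : pos_def g.
Hypothesis J2 : J *m J = - 1%:M.
Hypothesis JgJ : J *m g *m J^T = g.
Hypothesis rankD : \rank D = 2%N.
Hypothesis DJ : (D *m J <= D)%MS.
Hypothesis ID : forall v : 'rV[R]_4, (v <= D)%MS -> v *m I = v *m J.
Hypothesis IP : forall v : 'rV[R]_4,
  (forall w : 'rV[R]_4, (w <= D)%MS -> pair g v w = 0) -> v *m I = - (v *m J).

Let split_orth (v : 'rV[R]_4) : exists a b : 'rV[R]_4,
  [/\ v = a + b, (a <= D)%MS & forall w : 'rV[R]_4, (w <= D)%MS -> pair g b w = 0].
Proof.
pose P := kermx (g *m D^T).
have PE (b : 'rV[R]_4) : (b <= P)%MS -> forall w : 'rV[R]_4, (w <= D)%MS -> pair g b w = 0.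
  move=> /sub_kermxP bP w /submxP[c ->].
  by rewrite /pair trmx_mul -mulmxA (mulmxA g) mulmxA bP mul0mx mxE.
have rP : \rank P = 2%N.
  rewrite mxrank_ker -mxrank_tr trmx_mul trmxK mxrankMfree ?rankD //.
  by rewrite row_free_unit unitmx_tr pos_def_unit.
have cap : (D :&: P)%MS = 0.
  apply/row_matrixP => i; rewrite row0; set r := row i _.
  have : (r <= D :&: P)%MS by rewrite row_sub.
  rewrite sub_capmx => /andP[rD rP']; apply: pos_def_eq0 gpos _.
  exact: PE rP' r rD.
have full : (v <= D + P)%MS.
  apply: submx_full; rewrite /row_full.
  by have := mxrank_sum_cap D P; rewrite cap mxrank0 addn0 rankD rP => ->.
have /sub_addsmxP[[a b] /= vE] := full.
exists (a *m D), (b *m P); split => //; first exact: submxMl.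
by apply: PE; apply: submxMl.
Qed.

(** The splitting [v = a + b] along [D] and its orthogonal complement gives
    [v I - v J = - 2 b J]. *)
Lemma opposite_mem (v : 'rV[R]_4) : v *m I = v *m J <-> (v <= D)%MS.
Proof.
split; last exact: ID.
have [a [b [-> aD bP]]] := split_orth v; rewrite !mulmxDl (ID aD) (IP bP).
move=> /addrI/eqP; rewrite -subr_eq0 -opprD oppr_eq0 -mulr2n -scaler_nat scaler_eq0.
rewrite pnatr_eq0 /= => /eqP bJ0.
have : b *m J *m J = 0 by rewrite bJ0 mul0mx.
by rewrite -mulmxA J2 mulmxN mulmx1 => /eqP; rewrite oppr_eq0 => /eqP ->; rewrite addr0.
Qed.

Lemma opposite_comm : I *m J = J *m I.
Proof.
apply/row_matrixP => i; rewrite !rowE.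
have [a [b [-> aD bP]]] := split_orth (delta_mx 0 i).
rewrite !mulmxDl !mulmxA (ID aD) (IP bP).
have aJ : (a *m J <= D)%MS by apply: submx_trans DJ; apply: submxMr.
have bJ (w : 'rV[R]_4) : (w <= D)%MS -> pair g (b *m J) w = 0.
  move=> wD; have wJ : (w *m J <= D)%MS by apply: submx_trans DJ; apply: submxMr.
  by rewrite (pairI J2 JgJ) bP ?oppr0.
by rewrite (ID aJ) (IP bJ) mulNmx.
Qed.

Lemma opposite_rank : \rank (kermx (I - J)%R) = 2%N.
Proof.
apply: etrans _ rankD; apply: eqmx_rank; apply/andP; split; apply/rV_subP => v vI.
  apply/opposite_mem/eqP; rewrite -subr_eq0 -mulmxBr; apply/eqP.
  exact/sub_kermxP.
by apply/sub_kermxP; rewrite mulmxBr (ID vI) subrr.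
Qed.

End OppositeAlgebra.

(** [K] is the Jacobian matrix of a change of coordinates, whose derivatives are
    symmetric by Schwarz's theorem. *)
Section IntegrabilityInCoordinates.
Context {R : realType}.
Notation E := 'rV[R]_4.
Variables (W : set E) (K : E -> 'M[R]_4).
Hypothesis oW : open W.
Hypothesis sK : smx W K.
Hypothesis uK : forall p, W p -> K p \in unitmx.
Hypothesis torK : forall p, W p -> torsion_free (fun k => 'D_('e_k) K p).

(** The matrices [C k] are the Christoffel matrices of the flat connection of the
    new coordinates, in which [J] is constant. *)
Lemma integrable_endo (J : E -> 'M[R]_4) (S : 'M[R]_4) q : smx W J -> W q ->
  (forall p, W p -> J p *m K p = K p *m S) ->
  exists C, torsion_free C /\ forall k, 'D_('e_k) J q = C k *m J q - J q *m C k.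
Proof.
move=> sJ Wq JK; exists (fun k => 'D_('e_k) K q *m invmx (K q)); split.
  by move=> i k; rewrite !row_mul torK.
move=> k; have uq := uK Wq.
have e : 'D_('e_k) J q *m K q + J q *m 'D_('e_k) K q = 'D_('e_k) K q *m S.
  apply: etrans (esym (D_mul k oW sJ sK Wq)) _.
  apply: etrans (derive_eq_mx 'e_k oW JK Wq) _.
  apply: etrans (D_mul k oW sK (smx_cst W S) Wq) _.
  by rewrite (D_cst S q k) mulmx0 addr0.
have := JK q Wq.
move: ('D_('e_k) J q) ('D_('e_k) K q) (J q) (K q) uq e => dJ dK j m um e jm.
have SE : S = invmx m *m j *m m by rewrite -mulmxA jm mulmxA mulVmx // mul1mx.
apply: (can_inj (mulmxK um)); rewrite mulmxBl -!mulmxA mulVmx // mulmx1.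
by rewrite -[LHS](addrK (j *m dK)) e SE !mulmxA.
Qed.

(** [A] factors as [K P G], so on its kernel at [q] only the derivative of [K]
    contributes to that of [A], and this one is symmetric. *)
Lemma integrable_involutive (A : E -> 'M[R]_4) (P : 'M[R]_4) q (Y Z : 'rV[R]_4) :
  smx W A -> W q -> P *m P = P ->
  (forall p, W p -> forall v : 'rV[R]_4, v *m A p = 0 <-> v *m K p *m P = 0) ->
  Y *m A q = 0 -> Z *m A q = 0 -> let T k := 'D_('e_k) A q in
  Z *m along T Y = Y *m along T Z.
Proof.
move=> sA Wq PP AK YA ZA T.
pose G p := invmx (K p) *m A p.
have sG : smx W G by apply: smx_mul => //; apply: smx_inv.
have AE p : W p -> A p = K p *m P *m G p.
  move=> Wp; have up := uK Wp; rewrite /G.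
  have : (1%:M - P) *m invmx (K p) *m A p = 0.
    apply/row_matrixP => i; rewrite row0 row_mul; apply/AK => //.
    by rewrite -row_mul -row_mul mulmxKV // mulmxBl mul1mx PP subrr row0.
  rewrite mulmxBl mul1mx mulmxBl => /eqP; rewrite subr_eq0 => /eqP e.
  by rewrite -mulmxA [P *m (_ *m _)]mulmxA -e mulmxA mulmxV // mul1mx.
have sKP : smx W (fun p => K p *m P) by apply: smx_mul => //; apply: smx_cst.
have TE k : T k = 'D_('e_k) K q *m P *m G q + K q *m P *m 'D_('e_k) G q.
  rewrite /T; apply: etrans (derive_eq_mx 'e_k oW AE Wq) _.
  apply: etrans (D_mul k oW sKP sG Wq) _.
  congr (_ *m _ + _); apply: etrans (D_mul k oW sK (smx_cst W P) Wq) _.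
  by rewrite (D_cst P q k) mulmx0 addr0.
have vT (v w : 'rV[R]_4) : v *m A q = 0 -> v *m along T w =
   v *m along (fun k => 'D_('e_k) K q) w *m (P *m G q).
  move=> /(AK q Wq) v0; rewrite /along !mulmx_sumr mulmx_suml; apply: eq_bigr => k _.
  rewrite TE -!scalemxAr -scalemxAl mulmxDr !mulmxA v0 mul0mx addr0.
  by rewrite -!mulmxA.
rewrite (vT Z Y ZA) (vT Y Z YA); congr (_ *m _).
exact: torsion_freeP (torK Wq).
Qed.

End IntegrabilityInCoordinates.

Section Jacobian.
Context {R : realType} {M : manifold4 R}.
Notation E := 'rV[R]_4.
Implicit Types (c : chart R M) (x y z : M).

Definition jac y c (p : E) : 'M[R]_4 :=
  \matrix_(i, j) 'D_('e_i) (hatf (chart_at y) (coord c j)) p.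

Lemma dmx_jac y c z : compatible_chart c -> cdom (chart_at y) z -> cdom c z ->
  dmx c z = dmx (chart_at y) z *m jac y c (cmap (chart_at y) z).
Proof.
move=> cc yz cz; apply/row_matrixP => i; rewrite [in RHS]row_mul [row i (dmx c z)]rowE -(chart_diffE _ cc cz).
apply/rowP => j; rewrite [LHS]mxE.
have s := transition_smooth j (cc y).2.
apply: etrans (tangent_derivE _ (@compatible_chart_at _ _ y) yz (img_open _ (@cdom_open _ _ c))
  (img_cmap _ cz yz) s) _.
rewrite -rowE [LHS]mxE [RHS]mxE; apply: eq_bigr => k _.
by rewrite [covector _ _ _ _]mxE [jac _ _ _ _ _]mxE.
Qed.

Lemma tmx_dmx_jac y c z : compatible_chart c -> cdom (chart_at y) z -> cdom c z ->
  tmx (chart_at y) z *m dmx c z = jac y c (cmap (chart_at y) z).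
Proof.
by move=> cc yz cz; rewrite (dmx_jac cc yz cz) mulmxA (tmx_dmx (@compatible_chart_at _ _ y) yz) mul1mx.
Qed.

Lemma jac_unit y c p : compatible_chart c -> img (chart_at y) (cdom c) p ->
  jac y c p \in unitmx.
Proof.
move=> cc /img_cinv [cz yz <-]; rewrite -tmx_dmx_jac // unitmx_mul.
by rewrite (tmx_unit (@compatible_chart_at _ _ y) yz) dmx_unit.
Qed.

Lemma smx_jac y c : compatible_chart c -> smx (img (chart_at y) (cdom c)) (jac y c).
Proof.
move=> cc i j; rewrite (_ : (fun q => _) = 'D_('e_i) (hatf (chart_at y) (coord c j))).
  exact: CsmoothD_e (transition_smooth j (cc y).2).
by apply/funext => q; rewrite mxE.
Qed.

Lemma jac_torsion_free y c p : compatible_chart c -> img (chart_at y) (cdom c) p ->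
  torsion_free (fun k => 'D_('e_k) (jac y c) p).
Proof.
move=> cc ip i k; have oI := img_open (chart_at y) (@cdom_open _ _ c).
have e a b j : ('D_('e_a) (jac y c) p) b j =
   'D_('e_a) ('D_('e_b) (hatf (chart_at y) (coord c j))) p.
  apply: etrans (smx_deriveE a b j (@smx_jac y c cc) ip) _.
  by apply: eq_derive => q; rewrite mxE.
apply/rowP => j; rewrite [LHS]mxE [RHS]mxE.
apply: etrans (e k i j) _; apply: etrans _ (esym (e i k j)).
exact: Csmooth_schwarz oI (transition_smooth j (cc y).2) ip.
Qed.

Lemma integrable_hat y (J : M -> 'M[R]_4) p :
  integrable_complex setT J -> smooth_endo setT J -> img (chart_at y) setT p ->
  exists C, torsion_free C /\
    forall k, 'D_('e_k) (hate (chart_at y) J) p =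
      C k *m hate (chart_at y) J p - hate (chart_at y) J p *m C k.
Proof.
move=> iJ sJ ip; have [_ yz pE] := img_cinv ip.
have [c [cc cz cJ]] := iJ (cinv (chart_at y) p) I.
have oI := img_open (chart_at y) (@cdom_open _ _ c).
have ipc : img (chart_at y) (cdom c) p by rewrite -pE; apply: img_cmap.
have sJ' : smx (img (chart_at y) (cdom c)) (hate (chart_at y) J).
  move=> i j; apply: Csmooth_sub (hate_smooth y openT sJ i j).
  exact: img_sub.
apply: (@integrable_endo _ _ (jac y c) oI (@smx_jac y c cc) (fun q => @jac_unit y c q cc)
  (fun q => @jac_torsion_free y c q cc) _ std_complex _ sJ' ipc) => q iq.
have [cq yq <-] := img_cinv iq; set z := cinv _ q in cq yq *.
have JS : J z *m dmx c z = dmx c z *m std_complex.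
  apply/row_matrixP => i; have := cJ z I cq (delta_mx 0 i).
  by rewrite !chart_diffE // !rowE !mulmxA.
rewrite hate_cmap // -!(tmx_dmx_jac cc yq cq) -!mulmxA -JS.
rewrite (mulmxA (dmx (chart_at y) z)) (dmx_tmx (@compatible_chart_at _ _ y) yq).
by rewrite mul1mx.
Qed.

(** The projection onto the coordinates that cut out the leaves of the distribution. *)
Definition last_two : 'M[R]_4 :=
  block_mx (0 : 'M[R]_2) (0 : 'M[R]_2) (0 : 'M[R]_2) (1%:M : 'M[R]_2).

Lemma last_two_idem : last_two *m last_two = last_two.
Proof.
apply: etrans (@mulmx_block R 2 2 2 2 2 2 0 0 0 1%:M 0 0 0 1%:M) _.
by rewrite !(mulmx0, mul0mx, mulmx1, addr0, add0r).
Qed.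

Lemma last_two_rsub (v : E) : v *m last_two = 0 <-> rsubmx (v : 'rV[R]_(2 + 2)) = 0.
Proof.
have e : v *m last_two = row_mx (0 : 'rV[R]_2) (rsubmx (v : 'rV[R]_(2 + 2))).
  rewrite -{1}(@hsubmxK _ 1 2 2 v).
  apply: etrans (@mul_row_block R 1 2 2 2 2 _ _ 0 0 0 1%:M) _.
  by rewrite !(mulmx0, mulmx1, addr0, add0r).
rewrite e; split => [|->]; last by rewrite row_mx0.
by rewrite -(@row_mx0 _ 1 2 2) => /(@eq_row_mx _ 1 2 2)[_ ->].
Qed.

End Jacobian.

Section TwoFormsInCharts.
Context {R : realType} {M : manifold4 R}.
Notation E := 'rV[R]_4.
Implicit Types (c : chart R M) (x y z : M) (g J B : M -> 'M[R]_4) (u : M -> R).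

Lemma bil_app_kahler_form g J X Y :
  bil_app (kahler_form g J) X Y = bil_app g (endo_app J X) Y.
Proof. by apply/funext => x; rewrite /bil_app /kahler_form /endo_app mulmxA. Qed.

Lemma smooth_kahler_form g J : smooth_bil setT g -> smooth_endo setT J ->
  smooth_bil setT (kahler_form g J).
Proof.
move=> sg sJ V X Y oV sV sX sY; rewrite bil_app_kahler_form.
exact: (sg _ _ _ oV (@subsetT _ _) (sJ _ _ oV (@subsetT _ _) sX) sY).
Qed.

Lemma hatb_kahler_form g J c p : compatible_chart c -> cdom c (cinv c p) ->
  hatb c (kahler_form g J) p = hate c J p *m hatb c g p.
Proof.
move=> cc cp; rewrite /hatb /hate /kahler_form -!mulmxA; congr (_ *m (_ *m _)).
by rewrite [dmx _ _ *m _]mulmxA dmx_tmx // mul1mx.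
Qed.

Lemma hatf_bil_coord B y j k :
  hatf (chart_at y) (bil_app B (coord_vf y j) (coord_vf y k))
  = fun q => hatb (chart_at y) B q j k.
Proof. by apply/funext => q; rewrite hatb_entry. Qed.

Lemma lie_bil_coord B y i j k z : smooth_bil setT B -> cdom (chart_at y) z ->
  lie_fun (coord_vf y i) (bil_app B (coord_vf y j) (coord_vf y k)) z =
  ('D_('e_i) (hatb (chart_at y) B) (cmap (chart_at y) z)) j k.
Proof.
move=> sB yz; have oc := @cdom_open _ _ (chart_at y).
have s := sB _ _ _ oc (@subsetT _ _) (smooth_coord_vf y j) (smooth_coord_vf y k).
apply: etrans (lie_coord_vf i yz oc yz (s y)) _; rewrite hatf_bil_coord.
by rewrite (smx_deriveE i j k (hatb_smooth y oc (fun V X Y oV sV => sB V X Y oV (@subsetT _ _)))) //; apply: img_cmap.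
Qed.

Lemma bil_app_coord B y j k z : cdom (chart_at y) z ->
  bil_app B (coord_vf y j) (coord_vf y k) z = hatb (chart_at y) B (cmap (chart_at y) z) j k.
Proof. by move=> yz; rewrite hatb_entry /hatf /= cmapK. Qed.

Lemma bil_app_bracket_coord B y i j k z : cdom (chart_at y) z ->
  bil_app B (bracket (coord_vf y i) (coord_vf y j)) (coord_vf y k) z = 0.
Proof. by move=> yz; rewrite /bil_app (bracket_coord i j yz) !mul0mx mxE. Qed.

Let congr6 (a a' b b' c c' d e k : R) : a = a' -> b = b' -> c = c' ->
  d = 0 -> e = 0 -> k = 0 -> a - b + c - d + e - k = a' - b' + c'.
Proof. by move=> -> -> -> -> -> ->; rewrite !subr0 addr0. Qed.

(** Coordinate fields commute, which removes the bracket terms. *)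
Lemma ext_d2_coord B y i j k z : smooth_bil setT B -> cdom (chart_at y) z ->
  let T l := 'D_('e_l) (hatb (chart_at y) B) (cmap (chart_at y) z) in
  ext_d2 B (coord_vf y i) (coord_vf y j) (coord_vf y k) z = T i j k - T j i k + T k i j.
Proof.
move=> sB yz T; apply: congr6.
- exact: lie_bil_coord.
- exact: lie_bil_coord.
- exact: lie_bil_coord.
- exact: bil_app_bracket_coord.
- exact: bil_app_bracket_coord.
exact: bil_app_bracket_coord.
Qed.

Lemma form_differential_coord u y i z : smooth_fun setT u -> cdom (chart_at y) z ->
  form_app (differential u) (coord_vf y i) z
  = 'D_('e_i) (hatf (chart_at y) u) (cmap (chart_at y) z).
Proof.
move=> su yz; have oc := @cdom_open _ _ (chart_at y).
have su' := smooth_fun_sub (@subsetT _ (cdom (chart_at y))) su.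
apply: etrans _ (lie_coord_vf i yz oc yz (su' y)).
have oz := @cdom_open _ _ (chart_at z); have zz := chart_at_dom z.
have suz := smooth_fun_sub (@subsetT _ (cdom (chart_at z))) su.
apply: esym; apply: etrans (tangent_derivE _ (@compatible_chart_at _ _ z) zz
  (img_open _ oz) (img_cmap _ zz zz) (suz z)) _.
by rewrite dmx_self mulmx1.
Qed.

End TwoFormsInCharts.

Section LocalGeometryOfHats.
Context {R : realType} {M : manifold4 R}.
Notation E := 'rV[R]_4.
Variables (g J D I : M -> 'M[R]_4) (u : M -> R).
Hypothesis hJ : kahler setT g J.
Hypothesis hD : rank2_distribution setT D.
Hypothesis hDJ : invariant_distribution setT J D.
Hypothesis hDint : integrable_distribution setT D.
Hypothesis hIdef : opposite_structure setT g J D I.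
Hypothesis hI : hermitian_structure setT g I.
Hypothesis hlee : lee_form setT g I (differential u).
Hypothesis hu : smooth_fun setT u.

Notation hg := (let: And4 h _ _ _ := hI in h).
Notation gh y := (hatb (chart_at y) g).
Notation Jh y := (hate (chart_at y) J).
Notation Ih y := (hate (chart_at y) I).
Notation uh y := (hatf (chart_at y) u).
Notation Om y := (img (chart_at y) setT).

Let gs x : (g x)^T = g x. Proof. by case: hg => _ h _; apply: h. Qed.
Let gp x : pos_def (g x). Proof. exact: g_pos hg x. Qed.
Let J2 x : J x *m J x = - 1%:M. Proof. by case: hJ => -[_ [_ h] _ _] _; apply: h. Qed.
Let JgJ x : J x *m g x *m (J x)^T = g x. Proof. by case: hJ => -[_ _ h _] _; apply: h. Qed.
Let I2 x : I x *m I x = - 1%:M. Proof. by case: hI => _ [_ h] _ _; apply: h. Qed.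
Let IgI x : I x *m g x *m (I x)^T = g x. Proof. by case: hI => _ _ h _; apply: h. Qed.
Let sJ : smooth_endo setT J. Proof. by case: hJ => -[_ [h _] _ _] _. Qed.
Let sI : smooth_endo setT I. Proof. by case: hI => _ [h _] _ _. Qed.
Let iJ : integrable_complex setT J. Proof. by case: hJ => -[_ _ _ h] _. Qed.
Let iI : integrable_complex setT I. Proof. by case: hI. Qed.
Let sg : smooth_bil setT g. Proof. by case: hg. Qed.

Lemma mem_distribution x (v : E) : v *m I x = v *m J x <-> (v <= D x)%MS.
Proof.
apply: (opposite_mem (gp x) (J2 x) (proj1 hD x Logic.I)) => w hw.
  exact: (hIdef Logic.I w).1.
exact: (hIdef Logic.I w).2.
Qed.

Let IJ x : I x *m J x = J x *m I x.
Proof.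
apply: (opposite_comm (gp x) (J2 x) (JgJ x) (proj1 hD x Logic.I) (hDJ Logic.I)) => w hw.
  exact: (hIdef Logic.I w).1.
exact: (hIdef Logic.I w).2.
Qed.

Let rankIJ x : \rank (kermx (I x - J x)%R) = 2%N.
Proof.
apply: (opposite_rank (gp x) (J2 x) (proj1 hD x Logic.I)) => w hw.
  exact: (hIdef Logic.I w).1.
exact: (hIdef Logic.I w).2.
Qed.

Section OneChart.
Variable y : M.
Notation c := (chart_at y).
Notation z p := (cinv c p).
Let cc : compatible_chart c := @compatible_chart_at _ _ y.

Lemma hate_mul (A B : M -> 'M[R]_4) p : cdom c (z p) ->
  hate c A p *m hate c B p = tmx c (z p) *m (A (z p) *m B (z p)) *m dmx c (z p).
Proof.
move=> cz; rewrite /hate -!mulmxA; congr (_ *m (_ *m _)).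
by rewrite [dmx _ _ *m _]mulmxA dmx_tmx // mul1mx.
Qed.

Lemma hate_square (A : M -> 'M[R]_4) p : cdom c (z p) ->
  A (z p) *m A (z p) = - 1%:M -> hate c A p *m hate c A p = - 1%:M.
Proof.
by move=> cz e; rewrite hate_mul // e mulmxN mulmx1 mulNmx tmx_dmx.
Qed.

Lemma hate_orthogonal (A : M -> 'M[R]_4) p : cdom c (z p) ->
  A (z p) *m g (z p) *m (A (z p))^T = g (z p) ->
  hate c A p *m gh y p *m (hate c A p)^T = gh y p.
Proof.
move=> cz e; rewrite -(hatb_kahler_form _ _ cc cz) /hatb /hate /kahler_form !trmx_mul.
have dt : (tmx c (z p))^T *m (dmx c (z p))^T = 1%:M by rewrite -trmx_mul dmx_tmx // trmx1.
rewrite -!mulmxA [(tmx _ _)^T *m (_ *m _)]mulmxA dt mul1mx !mulmxA.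
by rewrite -(mulmxA (tmx _ _) (A _)) -(mulmxA (tmx _ _)) e.
Qed.

Lemma hate_diff_ker p (v : E) : cdom c (z p) ->
  v *m (Ih y p - Jh y p) = 0 <-> (v *m tmx c (z p) <= D (z p))%MS.
Proof.
move=> cz; rewrite /hate -mulmxBl -mulmxBr !mulmxA.
have du := dmx_unit cc cz.
split => [e|/mem_distribution e]; last by rewrite mulmxBr e subrr mul0mx.
apply/mem_distribution/eqP; rewrite -subr_eq0 -mulmxBr.
by apply/eqP/(can_inj (mulmxK du)); rewrite mul0mx.
Qed.

Lemma hate_involutive p (Y Z : E) : Om y p ->
  Y *m Ih y p = Y *m Jh y p -> Z *m Ih y p = Z *m Jh y p ->
  let T k := 'D_('e_k) (fun x => Ih y x - Jh y x) p in
  Z *m along T Y = Y *m along T Z.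
Proof.
move=> ip YE ZE T; have [_ yz pE] := img_cinv ip.
have [c' [cc' cz DE]] := hDint (x := z p) Logic.I.
have oI := img_open c (@cdom_open _ _ c').
have ipc : img c (cdom c') p by rewrite -pE; apply: img_cmap.
have sub : img c (cdom c') `<=` img c setT by apply: img_sub.
have sA : smx (img c (cdom c')) (fun x => Ih y x - Jh y x).
  apply: smx_sub => // i j; apply: (Csmooth_sub sub);
    [exact: (hate_smooth y openT sI)|exact: (hate_smooth y openT sJ)].
apply: (@integrable_involutive _ _ (jac y c') oI (@smx_jac _ _ y c' cc')
  (fun q => @jac_unit _ _ y c' q cc') (fun q => @jac_torsion_free _ _ y c' q cc')
  _ last_two _ Y Z sA ipc last_two_idem).
- move=> q iq v; have [cq yq qE] := img_cinv iq.
  apply: iff_trans (hate_diff_ker v yq) _; apply: iff_trans (DE _ Logic.I cq _) _.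
  rewrite chart_diffE // -mulmxA (tmx_dmx_jac cc' yq cq) qE.
  by apply: iff_sym; apply: last_two_rsub.
- by rewrite mulmxBr YE subrr.
by rewrite mulmxBr ZE subrr.
Qed.

Lemma smx_hat (A : M -> 'M[R]_4) : smooth_endo setT A -> smx (Om y) (hate c A).
Proof. by move=> sA; exact: (hate_smooth y openT sA). Qed.

Section OneForm.
Variable A : M -> 'M[R]_4.
Hypothesis sA : smooth_endo setT A.
Hypothesis A2 : forall x, A x *m A x = - 1%:M.
Hypothesis AgA : forall x, A x *m g x *m (A x)^T = g x.
Let F p : 'M[R]_4 := hate c A p *m gh y p.

Let smx_F : smx (Om y) F.
Proof.
exact: (smx_mul (@Om_open _ _ y) (smx_hat sA) (gh_smooth hg y)).
Qed.

Let F_skew p : Om y p -> (F p)^T = - F p.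
Proof.
move=> ip; have [_ yz _] := img_cinv ip; apply: hermitian_form_skew.
- exact: (gh_sym hg ip).
- exact: hate_square.
exact: hate_orthogonal.
Qed.

Lemma ext_d2_form p i j k : Om y p -> let T l := 'D_('e_l) F p in
  ext_d2 (kahler_form g A) (coord_vf y i) (coord_vf y j) (coord_vf y k) (z p)
  = T i j k + T j k i + T k i j.
Proof.
move=> ip T; have [_ yz pE] := img_cinv ip.
apply: etrans (ext_d2_coord i j k (smooth_kahler_form sg sA) yz) _.
have e l : 'D_('e_l) (hatb c (kahler_form g A)) (cmap c (z p)) = T l.
  rewrite pE; apply: (derive_eq_mx _ (@Om_open _ _ y) _ ip) => q iq.
  by have [_ yq _] := img_cinv iq; apply: hatb_kahler_form.
have sk l a b : T l a b = - T l b a.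
  have e1 : (T l)^T = - T l.
    apply: etrans (esym (D_tr l smx_F ip)) _.
    apply: etrans (derive_eq_mx _ (@Om_open _ _ y) F_skew ip) _.
    exact: D_opp smx_F ip.
  have e2 := congr1 (fun X : 'M[R]_4 => X b a) e1.
  by apply: etrans (etrans e2 _); rewrite mxE.
have alg (a b d a' b' d' : 'M[R]_4) : a' = a -> b' = b -> d' = d -> b i k = - b k i ->
    a' j k - b' i k + d' i j = a j k + b k i + d i j.
  by move=> -> -> -> ->; rewrite opprK.
exact: (alg _ _ _ _ _ _ (e i) (e j) (e k) (sk j i k)).
Qed.

Lemma kahler_form_entry p i j : Om y p ->
  bil_app (kahler_form g A) (coord_vf y i) (coord_vf y j) (z p) = F p i j.
Proof.
move=> ip; have [_ yz pE] := img_cinv ip.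
by rewrite (bil_app_coord _ _ _ yz) (hatb_kahler_form _ _ cc) pE.
Qed.

End OneForm.

Let congr_sum3 (a a' b b' d d' r r' s s' t t' : R) : a = a' -> b = b' -> d = d' ->
  r = r' -> s = s' -> t = t' -> a * r + b * s + d * t = a' * r' + b' * s' + d' * t'.
Proof. by move=> -> -> -> -> -> ->. Qed.

Let lee_entries (D1 D2 D3 B : 'M[R]_4) (u1 u2 u3 : R) i j k :
  D1 j k + D2 k i + D3 i j = 2 * (u1 * B j k + u2 * B k i + u3 * B i j) ->
  (D1 - (2 * u1) *: B) j k + (D2 - (2 * u2) *: B) k i + (D3 - (2 * u3) *: B) i j = 0.
Proof.
have e (X : 'M[R]_4) v a b : (X - (2 * v) *: B) a b = X a b - 2 * v * B a b.
  by rewrite [LHS]mxE; congr (_ + _); rewrite [LHS]mxE [X in - X]mxE.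
by rewrite !e => E0; transitivity (D1 j k + D2 k i + D3 i j
  - 2 * (u1 * B j k + u2 * B k i + u3 * B i j)); [ring|rewrite E0 subrr].
Qed.

Notation cv_ l := (coord_vf y l).

Lemma local_geometry_hat : local_geometry (Om y) (gh y) (Jh y) (Ih y) (uh y).
Proof.
have oc := @cdom_open _ _ c.
have cv i := smooth_coord_vf y i.
split.
- exact: Om_open.
- exact: (gh_smooth hg y).
- exact: (smx_hat sJ).
- exact: (smx_hat sI).
- exact: hu.
- by move=> q iq; exact: (gh_sym hg iq).
- by move=> q iq; exact: (gh_pos hg iq).
- by move=> q /img_cinv [_ yz _]; apply: hate_square.
- by move=> q /img_cinv [_ yz _]; apply: hate_orthogonal.
- by move=> q /img_cinv [_ yz _]; apply: hate_square.
- by move=> q /img_cinv [_ yz _]; apply: hate_orthogonal.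
- by move=> q /img_cinv [_ yz _]; rewrite !hate_mul // IJ.
- move=> q /img_cinv [_ yz _]; rewrite /hate -mulmxBl -mulmxBr mxrank_ker.
  have tf : row_free (dmx c (z q)) by rewrite row_free_unit dmx_unit.
  have tt : row_full (tmx c (z q)) by rewrite row_full_unit tmx_unit.
  by rewrite mxrankMfree // (eqmxMfull _ tt) -mxrank_ker rankIJ.
- by move=> q iq; exact: (integrable_hat iJ sJ iq).
- by move=> q iq; exact: (integrable_hat iI sI iq).
- move=> q iq i j k T; have [_ yz _] := img_cinv iq.
  apply: etrans (esym (ext_d2_form sJ J2 JgJ i j k iq)) _.
  by case: hJ => _ cl; exact: (cl _ _ _ _ oc (@subsetT _ _) (cv i) (cv j) (cv k) _ yz).
- move=> q iq i j k T; have [_ yz qE] := img_cinv iq.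
  have th l : form_app (differential u) (cv_ l) (z q) = 'D_('e_l) (uh y) q.
    exact: etrans (form_differential_coord l hu yz) (congr1 (fun p => 'D_('e_l) (uh y) p) qE).
  have w : wedge12 (differential u) (kahler_form g I) (cv_ i) (cv_ j) (cv_ k) (z q) =
     'D_('e_i) (uh y) q * (Ih y q *m gh y q) j k + 'D_('e_j) (uh y) q * (Ih y q *m gh y q) k i
     + 'D_('e_k) (uh y) q * (Ih y q *m gh y q) i j.
    by apply: congr_sum3; rewrite ?kahler_form_entry.
  have := hlee.2 _ _ _ _ oc (@subsetT _ _) (cv i) (cv j) (cv k) _ yz.
  rewrite w => /(etrans (esym (ext_d2_form sI I2 IgI i j k iq))) e.
  exact: lee_entries e.
move=> q iq Y Z; exact: hate_involutive.
Qed.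

End OneChart.

End LocalGeometryOfHats.

(** * Calabi type and the special Kähler-Ricci potential *)

Section Restriction.
Context {R : realType} {M : manifold4 R}.
Implicit Types (U : set M) (g J : M -> 'M[R]_4).

Lemma hermitian_restrict U g J :
  hermitian_structure setT g J -> hermitian_structure U g J.
Proof.
move=> [[sg gs gp] [sJ J2] JgJ iJ]; split.
- split=> [V X Y oV _|x _|x _]; [exact: sg|exact: gs|exact: gp].
- by split=> [V X oV _|x _]; [apply: sJ|apply: J2].
- by move=> x _; apply: JgJ.
move=> x _; have [c [cc cx cJ]] := iJ x Logic.I.
by exists c; split=> // z _ cz v; apply: cJ.
Qed.

Lemma kahler_restrict U g J : kahler setT g J -> kahler U g J.
Proof.
move=> [hJ cl]; split; first exact: hermitian_restrict.
by move=> V X Y Z oV _; apply: cl.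
Qed.

Lemma conformally_kahler_restrict U g J :
  conformally_kahler setT g J -> conformally_kahler U g J.
Proof.
move=> [phi [sphi phi0 hphi]]; exists phi; split.
- exact: smooth_fun_sub sphi.
- by move=> x _; apply: phi0.
exact: kahler_restrict.
Qed.

Lemma killing_restrict U g X : killing setT g X -> killing U g X.
Proof.
move=> [sX kX]; split; first exact: smooth_vf_sub sX.
by move=> V Y Z oV _; apply: kX.
Qed.

Lemma holomorphic_restrict U J X : holomorphic_vf setT J X -> holomorphic_vf U J X.
Proof.
move=> [sX hX]; split; first exact: smooth_vf_sub sX.
by move=> V Y oV _; apply: hX.
Qed.

End Restriction.

Section Gradient.
Context {R : realType} {M : manifold4 R}.
Notation E := 'rV[R]_4.
Variables (g : M -> 'M[R]_4) (f : M -> R).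
Hypothesis hg : riemannian setT g.
Hypothesis sf : smooth_fun setT f.

Lemma differential_chart y z : cdom (chart_at y) z ->
  differential f z = dmx (chart_at y) z *m covector (hatf (chart_at y) f) (cmap (chart_at y) z).
Proof.
move=> yz; apply/colP => i; rewrite [LHS]mxE.
apply: etrans (tangent_derivE _ (@compatible_chart_at _ _ y) yz (@Om_open _ _ y)
  (Om_cmap yz) (sf y)) _.
by rewrite -mulmxA -rowE mxE.
Qed.

Lemma hatv_gradient y p : img (chart_at y) setT p ->
  hatv (chart_at y) (gradient g f) p
  = grad (hatb (chart_at y) g) (hatf (chart_at y) f) p.
Proof.
move=> ip; have [_ yz pE] := img_cinv ip; set z := cinv _ p in yz pE *.
have gu := pos_def_unit (gh_pos hg ip).
apply: (can_inj (mulmxK gu)); rewrite /grad mulmxKV //.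
rewrite /hatv /gradient /hatb -/z (differential_chart yz) trmx_mul pE.
have td : tmx (chart_at y) z *m dmx (chart_at y) z = 1%:M.
  exact: (tmx_dmx (@compatible_chart_at _ _ y) yz).
have dt : dmx (chart_at y) z *m tmx (chart_at y) z = 1%:M.
  exact: (dmx_tmx (@compatible_chart_at _ _ y) yz).
have ug := pos_def_unit (g_pos hg z).
rewrite -!mulmxA [dmx _ _ *m (tmx _ _ *m _)]mulmxA dt mul1mx.
by rewrite [invmx _ *m (_ *m _)]mulmxA mulVmx // mul1mx -trmx_mul td trmx1 mulmx1.
Qed.

Lemma hessian_hessmx x J I u :
  local_geometry (img (chart_at x) setT) (hatb (chart_at x) g) J I u ->
  hessian (nabla g) f x *m invmx (g x)
  = hessmx (hatb (chart_at x) g) (hatf (chart_at x) f) (cmap (chart_at x) x).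
Proof.
move=> LG; have ix := Om_cmap (chart_at_dom x).
have ug := pos_def_unit (g_pos hg x).
apply: (can_inj (mulmxK ug)); rewrite mulmxKV //.
apply/matrixP => i j; rewrite (hessianE hg x i j sf).
apply: esym; rewrite -[g x](hatb_self g x).
exact: (hessmx_form LG i j (sf x) ix).
Qed.

End Gradient.

Lemma bracket_hat_eql {R : realType} (W : set 'rV[R]_4) (X X' Y : 'rV[R]_4 -> 'rV[R]_4) q :
  open W -> W q -> (forall p, W p -> X p = X' p) -> bracket_hat X Y q = bracket_hat X' Y q.
Proof.
move=> oW Wq XX; have e1 : along_field X Y q = along_field X' Y q.
  by apply: eq_bigr => k _; exact: (congr1 (fun v : 'rV[R]_4 => v 0 k *: 'D_('e_k) Y q) (XX q Wq)).
have e2 : along_field Y X q = along_field Y X' q.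
  by apply: eq_bigr => k _; exact: (congr1 (fun v : 'rV[R]_4 => Y q 0 k *: v)
    (derive_eq_mx 'e_k oW XX Wq)).
exact: (f_equal2 (fun a b : 'rV[R]_4 => a - b) e1 e2).
Qed.

Lemma bracket_hat_eqr {R : realType} (W : set 'rV[R]_4) (X Y Y' : 'rV[R]_4 -> 'rV[R]_4) q :
  open W -> W q -> (forall p, W p -> Y p = Y' p) -> bracket_hat X Y q = bracket_hat X Y' q.
Proof.
move=> oW Wq YY; have e1 : along_field X Y q = along_field X Y' q.
  by apply: eq_bigr => k _; exact: (congr1 (fun v : 'rV[R]_4 => X q 0 k *: v)
    (derive_eq_mx 'e_k oW YY Wq)).
have e2 : along_field Y X q = along_field Y' X q.
  by apply: eq_bigr => k _; exact: (congr1 (fun v : 'rV[R]_4 => v 0 k *: 'D_('e_k) X q) (YY q Wq)).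
exact: (f_equal2 (fun a b : 'rV[R]_4 => a - b) e1 e2).
Qed.

Section CalabiType.
Context {R : realType} {M : manifold4 R}.
Notation E := 'rV[R]_4.
Variables (g J D I : M -> 'M[R]_4) (u : M -> R).
Hypothesis hJ : kahler setT g J.
Hypothesis hD : rank2_distribution setT D.
Hypothesis hDJ : invariant_distribution setT J D.
Hypothesis hDint : integrable_distribution setT D.
Hypothesis hIdef : opposite_structure setT g J D I.
Hypothesis hI : hermitian_structure setT g I.
Hypothesis hlee : lee_form setT g I (differential u).
Hypothesis hu : smooth_fun setT u.

Notation hg := (let: And4 h _ _ _ := hI in h).
Notation sJ := (let: conj (And4 _ (conj h _) _ _) _ := hJ in h).
Notation gh y := (hatb (chart_at y) g).
Notation Jh y := (hate (chart_at y) J).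
Notation Ih y := (hate (chart_at y) I).
Notation uh y := (hatf (chart_at y) u).
Notation Om y := (img (chart_at y) setT).
Notation pt x := (cmap (chart_at x) x).
Notation tau := (fun x => expR (u x)).

Let LG y : local_geometry (Om y) (gh y) (Jh y) (Ih y) (uh y) :=
  local_geometry_hat hJ hD hDJ hDint hIdef hI hlee hu y.

Let LGV V y : open V ->
  local_geometry (img (chart_at y) V) (gh y) (Jh y) (Ih y) (uh y).
Proof.
by move=> oV; apply: local_geometry_sub (img_open _ oV) (@Om_sub _ _ V y) (LG y).
Qed.

Lemma smooth_exp_potential : smooth_fun setT tau.
Proof. by move=> y; apply: (Csmooth_exp (@Om_open _ _ y) (hu y)). Qed.

Let X := endo_app J (gradient g tau).

Lemma hatv_killing_field y p : Om y p ->
  hatv (chart_at y) X p = killing_field (gh y) (Jh y) (uh y) p.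
Proof.
move=> ip; have [_ yz _] := img_cinv ip.
rewrite (hatv_endo J _ (@compatible_chart_at _ _ y) yz).
by rewrite (hatv_gradient hg smooth_exp_potential ip).
Qed.

Lemma smooth_gradient_rotation : smooth_vf setT X.
Proof.
apply: smooth_vf_hatv openT _ => y.
exact: (smx_eq (@Om_open _ _ y) (fun p ip => esym (hatv_killing_field ip))
  (smx_killing_field (LG y))).
Qed.

Let sX V : smooth_vf V X.
Proof. exact: smooth_vf_sub (@subsetT _ V) smooth_gradient_rotation. Qed.

Lemma killing_gradient_rotation : killing setT g X.
Proof.
split; first exact: smooth_gradient_rotation.
move=> V Y Z oV _ sY sZ x Vx; have xx := chart_at_dom x.
have oI := img_open (chart_at x) oV; have ix := img_cmap (chart_at x) Vx xx.
have hX p : img (chart_at x) V p -> hatv (chart_at x) X p =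
    killing_field (gh x) (Jh x) (uh x) p.
  by move=> ip; apply: hatv_killing_field; apply: Om_sub ip.
pose k := killing_field (gh x) (Jh x) (uh x).
have e1 : lie_fun X (bil_app g Y Z) x = \sum_i k (pt x) 0 i *
    'D_('e_i) (fun q => pair (gh x q) (hatv (chart_at x) Y q) (hatv (chart_at x) Z q)) (pt x).
  apply: etrans (lie_bil_hat hg oV Vx (sX V) sY sZ xx) _.
  by apply: eq_bigr => i _; congr (_ * _); rewrite hX.
have b A : smooth_vf V A -> bracket X A x = bracket_hat k (hatv (chart_at x) A) (pt x).
  move=> sA; rewrite (bracket_self oV Vx (sX V) sA).
  exact: bracket_hat_eql oI ix hX.
have e2 : bil_app g (bracket X Y) Z x = pair (gh x (pt x))
    (bracket_hat k (hatv (chart_at x) Y) (pt x)) (hatv (chart_at x) Z (pt x)).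
  by rewrite bil_self (b Y sY) hatv_self.
have e3 : bil_app g Y (bracket X Z) x = pair (gh x (pt x))
    (hatv (chart_at x) Y (pt x)) (bracket_hat k (hatv (chart_at x) Z) (pt x)).
  by rewrite bil_self (b Z sZ) hatv_self.
apply: etrans (f_equal2 (fun a b : R => a - b)
  (f_equal2 (fun a b : R => a - b) e1 e2) e3) _.
exact: (killing_tau (LGV x oV) (hatv_smooth x oV sY) (hatv_smooth x oV sZ) ix).
Qed.

Lemma holomorphic_gradient_rotation : holomorphic_vf setT J X.
Proof.
split; first exact: smooth_gradient_rotation.
move=> V Y oV _ sY x Vx; have xx := chart_at_dom x.
have oI := img_open (chart_at x) oV; have ix := img_cmap (chart_at x) Vx xx.
have hX p : img (chart_at x) V p -> hatv (chart_at x) X p =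
    killing_field (gh x) (Jh x) (uh x) p.
  by move=> ip; apply: hatv_killing_field; apply: Om_sub ip.
have sJY : smooth_vf V (endo_app J Y) by apply: sJ oV (@subsetT _ V) sY.
have hJY p : img (chart_at x) V p -> hatv (chart_at x) (endo_app J Y) p =
    hatv (chart_at x) Y p *m Jh x p.
  by move=> /img_cinv [_ xz _]; rewrite (hatv_endo J _ (@compatible_chart_at _ _ x) xz).
apply: etrans (bracket_self oV Vx (sX V) sJY) _.
apply: etrans (bracket_hat_eql _ oI ix hX) _.
apply: etrans (bracket_hat_eqr _ oI ix hJY) _.
apply: etrans (holomorphic_tau (LGV x oV) (hatv_smooth x oV sY) ix) _.
have e := etrans (bracket_self oV Vx (sX V) sY) (bracket_hat_eql _ oI ix hX).
exact: (f_equal2 (fun (a : E) (b : 'M[R]_4) => a *m b) (esym e) (hate_self J x)).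
Qed.

Lemma gradient_tau x : gradient g tau x = expR (u x) *: grad (gh x) (uh x) (pt x).
Proof.
have ix := Om_cmap (chart_at_dom x).
rewrite -(hatv_self (gradient g tau)) (hatv_gradient hg smooth_exp_potential ix).
apply: etrans (grad_tau (LG x) ix) _.
by congr (expR _ *: _); exact: hatf_self.
Qed.

Let J2 x : J x *m J x = - 1%:M. Proof. by case: hJ => -[_ [_ h] _ _] _; apply: h. Qed.
Let IJ x : I x *m J x = J x *m I x.
Proof.
have ix := Om_cmap (chart_at_dom x); have := lg_IJ (LG x) ix.
by rewrite !hate_self.
Qed.

Let XJ x : X x *m J x = - gradient g tau x.
Proof. by rewrite /X /endo_app -mulmxA J2 mulmxN mulmx1. Qed.

Lemma gradient_inD x : gradient g tau x *m I x = gradient g tau x *m J x.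
Proof.
have ix := Om_cmap (chart_at_dom x); have := xi_inD (LG x) ix.
by rewrite !hate_self gradient_tau -!scalemxAl => ->.
Qed.

Lemma orth_gradient_inP x (v : E) : differential u x != 0 ->
  pair (g x) v (gradient g tau x) = 0 ->
  pair (g x) v (gradient g tau x *m J x) = 0 -> v *m I x = - (v *m J x).
Proof.
move=> du0; have ix := Om_cmap (chart_at_dom x).
have n0 := grad_neq0 (LG x) ix du0.
have e0 : expR (u x) != 0 by rewrite gt_eqF // expR_gt0.
rewrite gradient_tau -scalemxAl !pairZr => /eqP; rewrite mulf_eq0 (negbTE e0) /= => /eqP v1.
move=> /eqP; rewrite mulf_eq0 (negbTE e0) /= => /eqP v2.
have := @orth_grad_inP _ _ _ _ _ _ (LG x) (pt x) v ix n0.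
by rewrite !hate_self hatb_self; apply.
Qed.

Lemma gradient_neq0 x : differential u x != 0 -> gradient g tau x != 0.
Proof.
move=> du0; have ix := Om_cmap (chart_at_dom x).
have n0 := grad_neq0 (LG x) ix du0.
rewrite gradient_tau scaler_eq0 negb_or gt_eqF ?expR_gt0 //=.
by apply: contraNneq n0 => ->; rewrite /pair mul0mx mul0mx mxE.
Qed.

Lemma differential_tau x : differential tau x = expR (u x) *: differential u x.
Proof.
have ix := Om_cmap (chart_at_dom x).
apply: etrans (covector_tau (LG x) ix) _.
by congr (expR _ *: _); exact: hatf_self.
Qed.

(** Where [du <> 0] the gradient and its rotation by [J] span [D], so the
    opposite structure that they define is [I] itself. *)
Theorem calabi_type_of_opposite : conformally_kahler setT g I ->
  calabi_type [set x | differential u x != 0] g J.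
Proof.
move=> hcK; split; first exact: kahler_restrict.
exists X, I; split.
- move=> x /= du0; apply: contraNneq (gradient_neq0 du0) => X0.
  by rewrite -[gradient g tau x]opprK -XJ X0 mul0mx oppr0.
- split; first exact: holomorphic_restrict holomorphic_gradient_rotation.
  exact: killing_restrict killing_gradient_rotation.
- move=> x /= du0 v; split=> [/sub_addsmxP[[a b] vE]|h].
    have -> : v = a *m X x + b *m (X x *m J x) := vE.
    have XI : X x *m I x = X x *m J x.
      by rewrite /X /endo_app -mulmxA -IJ mulmxA gradient_inD.
    move: (X x) XI => w wI; rewrite !mulmxDl -!mulmxA wI; congr (_ + _ *m _).
    by rewrite -IJ mulmxA wI mulmxA.
  apply: orth_gradient_inP => //; last by apply: h; rewrite addsmxSl.
  rewrite -[gradient g tau x]opprK -XJ pairNr; apply/eqP; rewrite oppr_eq0; apply/eqP.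
  by apply: h; rewrite addsmxSr.
- exact: hermitian_restrict.
exact: conformally_kahler_restrict.
Qed.

(** The Lee form vanishes. *)
Lemma kahler_of_constant_potential : (forall x y, u x = u y) -> kahler setT g I.
Proof.
move=> uc; split => //; case: hlee => _ cl V A B C oV sV sA sB sC x Vx.
have d0 z : differential u z = 0.
  apply/colP => i; rewrite [LHS]mxE [RHS]mxE /tangent_deriv.
  rewrite (_ : u \o cinv (chart_at z) = fun=> u z); first exact: derive_cst.
  by apply/funext => p; apply: uc.
rewrite (cl V A B C oV sV sA sB sC x Vx) /wedge12 /form_app d0 !mulmx0 !mxE.
by rewrite !mul0r !addr0 mulr0.
Qed.

Theorem special_kahler_ricci_of_opposite : ~ kahler setT g I ->
  special_kahler_ricci_potential g J tau.
Proof.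
move=> hnK; split => //.
- by split; [exact: smooth_exp_potential|exact: killing_gradient_rotation].
- apply: contrapT => nex; apply: hnK; apply: kahler_of_constant_potential => x y.
  apply: contrapT => /eqP uxy; apply: nex; exists x, y.
  by apply: contraNneq uxy => /expR_inj ->.
exists (nabla g); split; first exact: nabla_levi_civita hg.
move=> x dt0 v v0 v1 v2; have ix := Om_cmap (chart_at_dom x).
have du0 : differential u x != 0.
  by apply: contraNneq dt0 => d0; rewrite differential_tau d0 scaler0.
have n0 := grad_neq0 (LG x) ix du0.
have vP : v *m Ih x (pt x) = - (v *m Jh x (pt x)).
  by rewrite !hate_self; apply: orth_gradient_inP.
split; split => //.
  rewrite /endo_of_bil (hessian_hessmx hg smooth_exp_potential (LG x)).
  by have [a e] := @hess_tau_eigen _ _ _ _ _ _ (LG x) _ v ix n0 vP; exists a; exact: e.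
rewrite /endo_of_bil (ricciE hg) -[g x](hatb_self g x).
by have [a e] := @ricci_tau_eigen _ _ _ _ _ _ (LG x) _ v ix n0 v0 vP; exists a; exact: e.
Qed.

End CalabiType.

Theorem theorem3p1 (R : realType) (M : manifold4 R) (g J D I : M -> 'M[R]_4)
    (theta : M -> 'cV[R]_4) (u : M -> R)
    (hJ : kahler setT g J)
    (hD : rank2_distribution setT D)
    (hDJ : invariant_distribution setT J D)
    (hDint : integrable_distribution setT D)
    (hIdef : opposite_structure setT g J D I)
    (hI : hermitian_structure setT g I)
    (hInK : ~ kahler setT g I)
    (hIcK : conformally_kahler setT g I)
    (htheta : lee_form setT g I theta)
    (hu : smooth_fun setT u)
    (hdu : forall x : M, theta x = differential u x) :
  calabi_type [set x : M | theta x != 0] g J /\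
  exists tau : M -> R, special_kahler_ricci_potential g J tau.
Proof.
have thE : theta = differential u by apply/funext.
rewrite thE in htheta *; split.
  exact: (calabi_type_of_opposite hJ hD hDJ hDint hIdef hI htheta hu).
exists (fun x => expR (u x)).
exact: (special_kahler_ricci_of_opposite hJ hD hDJ hDint hIdef hI htheta hu).
Qed.
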